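(* Let $A=(A_1,\ldots,A_N)$ be an $N$-tuple of complex $n\times m$ matrices with $\bigcap_{\ell}\ker A_\ell=\{0\}$ and $\bigcap_\ell\ker A_\ell^\dagger=\{0\}$, and suppose that $A$ is not $(\mathbf{1}/n,\mathbf{1}/m)$-scalable. Let $(g_k,h_k)$ be the sequence in $SL_n(\mathbb C)\times SL_m(\mathbb C)$ defined, with $L=2$, by $$(g_{k+1},h_{k+1}) = \Bigl(e^{-\frac{1}{2L} \mu_1(g_kAh_k^{\dagger})} g_k,\ e^{-\frac{1}{2L}\mu_2(g_kAh_k^{\dagger})} h_k \Bigr),\qquad (g_0,h_0) = (I,I).$$ Let $\hat B$ be a diagonalized DM-decomposition of $A$, and let $B^*$ be a $(p^*+\mathbf{1}/n,q^*+\mathbf{1}/m)$-scaling of $\hat B$. Then $[g_kAh_k^{\dagger}]$ accumulates to points in $[SU_n \cdot B^* \cdot SU_m]=\{[\sigma B^*\tau^\dagger]\mid\sigma\in SU_n,\tau\in SU_m\}$ for $k \to \infty$; that is, every accumulation point of the sequence $[g_kAh_k^\dagger]$ in the complex projective space $\mathbb{P}(\mathbb{C}^{N(n\times m)})$ belongs to this set.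
   Context: $n,m,N\ge1$; $\dagger$ is conjugate transpose; $\mathbb{C}^{N(n\times m)}$ is the space of $N$-tuples of complex $n\times m$ matrices; $gBh^\dagger:=(gB_1h^\dagger,\ldots,gB_Nh^\dagger)$; $\|B\|^2:=\sum_\ell\mathrm{tr}\,B_\ell B_\ell^\dagger$; $[B]$ is the class of $B\neq 0$ in projective space. $\mathbf 1$ is the all-ones vector and $\mathbf{1}_X$ the indicator vector of $X$. $\mu(B)=(\mu_1(B),\mu_2(B))=\frac{1}{\|B\|^2}\bigl(\sum_\ell B_\ell B_\ell^\dagger,\sum_\ell B_\ell^\dagger B_\ell\bigr)-\bigl(\frac1nI,\frac1mI\bigr)$. For nonnegative vectors $p\in\mathbb{R}^n,q\in\mathbb{R}^m$ with equal sums, a tuple $gBh^\dagger$ ($g\in GL_n,h\in GL_m$) is a $(p,q)$-scaling of $B$ if $\sum_\ell gB_\ell h^\dagger hB_\ell^\dagger g^\dagger=\mathrm{diag}\,p$ and $\sum_\ell hB_\ell^\dagger g^\dagger gB_\ell h^\dagger=\mathrm{diag}\,q$. $A$ is $(\mathbf{1}/n,\mathbf{1}/m)$-scalable if for every $\epsilon>0$ there are $g\in GL_n,h\in GL_m$ with $\|\sum_\ell gA_\ell h^\dagger hA_\ell^\dagger g^\dagger-\frac1nI\|_{\rm F}^2+\|\sum_\ell hA_\ell^\dagger g^\dagger gA_\ell h^\dagger-\frac1mI\|_{\rm F}^2\le\epsilon^2$. DM-decomposition: $\mathcal{S}_A$ is the set of pairs of subspaces $X\subseteq\mathbb{C}^n,Y\subseteq\mathbb{C}^m$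 with $u^\top A_\ell\bar v=0$ for all $u\in X,v\in Y,\ell$. $\phi(X,Y):=(\dim X,\dim Y)$. $\mathcal{E}_A$ is the set of $(X,Y)\in\mathcal{S}_A$ such that $\phi(X,Y)$ is an extreme point, other than $(0,0)$, of $\mathrm{Conv}\,\phi(\mathcal{S}_A)$. It is finite and can be arranged as $\mathcal{E}_A=\{(X_\alpha,Y_\alpha)\}_{\alpha=0}^\theta$ with $\mathbb{C}^n=X_0\supset\cdots\supset X_\theta=\{0\}$, $\{0\}=Y_0\subset\cdots\subset Y_\theta=\mathbb{C}^m$ (strict inclusions). For $1\le\alpha\le\theta$, $\mathcal{L}_A^\alpha$ is the set of $(X,Y)\in\mathcal{S}_A$ with $\phi(X,Y)$ on the edge (segment) between $\phi(X_{\alpha-1},Y_{\alpha-1})$ and $\phi(X_\alpha,Y_\alpha)$; ordered by $(X,Y)\preceq(X',Y')\Leftrightarrow X\supseteq X',Y\subseteq Y'$ it is a modular lattice. Choose a maximal chain $(X_{\alpha-1},Y_{\alpha-1})=(X_{\alpha,0},Y_{\alpha,0})\prec\cdots\prec(X_{\alpha,\theta_\alpha},Y_{\alpha,\theta_\alpha})=(X_\alpha,Y_\alpha)$ of $\mathcal{L}_A^\alpha$ for each $\alpha$; the union of these chains is a DM-flag. Choose $g\in GL_n$ whose last $\dim X_{\alpha,\beta}$ rows form a basis of $X_{\alpha,\beta}$, and $h\in GL_m$ whose first $\dim Y_{\alpha,\beta}$ rows form a basis of $Y_{\alpha,\beta}$, for all $\alpha,\beta$. Then $B=gAh^\dagger$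 is called a DM-decomposition of $A$. Let $I_{\alpha,\beta}\subseteq\{1,\ldots,n\}$ be the set of indices among the last $\dim X_{\alpha,\beta-1}$ but not among the last $\dim X_{\alpha,\beta}$, and $J_{\alpha,\beta}\subseteq\{1,\ldots,m\}$ the set of indices among the first $\dim Y_{\alpha,\beta}$ but not among the first $\dim Y_{\alpha,\beta-1}$ ($1\le\beta\le\theta_\alpha$). Each $B_\ell$ is block upper triangular for these partitions; the diagonalized DM-decomposition $\hat B=(\hat B_\ell)$ is obtained by replacing every off-diagonal block $B_\ell[I_{\alpha,\beta},J_{\alpha',\beta'}]$, $(\alpha,\beta)\ne(\alpha',\beta')$, by zero. Put $I_\alpha:=\bigcup_\beta I_{\alpha,\beta}$, $J_\alpha:=\bigcup_\beta J_{\alpha,\beta}$, $n_\alpha:=|I_\alpha|$, $m_\alpha:=|J_\alpha|$, $C_A:=\sum_{\alpha=1}^\theta\frac{n_\alpha m_\alpha}{n_\alpha+m_\alpha}$ and $$p^*:=-\frac1n\mathbf{1}+\frac1{C_A}\sum_{\alpha}\frac{m_\alpha}{n_\alpha+m_\alpha}\mathbf{1}_{I_\alpha},\qquad q^*:=-\frac1m\mathbf{1}+\frac1{C_A}\sum_{\alpha}\frac{n_\alpha}{n_\alpha+m_\alpha}\mathbf{1}_{J_\alpha}.$$ *)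

(* Defs.v *)
From HB Require Import structures.
From mathcomp Require Import all_boot all_order all_algebra.
From mathcomp Require Import all_classical all_reals all_analysis.
From mathcomp Require Import complex.

Set Implicit Arguments.
Unset Strict Implicit.
Unset Printing Implicit Defensive.

Import Order.TTheory GRing.Theory Num.Theory.
Import numFieldNormedType.Exports.

Local Open Scope ring_scope.
Local Open Scope complex_scope.
Local Open Scope sesquilinear_scope.
Local Open Scope quotient_scope.

(* The library gives R[i] no topology; this is the one of the complex modulus. *)
HB.instance Definition _ (R : realType) := PseudoPointedMetric.copy R[i] R[i]^o.
HB.instance Definition _ (R : realType) := NormedModule.copy R[i] R[i]^o.

Section MatrixTuples.
Variables (R : realType) (n m N : nat).
Local Notation C := R[i].
Implicit Types (B : 'I_N -> 'M[C]_(n, m)) (g : 'M[C]_n) (h : 'M[C]_m).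

Definition act g h B : 'I_N -> 'M[C]_(n, m) := fun l => g *m B l *m h ^t*.

Definition lgram B : 'M[C]_n := \sum_l B l *m (B l) ^t*.
Definition rgram B : 'M[C]_m := \sum_l (B l) ^t* *m B l.
Definition normsq B : C := \sum_l \tr (B l *m (B l) ^t*).

Definition mu1 B : 'M[C]_n := (normsq B)^-1 *: lgram B - (n%:R^-1)%:M.
Definition mu2 B : 'M[C]_m := (normsq B)^-1 *: rgram B - (m%:R^-1)%:M.

(* p, q >= 0 and the equality of their sums follow from the two equations. *)
Definition is_scaling (p : 'rV[R]_n) (q : 'rV[R]_m) B B' : Prop :=
  exists g h, [/\ g \in unitmx, h \in unitmx, B' = act g h B,
    lgram B' = diag_mx (map_mx (real_complex R) p) &
    rgram B' = diag_mx (map_mx (real_complex R) q)].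

End MatrixTuples.

Definition frobsq (R : realType) n (X : 'M[R[i]]_n) : R[i] := \tr (X *m X ^t*).

Definition uniform_scalable (R : realType) n m N
    (A : 'I_N -> 'M[R[i]]_(n, m)) : Prop :=
  forall eps : R, 0 < eps -> exists g h, [/\ g \in unitmx, h \in unitmx &
    frobsq (lgram (act g h A) - (n%:R^-1)%:M) +
    frobsq (rgram (act g h A) - (m%:R^-1)%:M) <= (eps ^+ 2)%:C].

Definition expmx (R : realType) n (X : 'M[R[i]]_n) : 'M[R[i]]_n :=
  limn (series (fun k => k`!%:R^-1 *: X ^+ k)).

Fixpoint descent (R : realType) n m N (L : R[i]) (A : 'I_N -> 'M[R[i]]_(n, m))
    (k : nat) : 'M[R[i]]_n * 'M[R[i]]_m :=
  if k is k'.+1 then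
    let: (g, h) := descent L A k' in
    (expmx (- (2 * L)^-1 *: mu1 (act g h A)) *m g,
     expmx (- (2 * L)^-1 *: mu2 (act g h A)) *m h)
  else (1%:M, 1%:M).

Section Projective.
Local Open Scope classical_set_scope.
Variables (R : realType) (n m N : nat).
Local Notation C := R[i].

Definition nonzero_tuple : set {ptws 'I_N -> 'M[C]_(n, m)} :=
  [set B | exists l, B l != 0].

Definition proportional (B B' : nonzero_tuple) : bool :=
  `[< exists2 c : C, c != 0 & forall l, set_val B' l = c *: set_val B l >].

Lemma proportional_equiv : equiv_class_of proportional.
Proof.
have sym : symmetric proportional.
  suff H B B' : proportional B B' -> proportional B' B.
    by move=> B B'; apply/idP/idP; exact: H.
  move=> /asboolP[c c0 e]; apply/asboolP; exists c^-1; first by rewrite invr_eq0.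
  by move=> l; rewrite e scalerA mulVf// scale1r.
split=> //.
- by move=> B; apply/asboolP; exists 1; [exact: oner_neq0|]
    => l; rewrite scale1r.
- move=> B1 B2 B3 /asboolP[c c0 e] /asboolP[d d0 f]; apply/asboolP.
  by exists (d * c); [rewrite mulf_neq0|] => // l; rewrite f e scalerA.
Qed.

Canonical proportional_rel := EquivRelPack proportional_equiv.

Definition projective : Type := quotient_topology {eq_quot proportional_rel}.
HB.instance Definition _ := Topological.on projective.

End Projective.

Section ProjectiveClass.
Local Open Scope classical_set_scope.
Variables (R : realType) (n m N : nat).
Local Notation C := R[i].

Fact ones_nonzero : ((fun=> const_mx 1) : {ptws 'I_N.+1 -> 'M[C]_(n.+1, m.+1)})
  \in @nonzero_tuple R n.+1 m.+1 N.+1.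
Proof.
rewrite inE; exists ord0; apply/eqP => /matrixP/(_ ord0 ord0)/eqP.
by rewrite !mxE oner_eq0.
Qed.

Definition ones_tuple : @nonzero_tuple R n.+1 m.+1 N.+1 :=
  @exist _ (fun B => B \in _) _ ones_nonzero.

(* The class [B]; the zero tuple, which has none, is sent to the class of the
   all-ones tuple. *)
Definition pclass (B : 'I_N.+1 -> 'M[C]_(n.+1, m.+1)) : projective R n.+1 m.+1 N.+1 :=
  \pi_(projective R n.+1 m.+1 N.+1)
    (insubd ones_tuple B).

End ProjectiveClass.

Definition SU (R : realType) (d : nat) : set 'M[R[i]]_d :=
  [set s | s \is unitarymx /\ \det s = 1]%classic.
Arguments SU : clear implicits.

Section Convexity.
Local Open Scope classical_set_scope.
Variables (R : realType) (M : lmodType R).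

Definition conv_hull (S : set M) : set M := smallest (@convex_set R M) S.

Definition segment (a b : M) : set M :=
  [set x | exists2 t : R, 0 <= t <= 1 & x = (1 - t) *: a + t *: b].

Definition extreme_point (K : set M) (x : M) : Prop :=
  K x /\ forall (a b : M) (t : R), K a -> K b -> 0 < t < 1 ->
    x = (1 - t) *: a + t *: b -> a = x /\ b = x.

End Convexity.

Section DM.
Variables (R : realType) (n m : nat).
Local Notation C := R[i].

Definition vpair : Type := {vspace 'cV[C]_n} * {vspace 'cV[C]_m}.

Definition phi (Z : vpair) : R^o * R^o := ((\dim Z.1)%:R, (\dim Z.2)%:R).

Definition vle (Z Z' : vpair) : Prop := (Z'.1 <= Z.1)%VS /\ (Z.2 <= Z'.2)%VS.
Definition vlt (Z Z' : vpair) : Prop := vle Z Z' /\ Z <> Z'.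

(* (X_a, Y_a) is dm_ext a for 0 <= a <= theta, and (X_{a,b}, Y_{a,b}) is
   dm_chain a b for 1 <= a <= theta, 0 <= b <= theta_a = dm_len a; the values at
   other indices are irrelevant. *)
Record dm_flag := DMFlag {
  dm_theta : nat;
  dm_ext : nat -> vpair;
  dm_len : nat -> nat;
  dm_chain : nat -> nat -> vpair }.

Section Tuple.
Variables (N : nat) (A : 'I_N -> 'M[C]_(n, m)).

Definition vanishing (Z : vpair) : Prop :=
  forall u v l, u \in Z.1 -> v \in Z.2 -> u^T *m A l *m map_mx Num.Def.conjC v = 0.

Definition vanishing_extreme (Z : vpair) : Prop :=
  [/\ vanishing Z,
      extreme_point (conv_hull (phi @` vanishing)%classic) (phi Z) &
      phi Z <> (0, 0)].

Definition vanishing_edge (Z0 Z1 Z : vpair) : Prop :=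
  vanishing Z /\ segment (phi Z0) (phi Z1) (phi Z).

Definition maximal_chain (L : vpair -> Prop) (Z0 Z1 : vpair) (k : nat)
    (c : nat -> vpair) : Prop :=
  [/\ c 0%N = Z0, c k = Z1,
      forall b, (b <= k)%N -> L (c b),
      forall b, (b < k)%N -> vlt (c b) (c b.+1) &
      forall Z, L Z -> (forall b, (b <= k)%N -> vle Z (c b) \/ vle (c b) Z) ->
        exists2 b, (b <= k)%N & Z = c b].

Definition is_dm_flag (F : dm_flag) : Prop :=
  let t := dm_theta F in let E := dm_ext F in
  [/\ forall Z, vanishing_extreme Z <-> exists2 a, (a <= t)%N & Z = E a,
      E 0%N = (fullv, 0%VS) /\ E t = (0%VS, fullv),
      forall a, (a < t)%N ->
        [/\ ((E a.+1).1 <= (E a).1)%VS, (E a.+1).1 <> (E a).1,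
            ((E a).2 <= (E a.+1).2)%VS & (E a).2 <> (E a.+1).2] &
      forall a, (0 < a <= t)%N ->
        maximal_chain (vanishing_edge (E a.-1) (E a)) (E a.-1) (E a)
          (dm_len F a) (dm_chain F a)].

Definition is_dm_decomposition (F : dm_flag) (B : 'I_N -> 'M[C]_(n, m)) : Prop :=
  exists (g : 'M[C]_n) (h : 'M[C]_m),
  [/\ g \in unitmx, h \in unitmx,
      forall a b, (0 < a <= dm_theta F)%N -> (b <= dm_len F a)%N ->
        let X := (dm_chain F a b).1 in let Y := (dm_chain F a b).2 in
        basis_of X [seq (row i g)^T | i : 'I_n <- enum 'I_n & (n - \dim X <= i)%N] /\
        basis_of Y [seq (row j h)^T | j : 'I_m <- enum 'I_m & (j < \dim Y)%N] &
      B = act g h A].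

End Tuple.

Variable F : dm_flag.

Definition rblock (a b : nat) : {set 'I_n} :=
  [set i : 'I_n | (n - \dim (dm_chain F a b.-1).1 <= i < n - \dim (dm_chain F a b).1)%N].
Definition cblock (a b : nat) : {set 'I_m} :=
  [set j : 'I_m | (\dim (dm_chain F a b.-1).2 <= j < \dim (dm_chain F a b).2)%N].

Definition diagonalized (N : nat) (B : 'I_N -> 'M[C]_(n, m)) :
    'I_N -> 'M[C]_(n, m) :=
  fun l => \matrix_(i, j)
    if `[< exists a b, [/\ (0 < a <= dm_theta F)%N, (0 < b <= dm_len F a)%N,
                           i \in rblock a b & j \in cblock a b] >]
    then B l i j else 0.

Definition rpart (a : nat) : {set 'I_n} :=
  \bigcup_(1 <= b < (dm_len F a).+1) rblock a b.
Definition cpart (a : nat) : {set 'I_m} :=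
  \bigcup_(1 <= b < (dm_len F a).+1) cblock a b.

Local Notation na a := (#|rpart a|%:R : R).
Local Notation ma a := (#|cpart a|%:R : R).

Definition dm_const : R :=
  \sum_(1 <= a < (dm_theta F).+1) na a * ma a / (na a + ma a).

Definition indicator_row (d : nat) (X : {set 'I_d}) : 'rV[R]_d :=
  \row_i (i \in X)%:R.

Definition pstar : 'rV[R]_n :=
  - const_mx n%:R^-1 + dm_const^-1 *:
    \sum_(1 <= a < (dm_theta F).+1) (ma a / (na a + ma a)) *: indicator_row (rpart a).
Definition qstar : 'rV[R]_m :=
  - const_mx m%:R^-1 + dm_const^-1 *:
    \sum_(1 <= a < (dm_theta F).+1) (na a / (na a + ma a)) *: indicator_row (cpart a).

End DM.

(* Main.v *)
(* Write rho for the pair of Gram matrices divided by the squared norm, P = pstar + 1/n,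
   Q = qstar + 1/m, kappa = 1/C_A and x_k for the iterates. Since the moment map is a gradient with
   Lipschitz constant matched to the step 1/(2L), each step satisfies a cocoercivity inequality:
   |mu(x_k)| decreases and ln|x_k|^2 drops by at least half the pairing of two consecutive
   moments. In a DM-decomposition the tuple is block upper triangular, P_i + Q_j >= kappa on
   the nonzero blocks (with equality on the diagonal ones), and |P|^2 + |Q|^2 = kappa.
   Factoring g_k and h_k as unitary times triangular, the function
   Phi_k = sum_i P_i ln|t_ii|^2 + sum_j Q_j ln|s_jj|^2 bounds ln|x_k|^2 from below up to a
   constant, by the capacity of Bstar, while one step lowers it by at most xi |mu(x_k)| / 2, where
   xi^2 = kappa - 1/n - 1/m. Comparing the two rates gives lim |mu(x_k)| <= xi. A limit point y of
   x_k/|x_k|, rotated to be block upper triangular, then has |rho(y)|^2 <= kappa, which by the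
   inequality on the blocks forces rho(y) = (P, Q) and y block diagonal. So y and Bstar are two
   points of moment (P, Q) in the closure of an orbit of the centralizer of (P, Q), and they are
   unitarily equivalent by the Kempf-Ness argument. *)
Require Import Defs.
From mathcomp Require Import all_boot all_order all_algebra.
From mathcomp Require Import all_classical all_reals all_analysis.
From mathcomp Require Import complex ring lra.

Set Implicit Arguments.
Unset Strict Implicit.
Unset Printing Implicit Defensive.

Import Order.TTheory GRing.Theory Num.Theory.
Import numFieldNormedType.Exports.

Local Open Scope classical_set_scope.
Local Open Scope ring_scope.
Local Open Scope complex_scope.
Local Open Scope sesquilinear_scope.

(** * Hermitian and triangular matrices *)

Section Basics.
Variable R : realType.
Local Notation C := R[i].
Local Notation dg d := (diag_mx (map_mx (real_complex R) d)).
Implicit Types (z : C).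

(** The group elements need not stay bounded, so no limit of (g_k, h_k) is available: only their
    unitary factors are passed to the limit, and the triangular factors are controlled through the
    two scalars [ln |x_k|^2] and Phi. Phi is a Busemann function of the symmetric space of pairs of
    positive definite matrices. It lies above its linearization, which is why a step cannot lower it
    by more than the first order term. This requires P nonincreasing and Q nondecreasing, that is,
    the convexity of the polygon of extreme dimension vectors. The left factor is upper and the
    right one lower triangular because h acts through its adjoint; both then preserve block upper
    triangular tuples. The constant L = 2 is the one in |d x + x e|^2 <= 2 (|d|^2 + |e|^2) |x|^2.
    Between different blocks of one edge P_i + Q_j equals kappa too, so block diagonality of the
    limit rests on a second property: P and Q have equal sums up to each cut of the flag. Limits are
    taken along an ultrafilter, so that tuples, unitary factors and labels of eigenvalues all
    converge at once. *)

Definition sqmod z : R := complex.Re z ^+ 2 + complex.Im z ^+ 2.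

Lemma sqmodE z : (sqmod z)%:C = z * Num.conj z.
Proof. by rewrite add_Re2_Im2 sqr_normc. Qed.

Lemma sqmod_ge0 z : 0 <= sqmod z.
Proof. by rewrite addr_ge0 ?sqr_ge0. Qed.

Lemma sqmod_eq0 z : (sqmod z == 0) = (z == 0).
Proof.
rewrite paddr_eq0 ?sqr_ge0// !sqrf_eq0.
by case: z => a b; rewrite eq_complex /=.
Qed.

Lemma sqmodM z z' : sqmod (z * z') = sqmod z * sqmod z'.
Proof. by case: z => a b; case: z' => c d; rewrite /sqmod /=; ring. Qed.

Lemma sqmodR (a : R) : sqmod a%:C = a ^+ 2.
Proof. by rewrite /sqmod /= expr0n addr0. Qed.

Lemma sqmod0 : sqmod 0 = 0.
Proof. by apply/eqP; rewrite sqmod_eq0. Qed.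

Lemma sqmod1 : sqmod 1 = 1.
Proof. by rewrite /sqmod /= expr1n expr0n addr0. Qed.

Lemma sqmod_prod (J : Type) (r : seq J) (Q : pred J) (g : J -> C) :
  sqmod (\prod_(j <- r | Q j) g j) = \prod_(j <- r | Q j) sqmod (g j).
Proof. exact: (big_morph _ sqmodM sqmod1). Qed.

Lemma ln_prod (J : Type) (r : seq J) (Q : pred J) (g : J -> R) :
  (forall j, Q j -> 0 < g j) ->
  ln (\prod_(j <- r | Q j) g j) = \sum_(j <- r | Q j) ln (g j).
Proof.
move=> g0; have [//] : ln (\prod_(j <- r | Q j) g j) = \sum_(j <- r | Q j) ln (g j)
   /\ 0 < \prod_(j <- r | Q j) g j.
apply: (big_ind2 (fun a b => ln a = b /\ 0 < a)) => [|a1 b1 a2 b2 [<- a0] [<- a20]|j Qj].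
- by rewrite ln1 ltr01.
- by rewrite lnM ?posrE// mulr_gt0.
- by split; last exact: g0.
Qed.

Lemma ReD (z z' : C) : complex.Re (z + z') = complex.Re z + complex.Re z'.
Proof. by case: z; case: z'. Qed.

Lemma Re_sum (I : Type) (r : seq I) (P : pred I) (E : I -> C) :
  complex.Re (\sum_(i <- r | P i) E i) = \sum_(i <- r | P i) complex.Re (E i).
Proof. by elim/big_rec2: _ => //= i y1 y2 _ <-; rewrite ReD. Qed.

Lemma ReZ (a : R) z : complex.Re (a%:C * z) = a * complex.Re z.
Proof. by case: z => b c /=; rewrite mul0r subr0. Qed.

Lemma ReN z : complex.Re (- z) = - complex.Re z.
Proof. by case: z. Qed.

Lemma ReB (z z' : C) : complex.Re (z - z') = complex.Re z - complex.Re z'.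
Proof. by rewrite ReD ReN. Qed.

Lemma Re_conj z : complex.Re (Num.conj z) = complex.Re z.
Proof. by case: z. Qed.

Lemma conjR (a : R) : Num.conj (a%:C) = a%:C :> C.
Proof. by apply/eqP; rewrite eq_complex /= oppr0 !eqxx. Qed.

Lemma sumR (I : Type) (r : seq I) (P : pred I) (E : I -> R) :
  (\sum_(i <- r | P i) E i)%:C = \sum_(i <- r | P i) (E i)%:C :> C.
Proof. exact: raddf_sum. Qed.

Lemma adjM m n p (X : 'M[C]_(m, n)) (Y : 'M[C]_(n, p)) :
  (X *m Y) ^t* = Y ^t* *m X ^t*.
Proof. by rewrite trmx_mul map_mxM. Qed.

Lemma adjE m n (X : 'M[C]_(m, n)) i j : (X ^t*) i j = Num.conj (X j i).
Proof. by rewrite !mxE. Qed.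

Lemma adj_dg n (d : 'rV[R]_n) : (dg d) ^t* = dg d.
Proof.
apply/matrixP => i j; rewrite !mxE eq_sym; case: eqVneq => [->|_].
  by rewrite !mulr1n conjR.
by rewrite !mulr0n rmorph0.
Qed.

Lemma mul_dg n (d e : 'rV[R]_n) :
  dg d *m dg e = dg (\row_i (d 0 i * e 0 i)).
Proof.
rewrite mulmx_diag; congr diag_mx; apply/rowP => i.
by rewrite !mxE rmorphM.
Qed.

Lemma mul_dgl n m (d : 'rV[R]_n) (X : 'M[C]_(n, m)) i j :
  (dg d *m X) i j = (d 0 i)%:C * X i j.
Proof. by rewrite mul_diag_mx !mxE. Qed.

Lemma mul_dgr n m (d : 'rV[R]_m) (X : 'M[C]_(n, m)) i j :
  (X *m dg d) i j = X i j * (d 0 j)%:C.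
Proof. by rewrite mul_mx_diag !mxE. Qed.

Lemma unitary_mulV n (U : 'M[C]_n) : U \is unitarymx -> U *m U ^t* = 1%:M.
Proof. by move/unitarymxP. Qed.

Lemma unitary_mulVr n (U : 'M[C]_n) : U \is unitarymx -> U ^t* *m U = 1%:M.
Proof. by move=> h; apply: mulmx1C; apply: unitary_mulV. Qed.

Lemma unitary_adj n (U : 'M[C]_n) : (U ^t* \is unitarymx) = (U \is unitarymx).
Proof. exact: trmxC_unitary. Qed.

Lemma det_adj n (U : 'M[C]_n) : \det (U ^t*) = Num.conj (\det U).
Proof. by rewrite det_map_mx det_tr. Qed.

Lemma det_unitary n (U : 'M[C]_n) : U \is unitarymx -> sqmod (\det U) = 1.
Proof.
move=> /unitary_mulV/(congr1 determinant); rewrite det_mulmx det1.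
rewrite det_map_mx det_tr -sqmodE => /eqP; rewrite eq_complex /= => /andP[/eqP-> _].
by [].
Qed.

Lemma unitary_conjK n (U X : 'M[C]_n) : U \is unitarymx ->
  U ^t* *m (U *m X *m U ^t*) *m U = X.
Proof.
by move=> hU; rewrite !mulmxA unitary_mulVr// mul1mx -mulmxA unitary_mulVr// mulmx1.
Qed.

Lemma hermitian_spectral n (X : 'M[C]_n) : X ^t* = X ->
  exists (U : 'M[C]_n) (d : 'rV[R]_n), U \is unitarymx /\ X = U ^t* *m dg d *m U.
Proof.
move=> hX.
have Xh : X \is hermsymmx by apply/is_hermitianmxP; rewrite expr0 scale1r.
have /orthomx_spectralP := hermitian_normalmx Xh.
have := hermitian_spectral_diag_real Xh; have := spectral_unitarymx X.
move: (spectralmx X) (spectral_diag X) => U d hU /mxOverP hd eX.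
exists U, (\row_i complex.Re (d 0 i)); split=> //.
have eU : invmx U = U ^t* by exact: invmx_unitary.
have ed : map_mx (real_complex R) (\row_i complex.Re (d 0 i)) = d.
  by apply/rowP => i; rewrite !mxE RRe_real.
by rewrite ed -eU; exact: eX.
Qed.

(* A unitary triangularization of commuting Hermitian matrices diagonalizes both. *)
Lemma commuting_spectral n (X : 'M[C]_n) (p : 'rV[R]_n) : X ^t* = X ->
  X *m dg p = dg p *m X ->
  exists (U : 'M[C]_n) (d : 'rV[R]_n) (s : 'I_n -> 'I_n),
   [/\ U \is unitarymx, X = U ^t* *m dg d *m U &
       U *m dg p *m U ^t* = dg (\row_i p 0 (s i))].
Proof.
move=> hX cX.
have cc : {in [:: X; dg p] &, forall A B : 'M[C]_n, comm_mx A B}.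
  move=> A B; rewrite !inE => /orP[]/eqP-> /orP[]/eqP->; rewrite /comm_mx //.
have [U hU /allP hall] := cotrigonalization cc.
have tX : is_trig_mx (U *m X *m U ^t*).
  have := hall X (mem_head _ _); rewrite inE /= => hX'.
  by rewrite -(conjymx X hU); exact: hX'.
have tP : is_trig_mx (U *m dg p *m U ^t*).
  have := hall (dg p) (mem_last X [:: dg p]); rewrite inE /= => hX'.
  by rewrite -(conjymx (dg p) hU); exact: hX'.
have diagT (Z : 'M[C]_n) : Z ^t* = Z -> is_trig_mx (U *m Z *m U^t*) ->
    U *m Z *m U^t* = dg (\row_i complex.Re ((U *m Z *m U^t*) i i)).
  move=> hZ /is_trig_mxP tZ.
  have hh : (U *m Z *m U^t*)^t* = U *m Z *m U^t*.
    by rewrite !adjM trmxCK hZ mulmxA.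
  apply/matrixP => i j; rewrite !mxE; case: (ltngtP i j) => ij.
  - rewrite (_ : (i == j) = false); last by apply/negbTE; rewrite neq_ltn ij.
    by have := tZ _ _ ij; rewrite mxE.
  - rewrite (_ : (i == j) = false); last by apply/negbTE; rewrite neq_ltn ij orbT.
    have := congr1 (fun M : 'M[C]_n => M i j) hh; rewrite adjE tZ// rmorph0 => e.
    by move: e; rewrite mxE => <-.
  - move/val_inj : ij => <-; rewrite eqxx mulr1n.
    have := congr1 (fun M : 'M[C]_n => M i i) hh; rewrite adjE.
    set w := (_ *m _) i i => hw; have -> : \sum_j (U *m Z) i j * U^t* j i = w by rewrite /w mxE.
    move: hw; case: (w) => a b /eqP; rewrite eq_complex /= => /andP[_ /eqP hb].
    by apply/eqP; rewrite eq_complex /= eqxx; apply/eqP; lra.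
have eX := diagT _ hX tX; have eP := diagT _ (adj_dg p) tP.
set p' := (\row_i _) in eP.
(* Row [i] of [U] has a nonzero entry, say at [j]; comparing the entries [(i, j)] of
   [U *m dg p = dg p' *m U] gives [p' 0 i = p 0 j]. The map [s] so chosen need not be a
   permutation. *)
have hs i : exists j, p' 0 i = p 0 j.
  have [j hj] : exists j, U i j != 0.
    apply/existsP; apply: contraT; rewrite negb_exists => /forallP h0.
    have := congr1 (fun M : 'M[C]_n => M i i) (unitary_mulV hU).
    rewrite !mxE eqxx big1 => [/eqP|j _]; first by rewrite eq_sym oner_eq0.
    by have := h0 j; rewrite negbK => /eqP->; rewrite mul0r.
  exists j.
  have /(congr1 (fun M : 'M[C]_n => (M *m U) i j)) := eP.
  rewrite -(mulmxA (U *m dg p)) (unitary_mulVr hU) mulmx1 mul_dgr mul_dgl mulrC => /(mulIf hj) /eqP.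
  by rewrite eq_complex /= eqxx andbT => /eqP.
have [s hs'] := choice hs.
exists U, (\row_i complex.Re ((U *m X *m U^t*) i i)), s; split=> //.
  by rewrite -eX unitary_conjK.
by rewrite eP; congr diag_mx; congr map_mx; apply/rowP => i; rewrite hs' mxE.
Qed.

End Basics.

(** * Triangular matrices and the QR and QL decompositions *)

Section Triangular.
Variable R : realType.
Local Notation C := R[i].
Local Notation dg d := (diag_mx (map_mx (real_complex R) d)).

Definition upper n (T : 'M[C]_n) := forall i j : 'I_n, (j < i)%N -> T i j = 0.
Definition lower n (T : 'M[C]_n) := forall i j : 'I_n, (i < j)%N -> T i j = 0.

Lemma upper_det n (T : 'M[C]_n) : upper T -> \det T = \prod_i T i i.
Proof.
move=> hT; rewrite -det_tr det_trig; first by apply: eq_bigr => i _; rewrite mxE.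
by apply/is_trig_mxP => i j ij; rewrite mxE hT.
Qed.

Lemma lower_det n (T : 'M[C]_n) : lower T -> \det T = \prod_i T i i.
Proof. by move=> hT; rewrite det_trig//; apply/is_trig_mxP => i j; exact: hT. Qed.

Lemma upper_diag_neq0 n (T : 'M[C]_n) i : upper T -> T \in unitmx -> T i i != 0.
Proof. by move=> /upper_det; rewrite unitmxE unitfE => -> /prodf_neq0->. Qed.

Lemma lower_diag_neq0 n (T : 'M[C]_n) i : lower T -> T \in unitmx -> T i i != 0.
Proof. by move=> /lower_det; rewrite unitmxE unitfE => -> /prodf_neq0->. Qed.

Lemma upper_adj n (T : 'M[C]_n) : upper T -> lower (T ^t*).
Proof. by move=> hT i j ij; rewrite adjE hT// rmorph0. Qed.

Lemma lower_adj n (T : 'M[C]_n) : lower T -> upper (T ^t*).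
Proof. by move=> hT i j ij; rewrite adjE hT// rmorph0. Qed.

Lemma upperM n (S T : 'M[C]_n) : upper S -> upper T -> upper (S *m T).
Proof.
move=> hS hT i j ij; rewrite mxE big1// => k _.
have [ki|ik] := ltnP k i; first by rewrite hS// mul0r.
by rewrite hT ?mulr0// (leq_trans ij).
Qed.

Lemma upperM_diag n (S T : 'M[C]_n) i : upper S -> upper T ->
  (S *m T) i i = S i i * T i i.
Proof.
move=> hS hT; rewrite mxE (bigD1 i)//= big1 ?addr0// => k ki.
have [|ik] := ltnP k i; first by move=> h; rewrite hS// mul0r.
by rewrite hT ?mulr0// ltn_neqAle eq_sym ki.
Qed.

Lemma lowerM n (S T : 'M[C]_n) : lower S -> lower T -> lower (S *m T).
Proof.
move=> hS hT; rewrite -[_ *m _]trmxCK adjM.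
by apply/upper_adj/upperM; apply: lower_adj.
Qed.

Lemma lowerM_diag n (S T : 'M[C]_n) i : lower S -> lower T ->
  (S *m T) i i = S i i * T i i.
Proof.
move=> hS hT; rewrite -[_ *m _]trmxCK adjM adjE upperM_diag; last 2 first.
- exact: lower_adj.
- exact: lower_adj.
by rewrite !adjE rmorphM /= !conjCK mulrC.
Qed.

(** Strong induction on the column [j]: in the entry [(i, j)] of [invmx T *m T = 1] the terms of
    index below [j] vanish by induction and those above because [T] is upper, which leaves
    [invmx T i j * T j j = 0]. *)
Lemma upper_inv n (T : 'M[C]_n) : upper T -> T \in unitmx -> upper (invmx T).
Proof.
move=> hT uT i j; have [k] := ubnP j; elim: k i j => // k IH i j jk ji.
have := congr1 (fun M : 'M[C]_n => M i j) (mulVmx uT).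
rewrite !mxE (bigD1 j)//= big1 => [|l lj].
  rewrite addr0 -val_eqE /= gtn_eqF// mulr0n => /eqP; rewrite mulf_eq0 => /orP[/eqP//|].
  by rewrite (negbTE (upper_diag_neq0 _ _ _)).
have [lltj|] := ltnP l j; last by move=> jl; rewrite hT ?mulr0// ltn_neqAle eq_sym lj.
by rewrite IH ?mul0r//; [exact: leq_trans lltj _ | exact: ltn_trans lltj _].
Qed.

Lemma lower_inv n (T : 'M[C]_n) : lower T -> T \in unitmx -> lower (invmx T).
Proof.
move=> hT uT; rewrite -[invmx T]trmxCK; apply: upper_adj.
have e : (invmx T) ^t* = invmx (T ^t*) by rewrite trmx_inv map_invmx.
by rewrite e; apply: upper_inv; [exact: lower_adj|rewrite map_unitmx unitmx_tr].
Qed.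

(** Schmidt orthonormalization of the rows of [G ^t*]: row [j] lies in the span of the rows of [Q]
    up to [j], hence is orthogonal to row [i > j], and this inner product is the conjugate of the
    entry [(i, j)] of [Q *m G]. *)
Lemma qr_decomposition n (G : 'M[C]_n) :
  exists u t : 'M[C]_n, [/\ u \is unitarymx, G = u *m t & upper t].
Proof.
pose Q := schmidt (G ^t*).
have uQ : Q \is unitarymx by apply: schmidt_unitarymx.
exists (Q ^t*), (Q *m G); split; first by rewrite unitary_adj.
  by rewrite mulmxA unitary_mulVr// mul1mx.
move=> i j ji.
have -> : (Q *m G) i j = Num.conj ((G ^t* *m Q ^t*) j i).
  by rewrite -adjM adjE conjCK.
suff -> : (G ^t* *m Q ^t*) j i = 0 by rewrite rmorph0.
have h : (row j (G ^t*) <= kermx (col i (Q ^t*)))%MS.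
  apply: submx_trans (row_schmidt_sub _ _) _; apply/sumsmx_subP => k kj.
  rewrite genmxE sub_kermx -/Q; apply/eqP/matrixP => a b; rewrite !mxE.
  have := congr1 (fun M : 'M[C]_n => M k i) (unitary_mulV uQ).
  rewrite !mxE (_ : (k == i) = false); last by rewrite -val_eqE /= ltn_eqF// (leq_ltn_trans kj).
  rewrite mulr0n => h; rewrite -[RHS]h.
  by apply: eq_bigr => l _; rewrite !mxE.
move: h; rewrite sub_kermx => /eqP/matrixP/(_ 0 0); rewrite !mxE => h; rewrite -[RHS]h.
by apply: eq_bigr => l _; rewrite !mxE.
Qed.

(** Inverting and taking adjoints fixes the unitary factor of a QR decomposition and turns its upper
    factor into a lower one. *)
Lemma ql_decomposition n (G : 'M[C]_n) : G \in unitmx ->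
  exists u t : 'M[C]_n, [/\ u \is unitarymx, G = u *m t & lower t].
Proof.
move=> uG; have [u [t [uu et ht]]] := qr_decomposition (invmx (G ^t*)).
have uG' : G ^t* \in unitmx by rewrite map_unitmx unitmx_tr.
have ut : t \in unitmx.
  by have : u *m t \in unitmx; [rewrite -et unitmx_inv|rewrite unitmx_mul => /andP[]].
exists u, ((invmx t) ^t*); split=> //; last by apply/upper_adj/upper_inv.
have e : G ^t* = invmx t *m u ^t*.
  have h : G ^t* *m (u *m t) = 1%:M by rewrite -et mulmxV.
  by rewrite -[RHS]mul1mx -h !mulmxA mulmxK// -mulmxA unitary_mulV// mulmx1.
by rewrite -[G]trmxCK e adjM trmxCK.
Qed.

End Triangular.

(** * Compression of a Gram matrix by an orthogonal projection *)

Section ProjectionGram.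
Variables (K : numClosedFieldType) (n : nat) (E : 'M[K]_n).
Hypotheses (EE : E *m E = E) (aE : E ^t* = E).

Let F := 1%:M - E.

Let FF : F *m F = F.
Proof. by rewrite /F mulmxBl mul1mx mulmxBr mulmx1 EE subrr subr0. Qed.

Let aF : F ^t* = F.
Proof.
rewrite -[in RHS]/F /F -[in RHS]aE; apply/matrixP => i j.
by rewrite !mxE rmorphB/= rmorph_nat eq_sym.
Qed.

Let adM (X Y : 'M[K]_n) : (X *m Y) ^t* = Y ^t* *m X ^t*.
Proof. by rewrite trmx_mul map_mxM. Qed.

(** The hypothesis says that [T] preserves the range of [E]; the cross terms of the product
    therefore vanish. *)
Lemma projection_gram (T : 'M[K]_n) : F *m (T *m E) = 0 ->
  (T *m E + F) ^t* *m (T *m E + F) = E *m (T ^t* *m T) *m E + F.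
Proof.
move: F FF aF => F' FF' aF' h0.
have h0' : E *m T ^t* *m F' = 0.
  by have := congr1 (fun X : 'M[K]_n => X ^t*) h0; rewrite !adM aE aF' trmx0 map_mx0.
have -> : (T *m E + F') ^t* = E *m T ^t* + F'.
  by rewrite -[in RHS]aE -adM -[in RHS]aF'; apply/matrixP => i j; rewrite !mxE rmorphD.
rewrite mulmxDl !mulmxDr h0 h0' FF' addr0 add0r.
by rewrite !mulmxA.
Qed.

(** Meant for [W] diagonalizing the compressed Gram matrix: each eigenvalue is then a combination of
    the entries of a diagonal [D] with weights [|A i j|^2], of total at most 1 by the second
    identity, the missing weight being put on the value 1. *)
Lemma projection_conj (W V D : 'M[K]_n) : W \is unitarymx -> V \is unitarymx ->
  let A := W *m E *m V ^t* in
  W *m (E *m (V ^t* *m D *m V) *m E + F) *m W ^t* = A *m D *m A ^t* + (1%:M - A *m A ^t*) /\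
  A *m A ^t* + (W *m F) *m (W *m F) ^t* = 1%:M.
Proof.
move=> uW uV A.
have eA : A ^t* = V *m E *m W ^t* by rewrite /A !adM trmxCK aE mulmxA.
have AA : A *m A ^t* = W *m E *m W ^t*.
  rewrite eA /A; transitivity (W *m E *m (V ^t* *m V) *m E *m W ^t*).
    by rewrite !mulmxA.
  have -> : V ^t* *m V = 1%:M by apply: mulmx1C; apply/unitarymxP.
  by rewrite mulmx1 -(mulmxA W) EE.
have FW : W *m F *m (W *m F) ^t* = W *m F *m W ^t*.
  by rewrite adM aF mulmxA -(mulmxA W) FF.
have sum1 : W *m E *m W ^t* + W *m F *m W ^t* = 1%:M.
  rewrite -mulmxDl -mulmxDr /F addrC subrK mulmx1; exact/unitarymxP.
rewrite AA FW; split=> //.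
rewrite mulmxDr mulmxDl; congr (_ + _); last first.
  by apply/eqP; rewrite eq_sym subr_eq addrC sum1.
by rewrite eA /A !mulmxA.
Qed.

End ProjectionGram.

(** * Jensen's inequality and the diagonal of a triangular factor *)

Section Jensen.
Variable R : realType.
Local Notation C := R[i].
Local Notation dg d := (diag_mx (map_mx (real_complex R) d)).

(** The missing mass [1 - \sum_i w i] sits at 0, where [expR] is 1. Each term is bounded below by
    the tangent of [expR] at the mean [a]; for the missing mass this reads
    [expR a * (1 - a) <= 1]. *)
Lemma jensen_expR (I : finType) (w y : I -> R) : (forall i, 0 <= w i) ->
  \sum_i w i <= 1 ->
  expR (\sum_i w i * y i) <= \sum_i w i * expR (y i) + (1 - \sum_i w i).
Proof.
move=> w0 w1; set a := \sum_i w i * y i.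
have h i : w i * (expR a * (1 + (y i - a))) <= w i * expR (y i).
  rewrite ler_wpM2l// -[in leRHS](subrKC a (y i)) expRD ler_wpM2l ?expR_ge0//.
  exact: expR_ge1Dx.
have := ler_sum (index_enum I) (fun i (_ : true) => h i).
have -> : \sum_i w i * (expR a * (1 + (y i - a))) = expR a * ((1 - a) * \sum_i w i + a).
  rewrite mulrDr mulr_sumr /a mulr_sumr mulr_sumr -big_split /=.
  by apply: eq_bigr => i _; rewrite -/a; ring.
have h0 : expR a * (1 - a) <= 1.
  have := expR_ge1Dx (- a); rewrite expRN => h1.
  by apply: le_trans (ler_wpM2l (expR_ge0 a) h1) _; rewrite divff// gt_eqF ?expR_gt0.
have := ler_wpM2l (_ : 0 <= 1 - \sum_i w i) h0; rewrite subr_ge0 => /(_ w1).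
move: (expR a) (\sum_i w i) (\sum_(i : I) w i * expR (y i)) => e s t; lra.
Qed.

Lemma diag_conj n m (A : 'M[C]_(n, m)) (d : 'rV[R]_m) i :
  (A *m dg d *m A ^t*) i i = (\sum_j d 0 j * sqmod (A i j))%:C.
Proof.
rewrite mxE sumR; apply: eq_bigr => j _.
by rewrite mul_dgr adjE rmorphM /= sqmodE; ring.
Qed.

(* [T E + (1 - E)], with [E] the projection on the coordinates in [I], has determinant
   [\prod_(i in I) T i i]; its Gram matrix is [E H E + (1 - E)], whose eigenvalues are
   bounded below by Jensen's inequality. *)
Lemma ln_diag_ge n (T V : 'M[C]_n) (e : 'rV[R]_n) (I : {set 'I_n}) :
  upper T \/ lower T -> V \is unitarymx ->
  T ^t* *m T = V ^t* *m dg (map_mx expR e) *m V ->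
  (forall i j, j \in I -> i \notin I -> T i j = 0) ->
  \sum_(i in I) complex.Re ((V ^t* *m dg e *m V) i i) <=
  \sum_(i in I) ln (sqmod (T i i)).
Proof.
move=> hT uV eT hI.
pose E : 'M[C]_n := dg (\row_i (i \in I)%:R).
pose T' : 'M[C]_n := T *m E + (1%:M - E).
have T'E i j : T' i j = T i j * (j \in I)%:R + ((i == j)%:R - (i == j)%:R * (j \in I)%:R).
  rewrite !mxE; congr (_ + _).
    rewrite (bigD1 j)//= big1 => [|k kj]; last by rewrite !mxE (negbTE kj) mulr0n mulr0.
    by rewrite !mxE eqxx mulr1n addr0 rmorph_nat.
  case: eqVneq => [->|]; first by rewrite !mulr1n rmorph_nat mul1r.
  by rewrite !mulr0n mul0r.
have T'd i : T' i i = if i \in I then T i i else 1.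
  by rewrite T'E eqxx; case: (i \in I); rewrite ?mulr1 ?mulr0 ?subrr ?addr0 ?subr0 ?add0r.
have dT' : \det T' = \prod_(i in I) T i i.
  have -> : \det T' = \prod_i T' i i.
    case: hT => hT; [apply: upper_det|apply: lower_det] => i j ij;
    by rewrite T'E hT// mul0r -val_eqE /= ?(gtn_eqF ij) ?(ltn_eqF ij) mul0r subrr addr0.
  by rewrite [RHS]big_mkcond; apply: eq_bigr => i _; rewrite T'd.
have EE : E *m E = E.
  rewrite mul_dg; congr diag_mx; congr map_mx; apply/rowP => i; rewrite !mxE.
  by case: (i \in I); rewrite ?mulr0 ?mulr1.
have aE : E ^t* = E by exact: adj_dg.
pose H := T ^t* *m T.
have hTE : (1%:M - E) *m (T *m E) = 0.
  rewrite mulmxBl mul1mx; apply/matrixP => i j; rewrite mxE [X in _ + X]mxE mul_dgl mul_dgr [RHS]mxE !mxE.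
  case jI : (j \in I); last by rewrite !mulr0 subrr.
  case iI : (i \in I); first by rewrite mul1r subrr.
  by rewrite hI ?iI// mul0r mulr0 subrr.
have gT' := projection_gram EE aE hTE.
have hM : (T' ^t* *m T') ^t* = T' ^t* *m T' by rewrite adjM trmxCK.
have [W [f [uW eM]]] := hermitian_spectral hM.
have [eA eA1] := projection_conj EE aE (dg (map_mx expR e)) uW uV.
have [A defA] : exists A, A = W *m E *m V ^t* by exists (W *m E *m V ^t*).
rewrite /= -defA in eA eA1.
have WM : W *m (T' ^t* *m T') *m W ^t* = dg f.
  by rewrite eM; have := unitary_conjK (dg f) (etrans (unitary_adj W) uW); rewrite trmxCK.
have fE i : f 0 i = \sum_j sqmod (A i j) * expR (e 0 j) + (1 - \sum_j sqmod (A i j)).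
  have : dg f = A *m dg (map_mx expR e) *m A ^t* + (1%:M - A *m dg (const_mx 1) *m A ^t*).
    have -> : dg (const_mx 1 : 'rV[R]_n) = 1%:M by apply/matrixP => i1 j1; rewrite !mxE.
    by rewrite -WM gT' eT mulmx1; exact: eA.
  have addE (M M' : 'M[C]_n) : (M + M') i i = M i i + M' i i by rewrite mxE.
  have subE (M M' : 'M[C]_n) : (M - M') i i = M i i - M' i i by rewrite !mxE.
  have dgE (d : 'rV[R]_n) : (dg d) i i = (d 0 i)%:C by rewrite !mxE eqxx mulr1n.
  have oneE : (1%:M : 'M[C]_n) i i = 1 by rewrite mxE eqxx.
  move=> /(congr1 (fun M : 'M[C]_n => complex.Re (M i i))).
  rewrite addE subE !diag_conj oneE dgE ReD ReB /= => ->; congr (_ + (_ - _)).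
    by apply: eq_bigr => j _; rewrite mxE mulrC.
  by apply: eq_bigr => j _; rewrite mxE mul1r.
(* By [eA1], row [i] of [A] has squared norm at most 1, the other summand having a nonnegative
   diagonal. *)
have fge i : expR (\sum_j sqmod (A i j) * e 0 j) <= f 0 i.
  rewrite fE; apply: jensen_expR => [j|]; first exact: sqmod_ge0.
  have sq (B : 'M[C]_n) : complex.Re ((B *m B ^t*) i i) = \sum_j sqmod (B i j).
    by rewrite mxE Re_sum; apply: eq_bigr => j _; rewrite adjE -sqmodE.
  have addE (M M' : 'M[C]_n) : (M + M') i i = M i i + M' i i by rewrite mxE.
  have oneE : (1%:M : 'M[C]_n) i i = 1 by rewrite mxE eqxx.
  have := congr1 (fun M : 'M[C]_n => complex.Re (M i i)) eA1.
  rewrite addE oneE ReD (sq A) (sq (W *m (1%:M - E))) => h1.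
  apply: (@le_trans _ _ (complex.Re (1 : C))); last by [].
  by rewrite -h1 lerDl; apply: sumr_ge0 => j _; exact: sqmod_ge0.
have dM : sqmod (\det T') = \prod_i f 0 i.
  have : \det (T' ^t* *m T') = \det (W ^t* *m dg f *m W) by rewrite eM.
  rewrite !det_mulmx !det_adj det_diag => e1.
  apply: complexI; rewrite sqmodE mulrC e1 mulrAC (mulrC _ (\det W)) -sqmodE det_unitary// mul1r.
  by rewrite rmorph_prod; apply: eq_bigr => i _; rewrite mxE.
have fgt i : 0 < f 0 i by exact: lt_le_trans (expR_gt0 _) (fge i).
have Tn0 i : i \in I -> 0 < sqmod (T i i).
  move=> iI; rewrite lt_neqAle sqmod_ge0 eq_sym sqmod_eq0 andbT.
  have : sqmod (\det T') != 0 by rewrite dM prodf_seq_neq0; apply/allP => j _; rewrite gt_eqF.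
  by rewrite sqmod_eq0 dT' => /prodf_neq0/(_ i iI).
have -> : \sum_(i in I) ln (sqmod (T i i)) = \sum_i ln (f 0 i).
  rewrite -ln_prod// -ln_prod; last by move=> i _; exact: fgt.
  by rewrite -sqmod_prod -dT' dM.
(* Both sides are the trace of [E *m X *m E] for the Hermitian logarithm [X] of the Gram matrix;
   conjugation by [W] does not change it. *)
have -> : \sum_(i in I) complex.Re ((V ^t* *m dg e *m V) i i) =
    \sum_i \sum_j sqmod (A i j) * e 0 j.
  have -> : \sum_i \sum_j sqmod (A i j) * e 0 j =
      complex.Re (\tr (A *m dg e *m A ^t*)).
    rewrite /mxtrace Re_sum; apply: eq_bigr => i _; rewrite diag_conj /=.
    by apply: eq_bigr => j _; rewrite mulrC.
  have [X defX] : exists X, X = V ^t* *m dg e *m V by eexists.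
  rewrite -defX; have -> : A *m dg e *m A ^t* = W *m (E *m X *m E) *m W ^t*.
    by rewrite defX defA !adjM trmxCK aE !mulmxA.
  rewrite mxtrace_mulC (mulmxA (W ^t*) W) (unitary_mulVr uW) mul1mx.
  rewrite /mxtrace Re_sum big_mkcond; apply: eq_bigr => i _.
  rewrite mul_dgr mul_dgl mxE.
  by case: (i \in I); rewrite ?mul1r ?mulr1 ?mul0r ?mulr0.
apply: ler_sum => i _; rewrite -ler_expR lnK ?posrE//.
Qed.

End Jensen.

(** * Weighted logarithms of triangular diagonals *)

Section Busemann.
Variable R : realType.
Local Notation C := R[i].
Local Notation dg d := (diag_mx (map_mx (real_complex R) d)).

Lemma mxtrace_unitary_conj n (V X : 'M[C]_n) : V \is unitarymx ->
  \tr (V ^t* *m X *m V) = \tr X.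
Proof. by move=> uV; rewrite mxtrace_mulC mulmxA unitary_mulV// mul1mx. Qed.

Lemma Re_mxtrace n (X : 'M[C]_n) : complex.Re (\tr X) = \sum_i complex.Re (X i i).
Proof. by rewrite /mxtrace Re_sum. Qed.

Lemma mxtrace_dg n (d : 'rV[R]_n) : \tr (dg d) = (\sum_i d 0 i)%:C.
Proof. by rewrite mxtrace_diag sumR; apply: eq_bigr => i _; rewrite mxE. Qed.

(** For the full set of indices the comparison of [ln_diag_ge] is an equality, both sides being the
    logarithm of [sqmod (\det T)]. *)
Lemma ln_diag_total n (T V : 'M[C]_n) (e : 'rV[R]_n) :
  upper T \/ lower T -> V \is unitarymx ->
  T ^t* *m T = V ^t* *m dg (map_mx expR e) *m V ->
  \sum_i ln (sqmod (T i i)) = \sum_i complex.Re ((V ^t* *m dg e *m V) i i).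
Proof.
move=> hT uV eT.
have dT : \det T = \prod_i T i i by case: hT => h; [exact: upper_det | exact: lower_det].
have dE : sqmod (\det T) = \prod_i expR (e 0 i).
  have : \det (T ^t* *m T) = \det (V ^t* *m dg (map_mx expR e) *m V) by rewrite eT.
  rewrite !det_mulmx !det_adj det_diag => e1.
  apply: complexI; rewrite sqmodE mulrC e1 mulrAC (mulrC _ (\det V)) -sqmodE det_unitary// mul1r.
  by rewrite rmorph_prod; apply: eq_bigr => i _; rewrite !mxE.
have T0 i : 0 < sqmod (T i i).
  rewrite lt_neqAle sqmod_ge0 eq_sym sqmod_eq0 andbT.
  have : sqmod (\det T) != 0.
    by rewrite dE prodf_seq_neq0; apply/allP => j _; rewrite gt_eqF// expR_gt0.
  by rewrite sqmod_eq0 dT => /prodf_neq0/(_ i isT).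
rewrite -ln_prod// -sqmod_prod -dT dE ln_prod; last by move=> i _; exact: expR_gt0.
rewrite -Re_mxtrace mxtrace_unitary_conj// mxtrace_dg /=.
by apply: eq_bigr => i _; rewrite expRK.
Qed.

(** Summation by parts: every partial sum of the products dominates the last weight times the
    partial sum of [Y], and over the full range the latter is zero. *)
Lemma abel_summation_ge0 n (P Y : 'I_n.+1 -> R) :
  (forall i j : 'I_n.+1, (i <= j)%N -> P j <= P i) ->
  (forall d, 0 <= \sum_(i < n.+1 | (i < d)%N) Y i) -> \sum_i Y i = 0 ->
  0 <= \sum_i P i * Y i.
Proof.
move=> hP hY Y0.
pose p k := P (inord k); pose y k := Y (inord k).
have sumE d : (d <= n.+1)%N -> \sum_(k < d) y k = \sum_(i < n.+1 | (i < d)%N) Y i.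
  move=> dn; rewrite (big_ord_widen _ y dn).
  by apply: eq_bigr => i _; rewrite /y inord_val.
have key d : (d <= n)%N -> p d * \sum_(k < d.+1) y k <= \sum_(k < d.+1) p k * y k.
  elim: d => [_|d IH dn]; first by rewrite !big_ord_recr !big_ord0 /= !add0r.
  rewrite [in leRHS]big_ord_recr [in leLHS]big_ord_recr /= mulrDr lerD2r.
  apply: le_trans (IH (ltnW dn)); rewrite ler_wpM2r//; first by rewrite sumE// ltnW.
  by apply: hP; rewrite !inordK// ltnW// ltnS// ltnW.
have := key n (leqnn n); rewrite [\sum_(k < n.+1) y k](_ : _ = 0); last first.
  by rewrite -[RHS]Y0; apply: eq_bigr => i _; rewrite /y inord_val.
by rewrite mulr0; under eq_bigr do rewrite /p /y inord_val.
Qed.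

Lemma ln_diag_ge_pred n (T V : 'M[C]_n) (e : 'rV[R]_n) (I : pred 'I_n) :
  upper T \/ lower T -> V \is unitarymx ->
  T ^t* *m T = V ^t* *m dg (map_mx expR e) *m V ->
  (forall i j, I j -> ~~ I i -> T i j = 0) ->
  \sum_(i | I i) complex.Re ((V ^t* *m dg e *m V) i i) <=
  \sum_(i | I i) ln (sqmod (T i i)).
Proof.
move=> hT uV eT hI; have sumE (F : 'I_n -> R) :
    \sum_(i in [set i | I i]%SET) F i = \sum_(i | I i) F i.
  by apply: eq_bigl => i; rewrite inE.
rewrite -!sumE; apply: ln_diag_ge => // i j; rewrite !inE; exact: hI.
Qed.

Variables (n : nat) (T V : 'M[C]_n.+1) (e : 'rV[R]_n.+1) (P : 'I_n.+1 -> R).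
Hypothesis uV : V \is unitarymx.
Hypothesis gT : T ^t* *m T = V ^t* *m dg (map_mx expR e) *m V.

(** The weighted sum is a Busemann function of [T ^t* *m T], compared here with its linearization at
    the identity. An upper [T] preserves the span of each initial set of coordinates, so the initial
    partial sums compare; they add up by parts because [P] is nonincreasing. *)
Lemma ln_diag_weighted_upper : upper T ->
  (forall i j : 'I_n.+1, (i <= j)%N -> P j <= P i) ->
  \sum_i P i * complex.Re ((V ^t* *m dg e *m V) i i) <= \sum_i P i * ln (sqmod (T i i)).
Proof.
move=> hT hP; rewrite -subr_ge0 -sumrB; under eq_bigr do rewrite -mulrBr.
apply: abel_summation_ge0 => // [d|]; rewrite sumrB; last first.
  by rewrite (ln_diag_total (or_introl hT) uV gT) subrr.
rewrite subr_ge0.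
by apply: (ln_diag_ge_pred _ uV gT) => [|i j /= jd]; [by left|]; rewrite -leqNgt => di; apply: hT; exact: leq_trans di.
Qed.

(** A lower [T] preserves the spans of final sets of coordinates. As the totals agree, the initial
    partial sums of the differences are nonpositive, and both they and [P] change sign before
    summation by parts. *)
Lemma ln_diag_weighted_lower : lower T ->
  (forall i j : 'I_n.+1, (i <= j)%N -> P i <= P j) ->
  \sum_i P i * complex.Re ((V ^t* *m dg e *m V) i i) <= \sum_i P i * ln (sqmod (T i i)).
Proof.
move=> hT hP; rewrite -subr_ge0 -sumrB; under eq_bigr do rewrite -mulrBr -mulrNN.
have tot : \sum_i (ln (sqmod (T i i)) - complex.Re ((V ^t* *m dg e *m V) i i)) = 0.
  by rewrite sumrB (ln_diag_total (or_intror hT) uV gT) subrr.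
apply: abel_summation_ge0 => [i j ij|d|]; first by rewrite lerN2 hP.
  have -> : \sum_(i < n.+1 | (i < d)%N) - (ln (sqmod (T i i)) - complex.Re ((V ^t* *m dg e *m V) i i)) =
    \sum_(i < n.+1 | ~~ (i < d)%N) (ln (sqmod (T i i)) - complex.Re ((V ^t* *m dg e *m V) i i)).
    rewrite sumrN; apply/eqP; rewrite eqr_oppLR -subr_eq0 opprK; apply/eqP.
    by rewrite -[RHS]tot [RHS](bigID (fun i : 'I_n.+1 => (i < d)%N)).
  rewrite sumrB subr_ge0.
  by apply: (ln_diag_ge_pred _ uV gT) => [|i j /=]; [by right|]; rewrite negbK -leqNgt => dj id; apply: hT; exact: leq_trans dj.
by rewrite sumrN tot oppr0.
Qed.

(** Each level set of [P] now spans an invariant subspace, so the comparison holds on every level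
    set; since the totals agree, it is an equality on each. *)
Lemma ln_diag_weighted_comm : upper T \/ lower T ->
  (forall i j, P i != P j -> T i j = 0) ->
  \sum_i P i * ln (sqmod (T i i)) = \sum_i P i * complex.Re ((V ^t* *m dg e *m V) i i).
Proof.
move=> hT hP; apply/eqP; rewrite -subr_eq0 -sumrB; under eq_bigr do rewrite -mulrBr.
set Y := fun i => ln (sqmod (T i i)) - complex.Re ((V ^t* *m dg e *m V) i i).
have S0 i0 : 0 <= \sum_(i | P i == P i0) Y i.
  rewrite sumrB subr_ge0.
  by apply: (ln_diag_ge_pred _ uV gT) => [//|i j /= /eqP jd di]; apply: hP; rewrite jd.
(* The least index with the same value of [P], a canonical representative: the level sets are
   indexed by the fixed points of [r]. *)
pose r i := [arg min_(j < i | P j == P i) (j : nat)]%N.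
have rP i : P (r i) = P i by rewrite /r; case: arg_minnP => // j /eqP.
have rr i j : P i = P j -> r i = r j.
  move=> ij; apply/val_inj; rewrite /r; case: arg_minnP => //= a /eqP ai ha.
  case: arg_minnP => //= b /eqP bi hb; apply/eqP; rewrite eqn_leq ha ?hb//.
    by rewrite ai ij.
  by rewrite bi ij.
have part (F : 'I_n.+1 -> R) : \sum_i F i = \sum_(k | r k == k) \sum_(i | P i == P k) F i.
  rewrite (partition_big r (fun k => r k == k)) /=; last first.
    by move=> i _; apply/eqP/rr; rewrite rP.
  apply: eq_bigr => k /eqP rk; apply: eq_bigl => i.
  by apply/eqP/eqP => [<-|/rr->]; rewrite ?rP.
have tot : \sum_i Y i = 0 by rewrite /Y sumrB (ln_diag_total hT uV gT) subrr.
have all0 k : r k == k -> \sum_(i | P i == P k) Y i = 0.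
  by move: k; apply/psumr_eq0P => [k _|]; [exact: S0 | rewrite -part].
rewrite part big1// => k rk.
under eq_bigr => i /eqP-> do [].
by rewrite -mulr_sumr all0// mulr0.
Qed.

End Busemann.

(** * Convergence and the matrix exponential *)

Section Convergence.
Variable R : realType.
Local Notation C := R[i].
Local Notation dg d := (diag_mx (map_mx (real_complex R) d)).

Section Filter.
Variables (T : Type) (F : set_system T) (FF : Filter F).

Lemma cvg_real_complex (u : T -> R) (l : R) :
  u t @[t --> F] --> l -> (u t)%:C @[t --> F] --> (l%:C : C).
Proof.
move=> /cvgrPdist_lt h; apply/cvgrPdist_lt => e e0.
have := h (complex.Re e); rewrite -ltcR RRe_real ?gtr0_real// => /(_ e0).
apply: filterS => t; rewrite -ltcR RRe_real ?gtr0_real//.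
by rewrite normc_def /= subrr expr0n addr0 sqrtr_sqr.
Qed.

Lemma cvg_Re (z : T -> C) (l : C) :
  z t @[t --> F] --> l -> complex.Re (z t) @[t --> F] --> complex.Re l.
Proof.
move=> /cvgrPdist_lt h; apply/cvgrPdist_lt => e e0.
have := h e%:C; rewrite ltcR => /(_ e0); apply: filterS => t ht.
by rewrite -ltcR; apply: le_lt_trans ht; rewrite -ReB; exact: normc_ge_Re.
Qed.

Lemma cvg_Im (z : T -> C) (l : C) :
  z t @[t --> F] --> l -> complex.Im (z t) @[t --> F] --> complex.Im l.
Proof.
move=> h; have -> : complex.Im l = complex.Re (- (l * 'i%C)) by case: (l) => a b /=; ring.
have -> : (fun t => complex.Im (z t)) = (fun t => complex.Re (- (z t * 'i%C))).
  by apply/funext => t; case: (z t) => a b /=; ring.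
by apply: cvg_Re; apply: cvgN; apply: cvgMl.
Qed.

Lemma cvg_complex (z : T -> C) (l : C) :
  complex.Re (z t) @[t --> F] --> complex.Re l ->
  complex.Im (z t) @[t --> F] --> complex.Im l -> z t @[t --> F] --> l.
Proof.
move=> hr hi; rewrite [l]complexE.
have -> : z = (fun t => (complex.Re (z t))%:C + 'i%C * (complex.Im (z t))%:C).
  by apply/funext => t; rewrite -complexE.
by apply: cvgD; [|apply: cvgMr]; apply: cvg_real_complex.
Qed.

Lemma cvg_conj (z : T -> C) (l : C) :
  z t @[t --> F] --> l -> Num.conj (z t) @[t --> F] --> Num.conj l.
Proof.
move=> h; apply: cvg_complex.
  by rewrite Re_conj; under eq_fun do rewrite Re_conj; exact: cvg_Re.
have e (x : C) : complex.Im (Num.conj x) = - complex.Im x by case: x.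
by rewrite e; under eq_fun do rewrite e; apply: cvgN; exact: cvg_Im.
Qed.

Lemma cvg_sqmod (z : T -> C) (l : C) :
  z t @[t --> F] --> l -> sqmod (z t) @[t --> F] --> sqmod l.
Proof.
move=> h; rewrite /sqmod !expr2; under eq_fun do rewrite !expr2.
by apply: cvgD; apply: cvgM; (exact: cvg_Re || exact: cvg_Im).
Qed.

Lemma cvg_bigsum (K : numFieldType) (V : normedModType K) (I : Type) (r : seq I)
    (P : pred I) (u : I -> T -> V) (l : I -> V) :
  (forall i, u i t @[t --> F] --> l i) ->
  \sum_(i <- r | P i) u i t @[t --> F] --> \sum_(i <- r | P i) l i.
Proof.
move=> h; elim: r => [|i r IH].
  by rewrite big_nil; under eq_fun do rewrite big_nil; exact: cvg_cst.
rewrite big_cons; under eq_fun do rewrite big_cons.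
by case: (P i); [apply: cvgD; [exact: h|exact: IH] | exact: IH].
Qed.

(** Entrywise, along an arbitrary filter, so as to serve both the exponential series and ultrafilter
    limits. *)
Definition mxcvg m n (X : T -> 'M[C]_(m, n)) (L : 'M[C]_(m, n)) :=
  forall i j, X t i j @[t --> F] --> L i j.

Lemma mxcvgM m n p (X : T -> 'M[C]_(m, n)) (Y : T -> 'M[C]_(n, p)) L M :
  mxcvg X L -> mxcvg Y M -> mxcvg (fun t => X t *m Y t) (L *m M).
Proof.
move=> hX hY i j; rewrite mxE; under eq_fun do rewrite mxE.
by apply: cvg_bigsum => k; apply: cvgM.
Qed.

Lemma mxcvg_adj m n (X : T -> 'M[C]_(m, n)) L :
  mxcvg X L -> mxcvg (fun t => (X t) ^t*) (L ^t*).
Proof.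
by move=> hX i j; rewrite adjE; under eq_fun do rewrite adjE; exact: cvg_conj.
Qed.

Lemma mxcvg_cst m n (X : 'M[C]_(m, n)) : mxcvg (fun=> X) X.
Proof. by move=> i j; exact: cvg_cst. Qed.

Lemma mxcvgP m n (X : T -> 'M[C]_(m, n)) (L : 'M[C]_(m, n)) :
  mxcvg X L -> X t @[t --> F] --> L.
Proof.
move=> h A [B hB hBA].
have : F (fun t => forall i j, B i j (X t i j)).
  have : \forall t \near F, forall p : 'I_m * 'I_n, B p.1 p.2 (X t p.1 p.2).
    apply: filter_forall => p; exact: (h p.1 p.2 _ (hB p.1 p.2)).
  by apply: filterS => t ht i j; exact: (ht (i, j)).
by move=> HF; change (F (fun t => A (X t))); apply: filterS HF => t ht; apply: hBA => i j; exact: ht.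
Qed.

End Filter.

Lemma mxcvg_unique (T : Type) (F : set_system T) (FF : ProperFilter F) m n
    (X : T -> 'M[C]_(m, n)) L L' : mxcvg F X L -> mxcvg F X L' -> L = L'.
Proof.
move=> h h'; apply/matrixP => i j.
exact: (@cvg_unique _ (@norm_hausdorff _ C) _ _ _ _ (h i j) (h' i j)).
Qed.

(** The partial sums of the matrix series are the conjugates by [V] of the diagonal matrices of
    partial sums [E N] of the scalar series. *)
Lemma expmx_spectral n (V : 'M[C]_n.+1) (e : 'rV[R]_n.+1) : V \is unitarymx ->
  expmx (V ^t* *m dg e *m V) = V ^t* *m dg (map_mx expR e) *m V.
Proof.
move=> uV; rewrite /expmx.
have powE k : (V ^t* *m dg e *m V) ^+ k = V ^t* *m dg (map_mx (fun x => x ^+ k) e) *m V.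
  elim: k => [|k IH].
    rewrite expr0 (_ : dg _ = 1%:M) ?mulmx1 ?unitary_mulVr//.
    by apply/matrixP => i j; rewrite !mxE expr0.
  rewrite exprS IH -[_ * _]/(_ *m _) -!mulmxA (mulmxA V) (unitary_mulV uV) mul1mx.
  rewrite (mulmxA (dg e)) mul_dg; congr (_ *m (diag_mx (map_mx _ _) *m _)).
  by apply/rowP => i; rewrite !mxE exprS.
pose E N : 'rV[R]_n.+1 := map_mx (fun x => series (exp_coeff x) N) e.
have serE : series (fun k => k`!%:R^-1 *: (V ^t* *m dg e *m V) ^+ k) =
    (fun N => V ^t* *m dg (E N) *m V).
  apply/funext => N; rewrite /series /=; elim: N => [|N IH].
    rewrite big_geq// (_ : dg (E 0%N) = 0) ?mulmx0 ?mul0mx//.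
    apply/matrixP => i j; rewrite !mxE /series /= big_geq//.
    by case: eqP; rewrite ?mulr1n ?mulr0n.
  rewrite big_nat_recr//= IH powE.
  have -> : dg (E N.+1) = dg (E N) + N`!%:R^-1 *: dg (map_mx (fun x => x ^+ N) e).
    apply/matrixP => i j; rewrite !mxE /series /= big_nat_recr//=.
    case: eqP => _; rewrite ?mulr1n ?mulr0n ?mulr0 ?addr0// rmorphD /=; congr (_ + _).
    by rewrite /exp_coeff mulrC rmorphM /= fmorphV /= rmorph_nat.
  by rewrite mulmxDr mulmxDl -scalemxAr -scalemxAl.
rewrite serE; apply: (@cvg_lim _ (@norm_hausdorff _ _)).
apply: mxcvgP; apply: mxcvgM; last exact: mxcvg_cst.
apply: mxcvgM; first exact: mxcvg_cst.
move=> i j; rewrite !mxE; under eq_fun do rewrite !mxE.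
case: eqP => _; last by under eq_fun do rewrite mulr0n; rewrite mulr0n; exact: cvg_cst.
rewrite mulr1n; under eq_fun do rewrite mulr1n.
apply: cvg_real_complex; exact: is_cvg_series_exp_coeff.
Qed.

End Convergence.

(** * The descent step *)

Section Cocoercivity.
Variables (R : realType) (K : finType).
Local Notation C := R[i].
Implicit Types (y : K -> C) (w : K -> R) (M : K -> K -> C).

Definition vnorm y : R := \sum_k sqmod (y k).
Definition vdiag w y : R := \sum_k w k * sqmod (y k).
Definition vapp M y k : C := \sum_l M k l * y l.
Definition vform M y : R := complex.Re (\sum_k Num.conj (y k) * vapp M y k).

Lemma sqmod_scale (a : R) (b : C) : sqmod (a%:C * b) = a ^+ 2 * sqmod b.
Proof. by rewrite sqmodM sqmodR. Qed.

(** The variance of the operator [w - M] in the state [y] is nonnegative; then [vnorm (vapp M y)] is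
    bounded by hypothesis and the square of [vform M y] is discarded. This is the numerator of the
    derivative in [flow_cocoercive]. *)
Lemma variance_ge0 w M y d : 0 < vnorm y -> vnorm (vapp M y) <= d * vnorm y ->
  0 <= (\sum_k w k ^+ 2 * sqmod (y k)) * vnorm y - vdiag w y ^+ 2
     - 2 * ((\sum_k w k * complex.Re (Num.conj (y k) * vapp M y k)) * vnorm y
            - vform M y * vdiag w y) + d * vnorm y ^+ 2.
Proof.
set z := vapp M y; set N := vnorm y => Np hM.
set S2 := \sum_k _ ^+ 2 * _; set X := \sum_k w k * complex.Re _.
set W := vdiag w y; set D := vform M y.
have eD : D = \sum_k complex.Re (Num.conj (y k) * z k) by rewrite /D /vform Re_sum.
have E k : sqmod (N%:C * ((w k)%:C * y k - z k) - (W - D)%:C * y k) =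
    N ^+ 2 * (w k ^+ 2 * sqmod (y k)) - 2 * N ^+ 2 * (w k * complex.Re (Num.conj (y k) * z k))
    + N ^+ 2 * sqmod (z k) - 2 * (N * (W - D)) * (w k * sqmod (y k))
    + 2 * (N * (W - D)) * complex.Re (Num.conj (y k) * z k) + (W - D) ^+ 2 * sqmod (y k).
  by rewrite /sqmod; case: (y k) => a b; case: (z k) => a' b' /=; ring.
have : 0 <= \sum_k sqmod (N%:C * ((w k)%:C * y k - z k) - (W - D)%:C * y k).
  by apply: sumr_ge0 => k _; exact: sqmod_ge0.
under eq_bigr do rewrite E.
rewrite !big_split /= !sumrN -!mulr_sumr -/S2 -/X -/W -eD -/(vnorm y) -/N -/(vnorm z).
rewrite -/(vdiag w y) -/W.
move: (vnorm z) hM S2 X W D {E eD} => Z hM S2 X W D.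
move=> h.
have : 0 <= N * (S2 * N - W ^+ 2 - 2 * (X * N - D * W) + d * N ^+ 2).
  have hZ : N ^+ 2 * Z <= N ^+ 2 * (d * N) by rewrite ler_wpM2l// sqr_ge0.
  have h3 : 0 <= N * D ^+ 2 by apply: mulr_ge0; [exact: ltW | exact: sqr_ge0].
  nra.
by rewrite pmulr_rge0.
Qed.

Lemma is_derive_exp_sum (J : finType) (c r : J -> R) (t : R) :
  is_derive t 1 (fun s : R => \sum_j c j * expR (- (s * r j)))
    (\sum_j - r j * c j * expR (- (t * r j))).
Proof.
have h j : is_derive t 1 (fun s : R => c j * expR (- (s * r j)))
    (- r j * c j * expR (- (t * r j))).
  have h0 : is_derive t 1 (fun s : R => - (s * r j)) (- r j).
    have -> : (fun s : R => - (s * r j)) = (- r j) \*: (id : R -> R).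
      by apply/funext => s; rewrite -[RHS]/(- r j * s) mulNr mulrC.
    by apply: is_derive_eq; rewrite [LHS]mulr1.
  have h1 : is_derive t 1 (expR \o (fun s : R => - (s * r j))) (expR (- (t * r j)) * - r j).
    exact: (@is_derive1_comp R expR (fun s : R => - (s * r j)) t _ _ (is_derive_expR _) h0).
  have -> : (fun s : R => c j * expR (- (s * r j))) = c j \*: (expR \o (fun s : R => - (s * r j))).
    by apply/funext.
  apply: is_derive_eq; rewrite -[_ *: _]/(_ * _); ring.
have -> : (fun s : R => \sum_j c j * expR (- (s * r j))) =
    \sum_j (fun s : R => c j * expR (- (s * r j))).
  by rewrite fct_sumE.
by elim/big_ind2 : _ => // [|] *; [exact: is_derive_cst|exact: is_deriveD].
Qed.

(** At time [1 / 2] the factor is [exp (- w / 4)], which is the descent step [1 / (2 L)] for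
    [L = 2]. *)
Definition flow w (x : K -> C) (t : R) (k : K) : C := (expR (- (t * (w k / 2))))%:C * x k.

(* For a diagonal operator [v] and a Hermitian [d], the function
   [t |-> - <m(t), v - 2 d> + 2 t |d|^2] is nondecreasing, [m(t)] being the moment map
   along the flow of [- v / 2]. *)
Lemma flow_cocoercive w M (x : K -> C) d :
  (forall k l, M l k = Num.conj (M k l)) -> (exists k, x k != 0) ->
  (forall y, vnorm (vapp M y) <= 2 * d * vnorm y) ->
  let y := flow w x (1 / 2) in
  0 <= vdiag w x / vnorm x - vdiag w y / vnorm y
     - 2 * (vform M x / vnorm x - vform M y / vnorm y) + d.
Proof.
move=> hM [k0 xk0] hd.
have flowpos t : 0 < vnorm (flow w x t).
  apply: (@lt_le_trans _ _ (sqmod (flow w x t k0))).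
    by rewrite lt_neqAle sqmod_ge0 eq_sym sqmod_eq0 mulf_neq0// eq_complex /= gt_eqF// expR_gt0.
  by rewrite /vnorm (bigD1 k0)//= lerDl; apply: sumr_ge0 => k _; exact: sqmod_ge0.
have flow0 : flow w x 0 = x.
  by apply/funext => k; rewrite /flow mul0r oppr0 expR0 mul1r.
pose fN := fun t => vnorm (flow w x t).
pose fW := fun t => vdiag w (flow w x t).
pose fD := fun t => vform M (flow w x t).
pose fW2 := fun t => \sum_k w k ^+ 2 * sqmod (flow w x t k).
pose fX := fun t => \sum_k w k * complex.Re (Num.conj (flow w x t k) * vapp M (flow w x t) k).
have eN t k : sqmod (flow w x t k) = sqmod (x k) * expR (- (t * w k)).
  rewrite /flow sqmod_scale mulrC; congr (_ * _); rewrite -expRM_natl; congr expR.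
  by field.
have dN (t : R) : is_derive t (1 : R) fN (- fW t).
  have -> : fN = (fun t => \sum_k sqmod (x k) * expR (- (t * w k))).
    by apply/funext => s; apply: eq_bigr => k _; rewrite eN.
  apply: is_derive_eq (is_derive_exp_sum _ _ _) _.
  by rewrite /fW /vdiag -sumrN; apply: eq_bigr => k _; rewrite eN; ring.
have dW (t : R) : is_derive t (1 : R) fW (- fW2 t).
  have -> : fW = (fun t => \sum_k (w k * sqmod (x k)) * expR (- (t * w k))).
    by apply/funext => s; apply: eq_bigr => k _; rewrite eN mulrA.
  apply: is_derive_eq (is_derive_exp_sum _ _ _) _.
  by rewrite /fW2 -sumrN; apply: eq_bigr => k _; rewrite eN; ring.
pose S k l := complex.Re (Num.conj (x k) * (M k l * x l)).
have SC k l : S k l = S l k.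
  by rewrite /S -Re_conj !rmorphM /= conjCK -hM; congr complex.Re; ring.
pose E t k l := expR (- (t * ((w k + w l) / 2))).
have eS t k l : complex.Re (Num.conj (flow w x t k) * (M k l * flow w x t l)) = S k l * E t k l.
  have -> : Num.conj (flow w x t k) * (M k l * flow w x t l) =
      (E t k l)%:C * (Num.conj (x k) * (M k l * x l)).
    rewrite /flow rmorphM /= conjR /E.
    have -> : - (t * ((w k + w l) / 2)) = - (t * (w k / 2)) + - (t * (w l / 2)) by field.
    by rewrite expRD rmorphM /=; ring.
  by rewrite ReZ mulrC.
have eX t k : complex.Re (Num.conj (flow w x t k) * vapp M (flow w x t) k) =
    \sum_l S k l * E t k l.
  by rewrite /vapp mulr_sumr Re_sum; apply: eq_bigr => l _; rewrite eS.
have dD (t : R) : is_derive t (1 : R) fD (- fX t).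
  have -> : fD = (fun t => \sum_(p : K * K) S p.1 p.2 * expR (- (t * ((w p.1 + w p.2) / 2)))).
    apply/funext => s; rewrite /fD /vform Re_sum.
    under eq_bigr do rewrite eX.
    by rewrite pair_big.
  apply: is_derive_eq (is_derive_exp_sum _ _ _) _.
  have h1 : fX t = \sum_(p : K * K) w p.1 * (S p.1 p.2 * E t p.1 p.2).
    rewrite /fX; under eq_bigr do rewrite eX mulr_sumr.
    by rewrite pair_big.
  (* Since [M] is Hermitian, the weight can be moved from one index to the other; averaging both
     forms produces the rate [(w k + w l) / 2] of the mixed terms. *)
  have h2 : fX t = \sum_(p : K * K) w p.2 * (S p.1 p.2 * E t p.1 p.2).
    rewrite h1 -(pair_big xpredT xpredT (fun k l => w k * (S k l * E t k l))) exchange_big /=.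
    rewrite pair_big; apply: eq_bigr => -[l k] _ /=.
    by rewrite SC /E addrC.
  have -> : - fX t = - (2^-1 * (fX t + fX t)) by field.
  rewrite {1}h1 h2 -big_split mulr_sumr -sumrN; apply: eq_bigr => p _.
  by rewrite /E /=; field.
(* By the quotient rule the numerator of [dG] is the quantity of [variance_ge0] for the bound
   [2 * d]. The claim is [G 0 <= G (1 / 2)]. *)
pose G := fun t => t * (2 * d) - fW t / fN t + 2 * (fD t / fN t).
pose dG t := 2 * d - (- fW2 t * fN t + fW t * fW t) / fN t ^+ 2
     + 2 * ((- fX t * fN t + fD t * fW t) / fN t ^+ 2).
have dGt (t : R) : is_derive t (1 : R) G (dG t).
  have N0 : fN t != 0 by rewrite gt_eqF// flowpos.
  have hV := is_deriveV N0 (dN t).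
  have h1 := is_deriveM (dW t) hV.
  have h2 := is_deriveM (dD t) hV.
  have -> : G = (2 * d) \*: (id : R -> R) - fW * (fun t => (fN t)^-1) + 2 \*: (fD * (fun t => (fN t)^-1)).
    by apply/funext => s; rewrite /G /= mulrC.
  apply: is_derive_eq.
  rewrite /dG; move: (fN t) N0 (fW t) (fD t) (fW2 t) (fX t) => a a0 b c e f.
  change (2 * d * 1 - (b * (- a ^- 2 * - b) + a^-1 * - e) + 2 * (c * (- a ^- 2 * - b) + a^-1 * - f) =
    2 * d - (- e * a + b * b) / a ^+ 2 + 2 * ((- f * a + c * b) / a ^+ 2)).
  by field.
have dG0 t : 0 <= dG t.
  have := @variance_ge0 w M _ (2 * d) (flowpos t) (hd _).
  rewrite -/(fN t) -/(fW t) -/(fD t) -/(fW2 t) -/(fX t) => h.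
  have -> : dG t = (fW2 t * fN t - fW t ^+ 2 - 2 * (fX t * fN t - fD t * fW t) +
     2 * d * fN t ^+ 2) / fN t ^+ 2.
    by rewrite /dG; field; rewrite gt_eqF// flowpos.
  by rewrite divr_ge0// sqr_ge0.
have dv (t : R) : derivable G t 1 by have [] := dGt t.
have cG : {within `[0, 1/2], continuous G}.
  apply: continuous_subspaceT => t; apply: differentiable_continuous.
  by apply/derivable1_diffP; exact: dv.
have half0 : (0 : R) <= 1 / 2 by rewrite divr_ge0.
have key : G 0 <= G (1 / 2).
  apply: (@ger0_derive1_ndecr R G 0 (1 / 2)) => // t _; rewrite derive1E.
  by rewrite (@derive_val _ _ _ _ _ _ _ (dGt t)).
rewrite /=; set y := flow _ _ _; move: key.
rewrite /G /fN /fW /fD flow0 -/y mul0r.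
set a1 := vdiag w x / _; set a2 := vdiag w y / _; set a3 := vform M x / _.
set a4 := vform M y / _; lra.
Qed.

End Cocoercivity.

(** * Norms and Gram matrices of tuples *)

Section Tuples.
Variable R : realType.
Local Notation C := R[i].
Local Notation dg d := (diag_mx (map_mx (real_complex R) d)).

Definition fsq n m (X : 'M[C]_(n, m)) : R := \sum_i \sum_j sqmod (X i j).

Lemma fsq_ge0 n m (X : 'M[C]_(n, m)) : 0 <= fsq X.
Proof. by apply: sumr_ge0 => i _; apply: sumr_ge0 => j _; exact: sqmod_ge0. Qed.

Lemma fsq_eq0 n m (X : 'M[C]_(n, m)) : fsq X = 0 -> X = 0.
Proof.
move=> h; apply/matrixP => i j; apply/eqP; rewrite mxE -sqmod_eq0; apply/eqP.
move: h; rewrite /fsq pair_big /= => /psumr_eq0P h.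
by apply: (h _ (i, j)) => // p _; exact: sqmod_ge0.
Qed.

Lemma fsqE n m (X : 'M[C]_(n, m)) : \tr (X *m X ^t*) = (fsq X)%:C.
Proof.
rewrite /mxtrace /fsq sumR; apply: eq_bigr => i _; rewrite mxE sumR.
by apply: eq_bigr => j _; rewrite adjE sqmodE.
Qed.

Lemma fsq_unitary n m (U : 'M[C]_n) (V : 'M[C]_m) (X : 'M[C]_(n, m)) :
  U \is unitarymx -> V \is unitarymx -> fsq (U *m X *m V ^t*) = fsq X.
Proof.
move=> uU uV; apply: complexI; rewrite -!fsqE.
have -> : U *m X *m V ^t* *m (U *m X *m V ^t*) ^t* = U *m (X *m X ^t*) *m U ^t*.
  rewrite !adjM trmxCK -(mulmxA _ (V ^t*)) (mulmxA (V ^t*)) unitary_mulVr// mul1mx.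
  by rewrite !mulmxA.
by rewrite mxtrace_mulC (mulmxA (U ^t*) U) unitary_mulVr// mul1mx.
Qed.

Lemma sqmodD_le (a b : C) : sqmod (a + b) <= 2 * (sqmod a + sqmod b).
Proof.
case: a b => a1 a2 [b1 b2]; rewrite /sqmod /=.
rewrite -subr_ge0 [X in 0 <= X](_ : _ = (a1 - b1) ^+ 2 + (a2 - b2) ^+ 2); last by ring.
by rewrite addr_ge0 ?sqr_ge0.
Qed.

Lemma fsqD_le n m (X Y : 'M[C]_(n, m)) : fsq (X + Y) <= 2 * (fsq X + fsq Y).
Proof.
rewrite /fsq -big_split mulr_sumr; apply: ler_sum => i _.
rewrite -big_split mulr_sumr; apply: ler_sum => j _.
by rewrite mxE sqmodD_le.
Qed.

(** Cauchy-Schwarz: the nonnegative sum [h] expands to [B * (A * B - sqmod s)]. *)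
Lemma sqmod_sumM_le (I : finType) (a b : I -> C) :
  sqmod (\sum_i a i * b i) <= (\sum_i sqmod (a i)) * (\sum_i sqmod (b i)).
Proof.
set A := \sum_i sqmod (a i); set B := \sum_i sqmod (b i); set s := \sum_i a i * b i.
have B0 : 0 <= B by apply: sumr_ge0 => i _; exact: sqmod_ge0.
have h : 0 <= \sum_i sqmod (B%:C * a i - s * Num.conj (b i)).
  by apply: sumr_ge0 => i _; exact: sqmod_ge0.
have E i : sqmod (B%:C * a i - s * Num.conj (b i)) =
    B ^+ 2 * sqmod (a i) - 2 * B * complex.Re (Num.conj s * (a i * b i)) + sqmod s * sqmod (b i).
  by rewrite /sqmod; case: (a i) (b i) s {h} => a1 a2 [b1 b2] [s1 s2] /=; ring.
move: h; under eq_bigr do rewrite E.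
rewrite !big_split /= sumrN -!mulr_sumr -Re_sum -mulr_sumr -/s -/A -/B.
have -> : complex.Re (Num.conj s * s) = sqmod s by rewrite mulrC -sqmodE.
move=> h; have [B00|Bn] := eqVneq B 0.
  have b0 i : b i = 0.
    apply/eqP; rewrite -sqmod_eq0; apply/eqP.
    by apply: (psumr_eq0P _ B00) => // j _; exact: sqmod_ge0.
  rewrite /s big1 ?sqmod0 ?B00 ?mulr0// => i _; by rewrite b0 mulr0.
have Bp : 0 < B by rewrite lt_neqAle eq_sym Bn.
have : 0 <= B * (A * B - sqmod s) by move: h; congr (0 <= _); ring.
by rewrite pmulr_rge0// subr_ge0.
Qed.

Lemma fsqM_le n m p (X : 'M[C]_(n, m)) (Y : 'M[C]_(m, p)) :
  fsq (X *m Y) <= fsq X * fsq Y.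
Proof.
rewrite /fsq mulr_suml; apply: ler_sum => i _.
rewrite [X in _ * X]exchange_big mulr_sumr /=; apply: ler_sum => j _.
by rewrite mxE; exact: sqmod_sumM_le.
Qed.

Variables (n m N : nat).
Local Notation tuple := ('I_N -> 'M[C]_(n, m)).
Implicit Types (x y : tuple).

(** The tuple enters the diagonals of its two Gram matrices only through these weights, as row sums
    and as column sums. *)
Definition mass x i j : R := \sum_l sqmod (x l i j).
Definition nsq x : R := \sum_i \sum_j mass x i j.

Lemma mass_ge0 x i j : 0 <= mass x i j.
Proof. by apply: sumr_ge0 => l _; exact: sqmod_ge0. Qed.

Lemma nsq_fsq x : nsq x = \sum_l fsq (x l).
Proof.
rewrite /nsq /mass [RHS]exchange_big; apply: eq_bigr => i _ /=.
by rewrite exchange_big.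
Qed.

Lemma nsq_ge0 x : 0 <= nsq x.
Proof. by rewrite nsq_fsq; apply: sumr_ge0 => l _; exact: fsq_ge0. Qed.

Lemma nsq_gt0 x l : x l != 0 -> 0 < nsq x.
Proof.
move=> h; rewrite lt_neqAle nsq_ge0 andbT eq_sym; apply: contra_neq h => h.
apply: fsq_eq0; move: h; rewrite nsq_fsq => h.
by apply: (psumr_eq0P _ h) => // k _; exact: fsq_ge0.
Qed.

Lemma nsq_gt0_ex x : 0 < nsq x -> exists l, x l != 0.
Proof.
move=> h; apply/existsP; apply: contraLR h; rewrite negb_exists => /forallP h.
rewrite -leNgt nsq_fsq big1// => l _; have := h l; rewrite negbK => /eqP->.
by rewrite /fsq big1// => i _; rewrite big1// => j _; rewrite mxE sqmod0.
Qed.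

Lemma normsqE x : normsq x = (nsq x)%:C.
Proof. by rewrite /normsq nsq_fsq sumR; apply: eq_bigr => l _; rewrite fsqE. Qed.

Lemma lgram_diagE x i : lgram x i i = (\sum_j mass x i j)%:C.
Proof.
rewrite /lgram summxE exchange_big sumR /=; apply: eq_bigr => l _.
by rewrite mxE sumR; apply: eq_bigr => j _; rewrite adjE sqmodE.
Qed.

Lemma rgram_diagE x j : rgram x j j = (\sum_i mass x i j)%:C.
Proof.
rewrite /rgram summxE exchange_big sumR /=; apply: eq_bigr => l _.
by rewrite mxE sumR; apply: eq_bigr => i _; rewrite adjE sqmodE mulrC.
Qed.

Lemma lgram_adj x : (lgram x) ^t* = lgram x.
Proof.
apply/matrixP => i j; rewrite adjE !summxE rmorph_sum; apply: eq_bigr => l _.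
transitivity (((x l *m (x l) ^t*) ^t*) i j); first by rewrite adjE.
by rewrite adjM trmxCK.
Qed.

Lemma rgram_adj x : (rgram x) ^t* = rgram x.
Proof.
apply/matrixP => i j; rewrite adjE !summxE rmorph_sum; apply: eq_bigr => l _.
transitivity ((((x l) ^t* *m x l) ^t*) i j); first by rewrite adjE.
by rewrite adjM trmxCK.
Qed.

Lemma act_act g g' h h' x : act g h (act g' h' x) = act (g *m g') (h *m h') x.
Proof. by apply/funext => l; rewrite /act adjM !mulmxA. Qed.

Lemma act1 x : act 1%:M 1%:M x = x.
Proof. by apply/funext => l; rewrite /act mul1mx trmx1 map_mx1 mulmx1. Qed.

Lemma act_unitaryK U V x : U \is unitarymx -> V \is unitarymx ->
  act (U ^t*) (V ^t*) (act U V x) = x.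
Proof. by move=> uU uV; rewrite act_act !unitary_mulVr// act1. Qed.

Lemma act_unitaryVK U V x : U \is unitarymx -> V \is unitarymx ->
  act U V (act (U ^t*) (V ^t*) x) = x.
Proof. by move=> uU uV; rewrite act_act !unitary_mulV// act1. Qed.

Lemma nsq_act_unitary U V x : U \is unitarymx -> V \is unitarymx ->
  nsq (act U V x) = nsq x.
Proof.
by move=> uU uV; rewrite !nsq_fsq; apply: eq_bigr => l _; exact: fsq_unitary.
Qed.

Lemma lgram_act_unitary U V x : V \is unitarymx ->
  lgram (act U V x) = U *m lgram x *m U ^t*.
Proof.
move=> uV; rewrite /lgram mulmx_sumr mulmx_suml; apply: eq_bigr => l _.
rewrite /act !adjM trmxCK; move: (x l) => X.
transitivity (U *m (X *m (V ^t* *m V) *m X ^t*) *m U ^t*); first by rewrite !mulmxA.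
by rewrite (unitary_mulVr uV) mulmx1.
Qed.

Lemma rgram_act_unitary U V x : U \is unitarymx ->
  rgram (act U V x) = V *m rgram x *m V ^t*.
Proof.
move=> uU; rewrite /rgram mulmx_sumr mulmx_suml; apply: eq_bigr => l _.
rewrite /act !adjM trmxCK; move: (x l) => X.
transitivity (V *m (X ^t* *m (U ^t* *m U) *m X) *m V ^t*); first by rewrite !mulmxA.
by rewrite (unitary_mulVr uU) mulmx1.
Qed.

End Tuples.

Section Moment.
Variables (R : realType) (n m N : nat).
Local Notation C := R[i].
Local Notation dg d := (diag_mx (map_mx (real_complex R) d)).
Local Notation tuple := ('I_N -> 'M[C]_(n.+1, m.+1)).
Implicit Types (x y : tuple).

Lemma mu1_act_unitary U V x : U \is unitarymx -> V \is unitarymx ->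
  mu1 (act U V x) = U *m mu1 x *m U ^t*.
Proof.
move=> uU uV; rewrite /mu1 !normsqE nsq_act_unitary// lgram_act_unitary//.
rewrite mulmxBr mulmxBl -scalemxAr -scalemxAl; congr (_ - _).
by rewrite mul_mx_scalar -scalemxAl unitary_mulV// scalemx1.
Qed.

Lemma mu2_act_unitary U V x : U \is unitarymx -> V \is unitarymx ->
  mu2 (act U V x) = V *m mu2 x *m V ^t*.
Proof.
move=> uU uV; rewrite /mu2 !normsqE nsq_act_unitary// rgram_act_unitary//.
rewrite mulmxBr mulmxBl -scalemxAr -scalemxAl; congr (_ - _).
by rewrite mul_mx_scalar -scalemxAl unitary_mulV// scalemx1.
Qed.

Lemma realinv (a : R) : (a%:C)^-1 = (a^-1)%:C :> C.
Proof. by rewrite fmorphV. Qed.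

Lemma natinv p : (p%:R : C)^-1 = (p%:R^-1)%:C.
Proof. by rewrite -realinv rmorph_nat. Qed.

Lemma adj_moment p (c k : R) (X : 'M[C]_p) : X ^t* = X ->
  (c%:C *: X - (k%:C)%:M) ^t* = c%:C *: X - (k%:C)%:M.
Proof.
move=> hX; apply/matrixP => i j; rewrite adjE !mxE rmorphB rmorphM /= conjR.
rewrite -[in RHS]hX adjE; congr (_ - _).
by rewrite eq_sym; case: eqP => _; rewrite ?mulr1n ?mulr0n ?conjR ?rmorph0.
Qed.

Lemma mu1E x : mu1 x = (nsq x)^-1%:C *: lgram x - (n.+1%:R^-1%:C)%:M.
Proof. by rewrite /mu1 normsqE realinv natinv. Qed.

Lemma mu2E x : mu2 x = (nsq x)^-1%:C *: rgram x - (m.+1%:R^-1%:C)%:M.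
Proof. by rewrite /mu2 normsqE realinv natinv. Qed.

Lemma mu1_adj x : (mu1 x) ^t* = mu1 x.
Proof. by rewrite mu1E adj_moment// lgram_adj. Qed.

Lemma mu2_adj x : (mu2 x) ^t* = mu2 x.
Proof. by rewrite mu2E adj_moment// rgram_adj. Qed.

Lemma tr_lgram x : \tr (lgram x) = (nsq x)%:C.
Proof.
by rewrite /mxtrace /nsq sumR; apply: eq_bigr => i _; rewrite lgram_diagE.
Qed.

Lemma tr_rgram x : \tr (rgram x) = (nsq x)%:C.
Proof.
by rewrite /mxtrace /nsq exchange_big sumR; apply: eq_bigr => i _; rewrite rgram_diagE.
Qed.

Lemma tr_mu1 x : 0 < nsq x -> \tr (mu1 x) = 0.
Proof.
move=> h; have hc : ((nsq x)^-1)%:C * (nsq x)%:C = 1 :> C.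
  by rewrite -rmorphM /= mulVf ?gt_eqF.
rewrite mu1E raddfB /= mxtraceZ tr_lgram mxtrace_scalar hc.
by rewrite -natinv -[X in _ - X]mulr_natr mulVf ?subrr// pnatr_eq0.
Qed.

Lemma tr_mu2 x : 0 < nsq x -> \tr (mu2 x) = 0.
Proof.
move=> h; have hc : ((nsq x)^-1)%:C * (nsq x)%:C = 1 :> C.
  by rewrite -rmorphM /= mulVf ?gt_eqF.
rewrite mu2E raddfB /= mxtraceZ tr_rgram mxtrace_scalar hc.
by rewrite -natinv -[X in _ - X]mulr_natr mulVf ?subrr// pnatr_eq0.
Qed.

End Moment.

(** * One step of the descent *)

Section Step.
Variables (R : realType) (n m N : nat).
Local Notation C := R[i].
Local Notation dg d := (diag_mx (map_mx (real_complex R) d)).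
Local Notation tuple := ('I_N -> 'M[C]_(n.+1, m.+1)).
Local Notation idx := ('I_N * 'I_n.+1 * 'I_m.+1)%type.
Implicit Types (x y : tuple).

Definition entries x : idx -> C := fun p => x p.1.1 p.1.2 p.2.

(** The matrix of [x |-> d x + x e] on flattened tuples, in the form to which the cocoercivity
    inequality applies. *)
Definition lr_operator (d : 'M[C]_n.+1) (e : 'M[C]_m.+1) (p q : idx) : C :=
  (p.1.1 == q.1.1)%:R *
  ((p.2 == q.2)%:R * d p.1.2 q.1.2 + (p.1.2 == q.1.2)%:R * e q.2 p.2).

Definition lr_app (d : 'M[C]_n.+1) (e : 'M[C]_m.+1) x : tuple :=
  fun l => d *m x l + x l *m e.

Lemma sum_idx (V : nmodType) (f : idx -> V) :
  \sum_p f p = \sum_l \sum_i \sum_j f (l, i, j).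
Proof. by rewrite pair_bigA pair_bigA; apply: eq_bigr => -[[l i] j]. Qed.

Lemma entries_surj (f : idx -> C) : exists x, f = entries x.
Proof.
exists (fun l => \matrix_(i, j) f (l, i, j)); apply/funext => -[[l i] j].
by rewrite /entries mxE.
Qed.

Lemma vnorm_entries x : vnorm (entries x) = nsq x.
Proof.
rewrite /vnorm sum_idx nsq_fsq; apply: eq_bigr => l _.
by apply: eq_bigr => i _; apply: eq_bigr => j _.
Qed.

Lemma vapp_lr d e x : vapp (lr_operator d e) (entries x) = entries (lr_app d e x).
Proof.
apply/funext => -[[l i] j]; rewrite /vapp sum_idx /entries /lr_app /= (bigD1 l)//=.
rewrite [X in _ + X]big1 ?addr0 => [|k kl]; last first.
  rewrite big1// => i' _; rewrite big1// => j' _.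
  by rewrite /lr_operator /= eq_sym (negbTE kl) !mul0r.
rewrite !mxE; under eq_bigr => i' _ do under eq_bigr => j' _ do
  rewrite /lr_operator /= eqxx mul1r mulrDl.
under eq_bigr do rewrite big_split; rewrite big_split /=; congr (_ + _).
  apply: eq_bigr => i' _; rewrite (bigD1 j)//= eqxx mul1r big1 ?addr0// => j' jj.
  by rewrite eq_sym (negbTE jj) !mul0r.
rewrite (bigD1 i)//= [X in _ + X]big1 ?addr0 => [|i' ii]; last first.
  by rewrite big1// => j' _; rewrite eq_sym (negbTE ii) !mul0r.
by apply: eq_bigr => j' _; rewrite eqxx mul1r mulrC.
Qed.

Lemma vform_lr d e x : vform (lr_operator d e) (entries x) =
  complex.Re (\tr (d *m lgram x)) + complex.Re (\tr (e *m rgram x)).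
Proof.
rewrite /vform vapp_lr -ReD; congr complex.Re; rewrite sum_idx.
rewrite /lgram /rgram !mulmx_sumr !raddf_sum -big_split /=; apply: eq_bigr => l _.
rewrite /entries /lr_app /=.
transitivity (\tr ((d *m x l + x l *m e) *m (x l) ^t*)).
  rewrite /mxtrace; apply: eq_bigr => i _; rewrite mxE; apply: eq_bigr => j _.
  by rewrite adjE mulrC.
rewrite mulmxDl raddfD /= mulmxA; congr (_ + _).
by rewrite -mulmxA mxtrace_mulC mulmxA.
Qed.

(** The origin of [L = 2]: this is the operator bound that [flow_cocoercive] asks for with the
    constant [fsq d + fsq e]. *)
Lemma lr_app_le d e x : nsq (lr_app d e x) <= 2 * (fsq d + fsq e) * nsq x.
Proof.
rewrite !nsq_fsq mulr_sumr; apply: ler_sum => l _.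
apply: le_trans (fsqD_le _ _) _; rewrite -mulrA; apply: ler_wpM2l => //.
rewrite mulrDl; apply: lerD; first exact: fsqM_le.
by rewrite mulrC; exact: fsqM_le.
Qed.

Lemma lr_operator_hermitian d e p q : d ^t* = d -> e ^t* = e ->
  lr_operator d e q p = Num.conj (lr_operator d e p q).
Proof.
move=> hd he; rewrite /lr_operator rmorphM rmorphD !rmorphM /= !rmorph_nat.
rewrite -[in LHS]hd -[in LHS]he !adjE (eq_sym q.1.1) (eq_sym q.2) (eq_sym q.1.2).
by [].
Qed.

Definition mu_dot (d d' : 'M[C]_n.+1) (e e' : 'M[C]_m.+1) : R :=
  complex.Re (\tr (d *m d')) + complex.Re (\tr (e *m e')).

(** The trace correction depends on [(d, e)] only and cancels when two points are compared. *)
Lemma lr_moment d e x : 0 < nsq x ->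
  vform (lr_operator d e) (entries x) / vnorm (entries x) =
  mu_dot d (mu1 x) e (mu2 x) +
  (complex.Re (\tr d) / n.+1%:R + complex.Re (\tr e) / m.+1%:R).
Proof.
move=> h; rewrite vform_lr vnorm_entries /mu_dot mu1E mu2E.
have tr_shift p (X Y : 'M[C]_p) (c k : R) :
    complex.Re (\tr (X *m (c%:C *: Y - (k%:C)%:M))) =
    c * complex.Re (\tr (X *m Y)) - k * complex.Re (\tr X).
  by rewrite mulmxBr -scalemxAr mul_mx_scalar raddfB /= !mxtraceZ ReB !ReZ.
rewrite !tr_shift; ring.
Qed.

Definition musq x : R := fsq (mu1 x) + fsq (mu2 x).

Lemma fsq_hermitian p (X : 'M[C]_p) : X ^t* = X -> complex.Re (\tr (X *m X)) = fsq X.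
Proof. by move=> h; rewrite -{2}h fsqE. Qed.

Lemma mu_dotB d e d1 d2 e1 e2 :
  mu_dot d (d1 - d2) e (e1 - e2) = mu_dot d d1 e e1 - mu_dot d d2 e e2.
Proof. by rewrite /mu_dot !mulmxBr !raddfB /= ?ReB; ring. Qed.

Lemma mu_dotBl d e d1 d2 e1 e2 :
  mu_dot (d1 - d2) d (e1 - e2) e = mu_dot d1 d e1 e - mu_dot d2 d e2 e.
Proof. by rewrite /mu_dot !mulmxBl !raddfB /= ?ReB; ring. Qed.

Lemma mu_dotC d d' e e' : mu_dot d d' e e' = mu_dot d' d e' e.
Proof. by rewrite /mu_dot mxtrace_mulC (mxtrace_mulC e). Qed.

(** Here [u] and [v] are the squared moments before and after the step and [q] is their pairing. The
    first inequality simplifies to [v <= q], the second to [2 q - v <= u]. *)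
Lemma cocoercive_arith (u v q r s : R) :
  0 <= u + r - (q + r) - 2 * (u - q + s - (q - v + s)) + (u - q - (q - v)) ->
  0 <= u - q - (q - v) -> v <= q /\ v <= u.
Proof. lra. Qed.

(** With diagonal moments the step scales the entry [(i, j)] by [exp (- (a i + b j) / 4)], so it is
    [flow] at time [1 / 2], and [w] is the operator of [(mu1 x, mu2 x)] in diagonal form. *)
Lemma descent_step_diag (a : 'rV[R]_n.+1) (b : 'rV[R]_m.+1) x : 0 < nsq x ->
  mu1 x = dg a -> mu2 x = dg b ->
  let x' := act (dg (map_mx expR (- (4^-1 *: a)))) (dg (map_mx expR (- (4^-1 *: b)))) x in
  [/\ 0 < nsq x', musq x' <= musq x & musq x' / 2 <= ln (nsq x) - ln (nsq x')].
Proof.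
move=> x0 ha hb x'.
pose w (p : idx) : R := a 0 p.1.2 + b 0 p.2.
have entry y p : entries (lr_app (dg a) (dg b) y) p = (w p)%:C * entries y p.
  by rewrite /entries /lr_app mxE mul_dgl mul_dgr /w rmorphD /=; ring.
have vdiagE y : vdiag w (entries y) = vform (lr_operator (dg a) (dg b)) (entries y).
  rewrite /vform Re_sum vapp_lr; apply: eq_bigr => p _.
  by rewrite entry mulrCA ReZ (mulrC (Num.conj _)) -sqmodE.
have x'E : entries x' = flow w (entries x) (1 / 2).
  apply/funext => -[[l i] j]; rewrite /entries /x' /act /flow /= adj_dg mul_dgr mul_dgl.
  rewrite !mxE mulrAC -rmorphM /= -expRD; congr ((expR _)%:C * _); by rewrite /w /=; field.
clearbody x'.
have x'0 : 0 < nsq x'.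
  have [l hl] := nsq_gt0_ex x0; apply: (@nsq_gt0 _ _ _ _ _ l).
  apply: contra_neq hl => h0; apply/matrixP => i j.
  have := congr1 (fun f : idx -> C => f (l, i, j)) x'E.
  rewrite {1}/entries /= h0 mxE /flow => /esym/eqP; rewrite mulf_eq0 => /orP[|/eqP h1]; last exact: h1.
  by rewrite eq_complex /= gt_eqF// expR_gt0.
have := mu1_adj x; have := mu2_adj x; have := mu1_adj x'; have := mu2_adj x'.
move=> h2' h1' h2 h1.
have [d dE] : exists d : 'M[C]_n.+1, d = mu1 x - mu1 x' by eexists.
have [e eE] : exists e : 'M[C]_m.+1, e = mu2 x - mu2 x' by eexists.
have adB p (X Y : 'M[C]_p) : X ^t* = X -> Y ^t* = Y -> (X - Y) ^t* = X - Y.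
  move=> hX hY; rewrite -[in RHS]hX -[in RHS]hY.
  by apply/matrixP => i j; rewrite !mxE rmorphB.
have hd : d ^t* = d by rewrite dE; exact: adB.
have he : e ^t* = e by rewrite eE; exact: adB.
have [l hl] := nsq_gt0_ex x0.
have xn0 : exists k, entries x k != 0.
  apply/existsP; apply: contraLR hl; rewrite negb_exists negbK => /forallP h0.
  apply/eqP/matrixP => i j; have := h0 (l, i, j); rewrite negbK => /eqP.
  by rewrite mxE.
have bound (f : idx -> C) : vnorm (vapp (lr_operator d e) f) <= 2 * (fsq d + fsq e) * vnorm f.
  have [z ->] := entries_surj f.
  by rewrite vapp_lr !vnorm_entries; exact: lr_app_le.
(* The Hermitian operator is that of the change of moment [(d, e)]; its constant [fsq d + fsq e]
   expands to [musq x - 2 p + musq x'], where [p] is the pairing of the two moments. *)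
have := @flow_cocoercive R _ w (lr_operator d e) (entries x) (fsq d + fsq e)
  (fun p q => lr_operator_hermitian p q hd he) xn0 bound.
rewrite /= -x'E !vdiagE !(lr_moment _ _ x0) !(lr_moment _ _ x'0) -ha -hb.
have mE y : mu_dot (mu1 y) (mu1 y) (mu2 y) (mu2 y) = musq y.
  by rewrite /mu_dot (fsq_hermitian (mu1_adj y)) (fsq_hermitian (mu2_adj y)).
have [p pE] : exists p, mu_dot (mu1 x) (mu1 x') (mu2 x) (mu2 x') = p by eexists.
have pC : mu_dot (mu1 x') (mu1 x) (mu2 x') (mu2 x) = p by rewrite mu_dotC.
have dx : mu_dot d (mu1 x) e (mu2 x) = musq x - p by rewrite dE eE mu_dotBl mE pC.
have dx' : mu_dot d (mu1 x') e (mu2 x') = p - musq x' by rewrite dE eE mu_dotBl mE pE.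
have de : fsq d + fsq e = (musq x - p) - (p - musq x').
  by rewrite -dx -dx' -mu_dotB -dE -eE /mu_dot (fsq_hermitian hd) (fsq_hermitian he).
rewrite mE pE dx dx' de.
set tv := complex.Re (\tr (mu1 x)) / _ + _; set td := complex.Re (\tr d) / _ + _ => hco.
have := addr_ge0 (fsq_ge0 d) (fsq_ge0 e); rewrite de => musqB.
have [hp hle] := cocoercive_arith hco musqB.
split; [exact: x'0 | exact: hle |].
apply: (@le_trans _ _ (p / 2)); first by rewrite ler_pM2r ?invr_gt0.
(* Jensen's inequality with the weights of [x'], not of [x]: as [x'] is [x] scaled by
   [exp (- w / 4)], the mean of [exp (w / 2)] is [nsq x / nsq x'], while the mean of [w / 2] is
   [p / 2]. *)
pose wt (q : idx) := sqmod (entries x' q) / nsq x'.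
have sum_wt : \sum_q wt q = 1.
  transitivity (vnorm (entries x') / nsq x'); first by rewrite /vnorm mulr_suml.
  by rewrite vnorm_entries (mulfV (lt0r_neq0 x'0)).
have wt0 q : 0 <= wt q by apply: divr_ge0; [exact: sqmod_ge0 | exact: nsq_ge0].
have := @jensen_expR R _ wt (fun q => w q / 2) wt0; rewrite sum_wt lexx subrr addr0 => /(_ isT).
have -> : \sum_q wt q * (w q / 2) = p / 2.
  have : vdiag w (entries x') / nsq x' = p.
    rewrite vdiagE -vnorm_entries (lr_moment _ _ x'0) -ha -hb (tr_mu1 x0) (tr_mu2 x0) !mul0r !addr0.
    exact: pE.
  by move=> <-; rewrite /vdiag !mulr_suml; apply: eq_bigr => q _; rewrite /wt; ring.
have -> : \sum_q wt q * expR (w q / 2) = nsq x / nsq x'.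
  rewrite -(vnorm_entries x) /vnorm mulr_suml; apply: eq_bigr => q _.
  have E : expR (- (1 / 2 * (w q / 2))) ^+ 2 * expR (w q / 2) = 1.
    have e0 : 2%:R * - (1 / 2 * (w q / 2)) + w q / 2 = 0 by field.
    by rewrite -expRM_natl -expRD e0 expR0.
  rewrite /wt x'E /flow sqmod_scale.
  transitivity (1 * (sqmod (entries x q) / nsq x')); last exact: mul1r.
  by rewrite -[in RHS]E; ring.
rewrite -ler_ln ?posrE; [|exact: expR_gt0|exact: divr_gt0].
by rewrite expRK ln_div.
Qed.

Definition step x : tuple :=
  act (expmx (- (2 * 2)^-1 *: mu1 x)) (expmx (- (2 * 2)^-1 *: mu2 x)) x.

Lemma expmx_step p (U : 'M[C]_p.+1) (a : 'rV[R]_p.+1) : U \is unitarymx ->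
  expmx (- (2 * 2)^-1 *: (U ^t* *m dg a *m U)) =
  U ^t* *m dg (map_mx expR (- (4^-1 *: a))) *m U.
Proof.
move=> uU; rewrite -(expmx_spectral _ uU); congr expmx.
rewrite scalemxAl scalemxAr; have -> // : - (2 * 2)^-1 *: dg a = dg (- (4^-1 *: a)).
apply/matrixP => i j; rewrite !mxE; case: eqP => _; last by rewrite !mulr0n mulr0.
by rewrite !mulr1n rmorphN rmorphM /= mulNr -natrM natinv.
Qed.

(** Unitary equivariance of the moments and of the step reduces this to diagonal moments. *)
Lemma descent_step x : 0 < nsq x ->
  [/\ 0 < nsq (step x), musq (step x) <= musq x
    & musq (step x) / 2 <= ln (nsq x) - ln (nsq (step x))].
Proof.
move=> x0.
have [U [a [uU eU]]] := hermitian_spectral (mu1_adj x).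
have [V [b [uV eV]]] := hermitian_spectral (mu2_adj x).
have h1 : mu1 (act U V x) = dg a.
  rewrite mu1_act_unitary// eU.
  by have := unitary_conjK (dg a) (etrans (unitary_adj U) uU); rewrite trmxCK.
have h2 : mu2 (act U V x) = dg b.
  rewrite mu2_act_unitary// eV.
  by have := unitary_conjK (dg b) (etrans (unitary_adj V) uV); rewrite trmxCK.
have n0 : 0 < nsq (act U V x) by rewrite (nsq_act_unitary _ uU uV).
have := descent_step_diag n0 h1 h2.
set y := act _ _ (act U V x); have -> : y = act U V (step x).
  rewrite /y /step eU eV !expmx_step// !act_act; congr act.
    by rewrite !mulmxA (unitary_mulV uU) mul1mx.
  by rewrite !mulmxA (unitary_mulV uV) mul1mx.
have mE z : musq (act U V z) = musq z.
  by rewrite /musq (mu1_act_unitary _ uU uV) (mu2_act_unitary _ uU uV) (fsq_unitary _ uU uU) (fsq_unitary _ uV uV).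
by rewrite /= !mE !(nsq_act_unitary _ uU uV).
Qed.

End Step.

Lemma polarization_arith (R : realType) (a b c d e f : R) :
  a + b <= c + d -> c + d <= e + f -> a + c - 2 * e + (b + d - 2 * f) <= 0.
Proof. lra. Qed.

(** * Block upper triangular tuples *)

Section Blocks.
Variables (R : realType) (n m N : nat).
Local Notation C := R[i].
Local Notation dg d := (diag_mx (map_mx (real_complex R) d)).
Local Notation tuple := ('I_N -> 'M[C]_(n.+1, m.+1)).
Variables (rb : 'I_n.+1 -> nat) (cb : 'I_m.+1 -> nat).
Hypothesis rb_mono : forall i j : 'I_n.+1, (i <= j)%N -> (rb i <= rb j)%N.
Hypothesis cb_mono : forall i j : 'I_m.+1, (i <= j)%N -> (cb i <= cb j)%N.
Implicit Types (x y z : tuple).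

Definition block_upper x := forall l i j, (cb j < rb i)%N -> x l i j = 0.
Definition block_diag x : tuple :=
  fun l => \matrix_(i, j) if rb i == cb j then x l i j else 0.
Definition diag_part p (b : 'I_p -> nat) (T : 'M[C]_p) : 'M[C]_p :=
  \matrix_(i, j) if b i == b j then T i j else 0.

Lemma block_diag_idem x : block_diag (block_diag x) = block_diag x.
Proof. by apply/funext => l; apply/matrixP => i j; rewrite !mxE; case: eqP. Qed.

Lemma diag_part_upper p (b : 'I_p -> nat) (T : 'M[C]_p) : upper T -> upper (diag_part b T).
Proof. by move=> hT i j ij; rewrite mxE hT//; case: ifP. Qed.

Lemma diag_part_lower p (b : 'I_p -> nat) (T : 'M[C]_p) : lower T -> lower (diag_part b T).
Proof. by move=> hT i j ij; rewrite mxE hT//; case: ifP. Qed.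

Lemma diag_part_diag p (b : 'I_p -> nat) (T : 'M[C]_p) i : (diag_part b T) i i = T i i.
Proof. by rewrite mxE eqxx. Qed.

Lemma diag_part_unit_upper p (b : 'I_p -> nat) (T : 'M[C]_p) :
  upper T -> T \in unitmx -> diag_part b T \in unitmx.
Proof.
move=> hT; rewrite !unitmxE (upper_det hT) (upper_det (diag_part_upper b hT)).
by under [in X in _ -> X]eq_bigr do rewrite diag_part_diag.
Qed.

Lemma diag_part_unit_lower p (b : 'I_p -> nat) (T : 'M[C]_p) :
  lower T -> T \in unitmx -> diag_part b T \in unitmx.
Proof.
move=> hT; rewrite !unitmxE (lower_det hT) (lower_det (diag_part_lower b hT)).
by under [in X in _ -> X]eq_bigr do rewrite diag_part_diag.
Qed.

Lemma act_entry t s x l i j :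
  act t s x l i j = \sum_i' \sum_j' t i i' * x l i' j' * Num.conj (s j j').
Proof.
rewrite /act mxE; under eq_bigr do rewrite mxE adjE mulr_suml.
by rewrite exchange_big.
Qed.

(** Along [i], [i'], [j'], [j] the levels can only increase in a nonzero term. *)
Lemma act_upper_zero t s x l i j i' j' : upper t -> lower s -> block_upper x ->
  ~~ [&& rb i <= rb i', rb i' <= cb j' & cb j' <= cb j]%N ->
  t i i' * x l i' j' * Num.conj (s j j') = 0.
Proof.
move=> ht hs hx; rewrite !negb_and -!ltnNge => /or3P[h|h|h].
- by rewrite ht ?mul0r//; rewrite ltnNge; apply/negP => /rb_mono; rewrite leqNgt h.
- by rewrite hx// mulr0 mul0r.
- by rewrite hs ?rmorph0 ?mulr0//; rewrite ltnNge; apply/negP => /cb_mono; rewrite leqNgt h.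
Qed.

Lemma act_block_upper t s x : upper t -> lower s -> block_upper x ->
  block_upper (act t s x).
Proof.
move=> ht hs hx l i j h; rewrite act_entry big1// => i' _; rewrite big1// => j' _.
apply: act_upper_zero => //; apply/negP => /and3P[h1 h2 h3].
by have := leq_trans h1 (leq_trans h2 h3); rewrite leqNgt h.
Qed.

(** If the levels of [i] and [j] agree, an increasing chain of levels between them is constant, so
    only diagonal blocks contribute. *)
Lemma block_diag_act t s x : upper t -> lower s -> block_upper x ->
  block_diag (act t s x) = act (diag_part rb t) (diag_part cb s) (block_diag x).
Proof.
move=> ht hs hx; apply/funext => l; apply/matrixP => i j; rewrite mxE !act_entry.
case: eqP => [e|ne]; last first.
  rewrite big1// => i' _; rewrite big1// => j' _; rewrite !mxE.
  case: eqP => [e1|]; last by rewrite !mul0r.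
  case: eqP => [e2|]; last by rewrite mulr0 mul0r.
  case: eqP => [e3|]; last by rewrite rmorph0 mulr0.
  by case: ne; rewrite e1 e2 e3.
apply: eq_bigr => i' _; apply: eq_bigr => j' _; rewrite !mxE.
case: (boolP [&& rb i <= rb i', rb i' <= cb j' & cb j' <= cb j]%N) => [/and3P[h1 h2 h3]|h].
  rewrite -e in h3.
  have e1 : rb i = rb i' by apply/eqP; rewrite eqn_leq h1 (leq_trans h2 h3).
  have e2 : rb i' = cb j' by apply/eqP; rewrite eqn_leq h2 -e1 h3.
  by rewrite e1 eqxx e2 eqxx -e e1 e2 eqxx.
rewrite (act_upper_zero _ ht hs hx h).
have := act_upper_zero l ht hs hx h.
by case: eqP => _; case: eqP => _; case: eqP => _; rewrite ?mul0r ?mulr0 ?rmorph0 ?mul0r ?mulr0.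
Qed.

Lemma nsq_block_diag_le x : nsq (block_diag x) <= nsq x.
Proof.
apply: ler_sum => i _; apply: ler_sum => j _; apply: ler_sum => l _.
by rewrite mxE; case: ifP => // _; rewrite sqmod0 sqmod_ge0.
Qed.

Variables (P : 'rV[R]_n.+1) (Q : 'rV[R]_m.+1) (kappa : R).
Hypothesis sumP : \sum_i P 0 i = 1.
Hypothesis sumPQ2 : \sum_i P 0 i ^+ 2 + \sum_j Q 0 j ^+ 2 = kappa.
Hypothesis PQ_ge : forall i j, (rb i <= cb j)%N -> kappa <= P 0 i + Q 0 j.
Hypothesis PQ_cut : forall k, \sum_(i | (rb i <= k)%N) P 0 i = \sum_(j | (cb j <= k)%N) Q 0 j.

Lemma tr_dg_lgram (p : 'rV[R]_n.+1) x :
  complex.Re (\tr (dg p *m lgram x)) = \sum_i p 0 i * \sum_j mass x i j.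
Proof.
by rewrite /mxtrace Re_sum; apply: eq_bigr => i _; rewrite mul_dgl ReZ lgram_diagE.
Qed.

Lemma tr_dg_rgram (p : 'rV[R]_m.+1) x :
  complex.Re (\tr (dg p *m rgram x)) = \sum_j p 0 j * \sum_i mass x i j.
Proof.
by rewrite /mxtrace Re_sum; apply: eq_bigr => i _; rewrite mul_dgl ReZ rgram_diagE.
Qed.

Lemma fsqB_hermitian p (X Y : 'M[C]_p) : X ^t* = X -> Y ^t* = Y ->
  fsq (X - Y) = fsq X + fsq Y - 2 * complex.Re (\tr (Y *m X)).
Proof.
move=> hX hY; rewrite -(fsq_hermitian hX) -(fsq_hermitian hY) -fsq_hermitian; last first.
  by rewrite -[in RHS]hX -[in RHS]hY; apply/matrixP => i j; rewrite !mxE rmorphB.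
rewrite mulmxBl !mulmxBr !raddfB /= (mxtrace_mulC X Y) ?ReB.
move: (\tr (X *m X)) (\tr (Y *m X)) (\tr (Y *m Y)) => [a1 a2] [b1 b2] [c1 c2] /=; ring.
Qed.

Lemma fsq_dg p (d : 'rV[R]_p) : fsq (dg d) = \sum_i d 0 i ^+ 2.
Proof.
rewrite /fsq; apply: eq_bigr => i _; rewrite (bigD1 i)//= big1 ?addr0 => [|j ji].
  by rewrite !mxE eqxx mulr1n sqmodR.
by rewrite !mxE eq_sym (negbTE ji) mulr0n sqmod0.
Qed.

(** All mass lies where [P 0 i + Q 0 j >= kappa], so the pairing of the Gram matrices with [(P, Q)]
    is at least [kappa]. Both sides of the pairing have squared norm at most [kappa]; by
    polarization their squared distance is nonpositive. *)
Lemma balanced_of_min x : block_upper x -> nsq x = 1 ->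
  fsq (lgram x) + fsq (rgram x) <= kappa ->
  [/\ lgram x = dg P, rgram x = dg Q & block_diag x = x].
Proof.
move=> ux nx hx.
have pair_ge : kappa <= complex.Re (\tr (dg P *m lgram x)) + complex.Re (\tr (dg Q *m rgram x)).
  rewrite tr_dg_lgram tr_dg_rgram.
  have -> : kappa = \sum_i \sum_j kappa * mass x i j.
    by rewrite -[LHS]mulr1 -nx /nsq mulr_sumr; apply: eq_bigr => i _; rewrite mulr_sumr.
  have -> : \sum_j Q 0 j * \sum_i mass x i j = \sum_i \sum_j Q 0 j * mass x i j.
    by rewrite exchange_big; apply: eq_bigr => j _; rewrite mulr_sumr.
  rewrite -big_split /=; apply: ler_sum => i _.
  rewrite mulr_sumr -big_split /=; apply: ler_sum => j _.
  have [ij|ji] := leqP (rb i) (cb j).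
    by rewrite -mulrDl ler_wpM2r ?mass_ge0 ?PQ_ge.
  suff -> : mass x i j = 0 by rewrite !mulr0 addr0.
  by rewrite /mass big1// => l _; rewrite ux// sqmod0.
have h : fsq (lgram x - dg P) + fsq (rgram x - dg Q) <= 0.
  rewrite !fsqB_hermitian ?lgram_adj ?rgram_adj ?adj_dg// !fsq_dg.
  by apply: polarization_arith; rewrite sumPQ2; [exact: hx | exact: pair_ge].
have eL : lgram x = dg P.
  apply/eqP; rewrite -subr_eq0; apply/eqP/fsq_eq0/eqP.
  rewrite eq_le fsq_ge0 andbT; apply: le_trans h.
  by rewrite lerDl fsq_ge0.
have eR : rgram x = dg Q.
  apply/eqP; rewrite -subr_eq0; apply/eqP/fsq_eq0/eqP.
  rewrite eq_le fsq_ge0 andbT; apply: le_trans h.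
  by rewrite lerDr fsq_ge0.
split=> //.
have rowE i : \sum_j mass x i j = P 0 i.
  by apply: complexI; rewrite -lgram_diagE eL !mxE eqxx mulr1n.
have colE j : \sum_i mass x i j = Q 0 j.
  by apply: complexI; rewrite -rgram_diagE eR !mxE eqxx mulr1n.
(* Rows of level at most [k] and columns of level at most [k] carry the same mass by [PQ_cut]. The
   mass of these columns already lies in these rows, so these rows have nothing left in the other
   columns. *)
have cut0 k : \sum_(i | (rb i <= k)%N) \sum_(j | ~~ (cb j <= k)%N) mass x i j = 0.
  have := PQ_cut k.
  under eq_bigr do rewrite -rowE.
  under [in X in _ = X]eq_bigr do rewrite -colE.
  rewrite [RHS]exchange_big [RHS](bigID (fun i => rb i <= k)%N) /=.
  rewrite [X in _ = _ + X]big1 ?addr0 => [|i ik]; last first.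
    rewrite big1// => j jk; rewrite /mass big1// => l _; rewrite ux ?sqmod0//.
    by rewrite -ltnNge in ik; exact: leq_ltn_trans ik.
  under eq_bigr do rewrite (bigID (fun j => cb j <= k)%N) /=.
  by rewrite big_split /= => h1; apply: (addrI _ (etrans h1 (esym (addr0 _)))).
apply/funext => l; apply/matrixP => i j; rewrite mxE; case: eqP => // /eqP.
rewrite neq_ltn => /orP[ij|ji]; last by rewrite ux.
have := cut0 (rb i); rewrite pair_big_dep /= => /psumr_eq0P h0.
have m0 : mass x i j = 0.
  by apply: (h0 _ (i, j)) => [p _|/=]; [exact: mass_ge0 | rewrite leqnn -ltnNge].
apply/esym/eqP; rewrite -sqmod_eq0; apply/eqP.
by apply: (psumr_eq0P _ m0) => // k _; exact: sqmod_ge0.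
Qed.

End Blocks.

(** * The capacity bound on the centralizer of (P, Q) *)

Section Capacity.
Variable R : realType.
Local Notation C := R[i].
Local Notation dg d := (diag_mx (map_mx (real_complex R) d)).

Lemma comm_dgP p (T : 'M[C]_p) (P : 'rV[R]_p) :
  (forall i j, P 0 i != P 0 j -> T i j = 0) -> T *m dg P = dg P *m T.
Proof.
move=> h; apply/matrixP => i j; rewrite mul_dgr mul_dgl mulrC.
by have [->//|/h->] := eqVneq (P 0 i) (P 0 j); rewrite !mulr0.
Qed.

Lemma mul_dg_exp p (a b : 'rV[R]_p) :
  dg (map_mx expR a) *m dg (map_mx expR b) = dg (map_mx expR (a + b)).
Proof.
rewrite mul_dg; congr diag_mx; congr map_mx; apply/rowP => i.
by rewrite !mxE expRD.
Qed.

Lemma dg_exp0 p : dg (map_mx expR (0 : 'rV[R]_p)) = 1%:M.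
Proof. by apply/matrixP => i j; rewrite !mxE expR0. Qed.

(** A singular value decomposition adapted to [P]. The Gram matrix of [T] commutes with [dg P], so
    [W] diagonalizes both; [e] is half the logarithm of its spectrum, and the remaining factor [k]
    is unitary. *)
Lemma polar_commuting p (T : 'M[C]_p) (P : 'rV[R]_p) :
  T \in unitmx -> T *m dg P = dg P *m T ->
  exists (k W : 'M[C]_p) (e : 'rV[R]_p) (s : 'I_p -> 'I_p),
  [/\ k \is unitarymx, W \is unitarymx, T = k *m dg (map_mx expR e) *m W,
      W *m dg P *m W ^t* = dg (\row_i P 0 (s i)) &
      k ^t* *m dg P *m k = dg (\row_i P 0 (s i))].
Proof.
move=> uT cT.
have cT' : T ^t* *m dg P = dg P *m T ^t*.
  by have := congr1 (fun X : 'M[C]_p => X ^t*) cT; rewrite !adjM adj_dg => ->.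
have hH : (T ^t* *m T) ^t* = T ^t* *m T by rewrite adjM trmxCK.
have cH : (T ^t* *m T) *m dg P = dg P *m (T ^t* *m T).
  by rewrite -mulmxA cT !mulmxA cT'.
have [W [d [s [uW eH eP]]]] := commuting_spectral hH cH.
have eD : (T *m W ^t*) ^t* *m (T *m W ^t*) = dg d.
  rewrite adjM trmxCK; transitivity (W *m (T ^t* *m T) *m W ^t*); first by rewrite !mulmxA.
  by rewrite eH; have := unitary_conjK (dg d) (etrans (unitary_adj W) uW); rewrite trmxCK.
have d0 i : 0 <= d 0 i.
  have := congr1 (fun M : 'M[C]_p => complex.Re (M i i)) eD.
  rewrite mxE [in X in _ = X]mxE mxE eqxx mulr1n /= => <-.
  rewrite Re_sum; apply: sumr_ge0 => j _.
  by rewrite adjE mulrC -sqmodE /=; exact: sqmod_ge0.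
have dp i : 0 < d 0 i.
  rewrite lt_neqAle d0 andbT eq_sym.
  have /prodf_neq0 : \prod_i (d 0 i)%:C != 0 :> C.
    have := congr1 determinant eH; rewrite !det_mulmx !det_adj det_diag.
    have detT : \det T != 0 by rewrite -unitfE -unitmxE.
    move=> hdet; apply: contraNneq detT => h0.
    have : Num.conj (\det T) * \det T = 0.
      rewrite hdet; under eq_bigr do rewrite mxE.
      by rewrite h0 mulr0 mul0r.
    by move=> /eqP; rewrite mulf_eq0 conjC_eq0 orbb.
  move=> /(_ i isT); apply: contraNneq => ->; by rewrite rmorph0.
pose e : 'rV[R]_p := \row_i (ln (d 0 i) / 2).
have ed : dg d = dg (map_mx expR (e + e)).
  congr diag_mx; congr map_mx; apply/rowP => i; rewrite !mxE -splitr lnK//.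
  by rewrite posrE.
pose k := T *m W ^t* *m dg (map_mx expR (- e)).
have uk : k ^t* \is unitarymx.
  apply/unitarymxP; rewrite trmxCK /k adjM adj_dg -mulmxA.
  rewrite (mulmxA ((T *m W ^t*) ^t*)) eD ed !mul_dg_exp.
  by rewrite (_ : - e + (e + e - e) = 0) ?dg_exp0//; rewrite addrK addNr.
exists k, W, e, s; split; [by rewrite -unitary_adj | exact: uW | | exact: eP | ].
  rewrite /k -(mulmxA _ (dg (map_mx expR (- e)))) mul_dg_exp addNr dg_exp0 mulmx1.
  by rewrite -mulmxA (unitary_mulVr uW) mulmx1.
have Pk : dg P *m k = k *m dg (\row_i P 0 (s i)).
  rewrite /k -!mulmxA; have -> : dg (map_mx expR (- e)) *m dg (\row_i P 0 (s i)) =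
     dg (\row_i P 0 (s i)) *m dg (map_mx expR (- e)).
    by rewrite !mul_dg; congr diag_mx; congr map_mx; apply/rowP => i; rewrite !mxE mulrC.
  rewrite -eP !mulmxA -cT; congr (_ *m _).
  by rewrite -(mulmxA T (W ^t*) W) (unitary_mulVr uW) mulmx1.
by rewrite -mulmxA Pk mulmxA; move/unitarymxP: uk; rewrite trmxCK => ->; rewrite mul1mx.
Qed.

Variables (n m N : nat).
Local Notation tuple := ('I_N -> 'M[C]_(n.+1, m.+1)).
Implicit Types (x y z : tuple).

Lemma mass_act_dg (a : 'rV[R]_n.+1) (b : 'rV[R]_m.+1) z i j :
  mass (act (dg (map_mx expR a)) (dg (map_mx expR b)) z) i j =
  expR (2 * (a 0 i + b 0 j)) * mass z i j.
Proof.
rewrite /mass mulr_sumr; apply: eq_bigr => l _.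
rewrite /act adj_dg mul_dgr mul_dgl mulrAC -rmorphM /= !mxE -expRD sqmod_scale.
by rewrite -expRM_natl.
Qed.

Lemma sum_mass_row (a : 'rV[R]_n.+1) (p : 'rV[R]_n.+1) z : lgram z = dg p ->
  \sum_i \sum_j mass z i j * a 0 i = \sum_i p 0 i * a 0 i.
Proof.
move=> h; apply: eq_bigr => i _; rewrite -mulr_suml; congr (_ * _).
by apply: complexI; rewrite -lgram_diagE h !mxE eqxx mulr1n.
Qed.

Lemma sum_mass_col (b : 'rV[R]_m.+1) (q : 'rV[R]_m.+1) z : rgram z = dg q ->
  \sum_i \sum_j mass z i j * b 0 j = \sum_j q 0 j * b 0 j.
Proof.
move=> h; rewrite exchange_big; apply: eq_bigr => j _; rewrite -mulr_suml; congr (_ * _).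
by apply: complexI; rewrite -rgram_diagE h !mxE eqxx mulr1n.
Qed.

Lemma nsq_of_lgram (p : 'rV[R]_n.+1) z : lgram z = dg p -> nsq z = \sum_i p 0 i.
Proof.
by move=> h; apply: complexI; rewrite -tr_lgram h mxtrace_dg.
Qed.

(** On the centralizer the weighted sum equals the trace of [dg P] against the logarithm of
    [T ^t* *m T], which the adapted decomposition evaluates. *)
Lemma weighted_polar p (T k W : 'M[C]_p.+1) (P e : 'rV[R]_p.+1) (s : 'I_p.+1 -> 'I_p.+1) :
  k \is unitarymx -> W \is unitarymx -> T = k *m dg (map_mx expR e) *m W ->
  W *m dg P *m W ^t* = dg (\row_i P 0 (s i)) ->
  upper T \/ lower T -> (forall i j, P 0 i != P 0 j -> T i j = 0) ->
  \sum_i P 0 i * ln (sqmod (T i i)) = \sum_i P 0 (s i) * (2 * e 0 i).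
Proof.
move=> uk uW eT eP hT hPT.
have gT : T ^t* *m T = W ^t* *m dg (map_mx expR (e + e)) *m W.
  rewrite eT !adjM adj_dg -mul_dg_exp.
  transitivity (W ^t* *m dg (map_mx expR e) *m (k ^t* *m k) *m dg (map_mx expR e) *m W).
    by rewrite !mulmxA.
  by rewrite (unitary_mulVr uk) mulmx1 !mulmxA.
rewrite (ln_diag_weighted_comm (P := fun i => P 0 i) uW gT hT hPT).
transitivity (complex.Re (\tr (dg P *m (W ^t* *m dg (e + e) *m W)))).
  by rewrite /mxtrace Re_sum; apply: eq_bigr => i _; rewrite mul_dgl ReZ.
rewrite mxtrace_mulC -!mulmxA mxtrace_mulC -!mulmxA (mulmxA W) eP mul_dg mxtrace_dg /=.
by apply: eq_bigr => i _; rewrite !mxE; ring.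
Qed.

(** After the unitary factors are absorbed, the masses of [w] form a probability distribution whose
    marginals are the relabelled [P] and [Q]. Jensen's inequality for the exponents [2 (e i + f j)]
    then bounds the norm below by the two weighted sums. *)
Lemma capacity_ge (P : 'rV[R]_n.+1) (Q : 'rV[R]_m.+1) z T S :
  \sum_i P 0 i = 1 -> lgram z = dg P -> rgram z = dg Q ->
  T \in unitmx -> S \in unitmx -> upper T -> lower S ->
  (forall i j, P 0 i != P 0 j -> T i j = 0) ->
  (forall i j, Q 0 i != Q 0 j -> S i j = 0) ->
  \sum_i P 0 i * ln (sqmod (T i i)) + \sum_j Q 0 j * ln (sqmod (S j j)) <=
  ln (nsq (act T S z)).
Proof.
move=> sP hl hr uT uS tT tS hT hS.
have [k [W [e [s [uk uW eT eP _]]]]] := polar_commuting uT (comm_dgP hT).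
have [k' [V [f [s' [uk' uV eS eQ _]]]]] := polar_commuting uS (comm_dgP hS).
rewrite (weighted_polar uk uW eT eP (or_introl tT) hT).
rewrite (weighted_polar uk' uV eS eQ (or_intror tS) hS).
have [w wE] : exists w, w = act W V z by eexists.
have lw : lgram w = dg (\row_i P 0 (s i)) by rewrite wE (lgram_act_unitary _ _ uV) hl eP.
have rw : rgram w = dg (\row_i Q 0 (s' i)) by rewrite wE (rgram_act_unitary _ _ uW) hr eQ.
have nw : nsq w = 1 by rewrite wE (nsq_act_unitary _ uW uV) (nsq_of_lgram hl).
have -> : nsq (act T S z) = \sum_(p : 'I_n.+1 * 'I_m.+1) mass w p.1 p.2 * expR (2 * (e 0 p.1 + f 0 p.2)).
  have -> : act T S z = act k k' (act (dg (map_mx expR e)) (dg (map_mx expR f)) w).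
    by rewrite wE !act_act eT eS.
  rewrite (nsq_act_unitary _ uk uk') /nsq pair_big; apply: eq_bigr => p _.
  by rewrite mass_act_dg mulrC.
have nw' : \sum_(p : 'I_n.+1 * 'I_m.+1) mass w p.1 p.2 = 1.
  by rewrite -[RHS]nw /nsq [RHS]pair_big.
have := @jensen_expR R _ (fun p : 'I_n.+1 * 'I_m.+1 => mass w p.1 p.2)
  (fun p => 2 * (e 0 p.1 + f 0 p.2)) (fun p => mass_ge0 w p.1 p.2).
rewrite nw' lexx subrr addr0 => /(_ isT) h.
rewrite -ler_expR lnK; last by rewrite posrE; exact: lt_le_trans (expR_gt0 _) h.
apply: le_trans h; rewrite ler_expR.
have -> : \sum_(p : 'I_n.+1 * 'I_m.+1) mass w p.1 p.2 * (2 * (e 0 p.1 + f 0 p.2)) =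
  \sum_i \sum_j mass w i j * (e + e) 0 i + \sum_i \sum_j mass w i j * (f + f) 0 j.
  transitivity (\sum_i \sum_j mass w i j * (2 * (e 0 i + f 0 j))).
    by rewrite [RHS]pair_big.
  rewrite -big_split /=; apply: eq_bigr => i _; rewrite -big_split /=.
  by apply: eq_bigr => j _; rewrite !mxE; ring.
rewrite (sum_mass_row _ lw) (sum_mass_col _ rw); rewrite le_eqVlt; apply/orP; left; apply/eqP; congr (_ + _).
  by apply: eq_bigr => i _; rewrite !mxE; ring.
by apply: eq_bigr => i _; rewrite !mxE; ring.
Qed.

End Capacity.

Lemma square_arith (R : realType) (a b c : R) : 0 <= b -> 1 + c <= a ->
  (a - 1) ^+ 2 * b <= a * a * b - b - b * (2 * c).
Proof. by move=> b0 h; have := ler_wpM2l b0 h; nra. Qed.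

Lemma shift_arith (R : realType) (p q v : R) : 1 - q <= v -> p - 1 - q <= p - 2 + v.
Proof. lra. Qed.

Lemma sub_arith (R : realType) (r : R) : r <= 1 -> 1 - 2 + r <= 0.
Proof. lra. Qed.

(** * Limits along an ultrafilter *)

Section Ultra.
Variables (R : realType) (F : set_system nat) (FU : UltraFilter F).
Local Notation C := R[i].
Local Notation dg d := (diag_mx (map_mx (real_complex R) d)).

Let FP : ProperFilter F := ultra_proper.
Let FF : Filter F := filter_filter.

Lemma ultra_finite (J : finType) (s : nat -> J) : exists c, F [set t | s t = c].
Proof.
apply: contrapT => /forallNP h.
have : F (fun t => forall c, s t <> c).
  apply: filter_forall => c; by have [/h|] := in_ultra_setVsetC [set t | s t = c] FU.
by move=> /filter_ex[t /(_ (s t))].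
Qed.

(** Compactness gives a cluster point, and an ultrafilter converges to each of its cluster
    points. *)
Lemma ultra_bounded (u : nat -> R) (M : R) : (forall t, `|u t| <= M) ->
  exists l : R, u t @[t --> F] --> l.
Proof.
move=> hM.
have uF : F (u @^-1` `[- M, M]%classic).
  by apply: (filterS _ (@filterT _ F _)) => t _ /=; rewrite in_itv /= -ler_norml.
have [l [_ hl]] := @segment_compact R (- M) M _ (fmap_proper_filter u FP) uF.
exists l => A hA; have [hc|hc] := in_ultra_setVsetC (u @^-1` A) FU; first exact: hc.
have [t [ht ht']] : (~` A) `&` A !=set0 by apply: hl.
by [].
Qed.

Lemma mxcvg_near p q (X Y : nat -> 'M[C]_(p, q)) L : F (fun t => X t = Y t) ->
  mxcvg F X L -> mxcvg F Y L.
Proof.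
move=> h hX i j; apply: cvg_trans (hX i j); apply: near_eq_cvg.
by apply: filterS h => t ->.
Qed.

Lemma ultra_unitary p (U : nat -> 'M[C]_p) : (forall t, U t \is unitarymx) ->
  exists L, mxcvg F U L /\ L \is unitarymx.
Proof.
move=> uU.
have bnd t i j : sqmod (U t i j) <= 1.
  have := congr1 (fun M : 'M[C]_p => complex.Re (M i i)) (unitary_mulV (uU t)).
  rewrite mxE [in X in _ = X]mxE eqxx Re_sum /= => <-.
  under eq_bigr do rewrite adjE -sqmodE /=.
  by rewrite (bigD1 j)//= lerDl; apply: sumr_ge0 => k _; exact: sqmod_ge0.
have ij i j : exists l : C, U t i j @[t --> F] --> l.
  have sq1 (x y : R) : x ^+ 2 + y ^+ 2 <= 1 -> `|x| <= 1.
    move=> h; rewrite -(@expr_le1 _ 2)// real_normK ?num_real//.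
    by apply: le_trans h; rewrite lerDl sqr_ge0.
  have [a ha] : exists a : R, complex.Re (U t i j) @[t --> F] --> a.
    by apply: (@ultra_bounded _ 1) => t; exact: sq1 (bnd t i j).
  have [b hb] : exists b : R, complex.Im (U t i j) @[t --> F] --> b.
    by apply: (@ultra_bounded _ 1) => t; apply: (sq1 _ (complex.Re (U t i j))); rewrite addrC; exact: bnd.
  by exists (Complex a b); apply: cvg_complex.
have [L hL] := choice (fun p => ij p.1 p.2).
exists (\matrix_(i, j) L (i, j)).
have hU : mxcvg F U (\matrix_(i, j) L (i, j)).
  by move=> i j; rewrite mxE; exact: (hL (i, j)).
split; first exact: hU.
have h1 := mxcvgM FF hU (mxcvg_adj FF hU).
apply/unitarymxP; apply: (mxcvg_unique FP h1).
move=> i j; have -> : (fun t => (U t *m (U t) ^t*) i j) = (fun=> (1%:M : 'M[C]_p) i j).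
  by apply/funext => t; rewrite (unitary_mulV (uU t)).
exact: cvg_cst.
Qed.

Variables (n m N : nat).
Local Notation tuple := ('I_N -> 'M[C]_(n.+1, m.+1)).
Implicit Types (x y z : tuple).

Definition tcvg (X : nat -> tuple) (L : tuple) := forall l, mxcvg F (fun t => X t l) (L l).

Lemma tcvg_act (g : nat -> 'M[C]_n.+1) (h : nat -> 'M[C]_m.+1) X g0 h0 L :
  mxcvg F g g0 -> mxcvg F h h0 -> tcvg X L ->
  tcvg (fun t => act (g t) (h t) (X t)) (act g0 h0 L).
Proof.
move=> hg hh hX l; apply: (mxcvgM FF); last exact: mxcvg_adj.
by apply: (mxcvgM FF); [exact: hg | exact: hX].
Qed.

Lemma tcvg_cst x : tcvg (fun=> x) x.
Proof. by move=> l; exact: mxcvg_cst. Qed.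

Lemma cvg_mass X L i j : tcvg X L -> mass (X t) i j @[t --> F] --> mass L i j.
Proof. by move=> h; apply: cvg_bigsum => l; apply: cvg_sqmod; exact: h. Qed.

Lemma cvg_nsq X L : tcvg X L -> nsq (X t) @[t --> F] --> nsq L.
Proof.
by move=> h; apply: cvg_bigsum => i; apply: cvg_bigsum => j; exact: cvg_mass.
Qed.

Definition tsub x y : tuple := fun l => x l - y l.

Lemma tcvg_sub X Y L M : tcvg X L -> tcvg Y M ->
  tcvg (fun t => tsub (X t) (Y t)) (tsub L M).
Proof.
move=> hX hY l i j; rewrite !mxE; under eq_fun do rewrite !mxE.
by apply: cvgB; [exact: hX | exact: hY].
Qed.

(** Entrywise this is [(exp v - 1)^2 <= exp (2 v) - 1 - 2 v] at [v = e i + f j], a form of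
    [1 + v <= exp v]. The marginals [p] and [q] of the masses of [z] turn the linear term into the
    two sums. *)
Lemma scaled_dist_le (e : 'rV[R]_n.+1) (f : 'rV[R]_m.+1) p q z u :
  lgram z = dg p -> rgram z = dg q ->
  u = act (dg (map_mx expR e)) (dg (map_mx expR f)) z ->
  nsq (tsub u z) <=
  nsq u - nsq z - (\sum_i p 0 i * (2 * e 0 i) + \sum_j q 0 j * (2 * f 0 j)).
Proof.
move=> hl hr uE.
have -> : \sum_i p 0 i * (2 * e 0 i) = \sum_i \sum_j mass z i j * (2 *: e) 0 i.
  by rewrite (sum_mass_row _ hl); apply: eq_bigr => i _; rewrite mxE.
have -> : \sum_j q 0 j * (2 * f 0 j) = \sum_i \sum_j mass z i j * (2 *: f) 0 j.
  by rewrite (sum_mass_col _ hr); apply: eq_bigr => i _; rewrite mxE.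
rewrite -big_split /= /nsq -!sumrB; apply: ler_sum => i _.
rewrite -big_split /= -!sumrB; apply: ler_sum => j _.
have -> : mass u i j = expR (2 * (e 0 i + f 0 j)) * mass z i j by rewrite uE mass_act_dg.
rewrite -mulrDr [(2 *: e) 0 i]mxE [(2 *: f) 0 j]mxE -mulrDr.
have -> : mass (tsub u z) i j = (expR (e 0 i + f 0 j) - 1) ^+ 2 * mass z i j.
  rewrite /mass mulr_sumr; apply: eq_bigr => l _; rewrite -sqmod_scale; congr sqmod.
  have tsubE (a b : tuple) : tsub a b l i j = a l i j - b l i j by rewrite !mxE.
  rewrite tsubE uE /act adj_dg mul_dgr mul_dgl mulrAC -rmorphM /= !mxE -expRD.
  by rewrite rmorphB /= mulrBl mul1r.
have := expR_ge1Dx (e 0 i + f 0 j); have := mass_ge0 z i j.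
have -> : expR (2 * (e 0 i + f 0 j)) = expR (e 0 i + f 0 j) * expR (e 0 i + f 0 j).
  by rewrite -expRD; congr expR; ring.
by move=> m0 h; exact: square_arith.
Qed.

(* Kempf-Ness uniqueness: two points with the same moment [(P, Q)] in the closure of one
   orbit of the centralizer of [(P, Q)] are unitarily equivalent. The Hermitian parts of
   the group elements are diagonalized together with [P] and [Q]; then
   [c t] below is the logarithm of a character, and [0 <= nsq u - 1 - c t] as well as
   [1 - c t <= sum y e^(-2(e + f))] force the displacement to vanish in the limit. *)
Lemma limit_of_critical_unitary (P : 'rV[R]_n.+1) (Q : 'rV[R]_m.+1) z y
    (T : nat -> 'M[C]_n.+1) (S : nat -> 'M[C]_m.+1) :
  \sum_i P 0 i = 1 -> lgram z = dg P -> rgram z = dg Q -> lgram y = dg P -> rgram y = dg Q ->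
  (forall t, T t \in unitmx) -> (forall t, S t \in unitmx) ->
  (forall t, T t *m dg P = dg P *m T t) -> (forall t, S t *m dg Q = dg Q *m S t) ->
  tcvg (fun t => act (T t) (S t) z) y ->
  exists U V, [/\ U \is unitarymx, V \is unitarymx & y = act U V z].
Proof.
move=> sP zl zr yl yr uT uS cT cS hy.
have polar p (X : nat -> 'M[C]_p) (d : 'rV[R]_p) : (forall t, X t \in unitmx) ->
    (forall t, X t *m dg d = dg d *m X t) ->
    exists (k W : nat -> 'M[C]_p) (e : nat -> 'rV[R]_p) (s : nat -> {ffun 'I_p -> 'I_p}),
    forall t, [/\ k t \is unitarymx, W t \is unitarymx,
      X t = k t *m dg (map_mx expR (e t)) *m W t,
      W t *m dg d *m (W t) ^t* = dg (\row_i d 0 (s t i)) &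
      (k t) ^t* *m dg d *m k t = dg (\row_i d 0 (s t i))].
  move=> uX cX.
  have : forall t, exists q : 'M[C]_p * 'M[C]_p * 'rV[R]_p * {ffun 'I_p -> 'I_p},
      [/\ q.1.1.1 \is unitarymx, q.1.1.2 \is unitarymx,
      X t = q.1.1.1 *m dg (map_mx expR q.1.2) *m q.1.1.2,
      q.1.1.2 *m dg d *m q.1.1.2 ^t* = dg (\row_i d 0 (q.2 i)) &
      q.1.1.1 ^t* *m dg d *m q.1.1.1 = dg (\row_i d 0 (q.2 i))].
    move=> t; have [k [W [e [s [h1 h2 h3 h4 h5]]]]] := polar_commuting (uX t) (cX t).
    have sE : \row_i d 0 (finfun s i) = \row_i d 0 (s i).
      by apply/rowP => i; rewrite !mxE ffunE.
    by exists (k, W, e, finfun s); rewrite /= sE; split; [exact: h1|exact: h2|exact: h3|exact: h4|exact: h5].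
  move=> /choice[q hq]; exists (fun t => (q t).1.1.1), (fun t => (q t).1.1.2),
    (fun t => (q t).1.2), (fun t => (q t).2) => t; exact: hq.
have [k [W [e [s hT]]]] := polar _ _ _ uT cT.
have [k' [V [f [s' hS]]]] := polar _ _ _ uS cS.
have uk t : k t \is unitarymx by case: (hT t).
have uW t : W t \is unitarymx by case: (hT t).
have uk' t : k' t \is unitarymx by case: (hS t).
have uV t : V t \is unitarymx by case: (hS t).
have [k0 [hk uk0]] := ultra_unitary uk.
have [W0 [hW uW0]] := ultra_unitary uW.
have [k0' [hk' uk0']] := ultra_unitary uk'.
have [V0 [hV uV0]] := ultra_unitary uV.
(* [s] and [s'] have finitely many values, so each is constant on a set of the ultrafilter; the
   relabelled spectra become the fixed rows [P0] and [Q0]. *)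
have [s0 hs0] := ultra_finite s.
have [s0' hs0'] := ultra_finite s'.
pose P0 : 'rV[R]_n.+1 := \row_i P 0 (s0 i).
pose Q0 : 'rV[R]_m.+1 := \row_i Q 0 (s0' i).
have kP0 : k0 ^t* *m dg P *m k0 = dg P0.
  have h1 := mxcvgM FF (mxcvgM FF (mxcvg_adj FF hk) (@mxcvg_cst _ _ _ FF _ _ (dg P))) hk.
  apply: (mxcvg_unique FP h1); apply: (@mxcvg_near _ _ (fun=> dg P0)); last exact: mxcvg_cst.
  by apply: filterS hs0 => t /= st; have [_ _ _ _ ->] := hT t; rewrite st.
have kQ0 : k0' ^t* *m dg Q *m k0' = dg Q0.
  have h1 := mxcvgM FF (mxcvgM FF (mxcvg_adj FF hk') (@mxcvg_cst _ _ _ FF _ _ (dg Q))) hk'.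
  apply: (mxcvg_unique FP h1); apply: (@mxcvg_near _ _ (fun=> dg Q0)); last exact: mxcvg_cst.
  by apply: filterS hs0' => t /= st; have [_ _ _ _ ->] := hS t; rewrite st.
have [zt ztE] : exists zt, zt = fun t => act (W t) (V t) z by eexists.
have [z0 z0E] : exists z0, z0 = act W0 V0 z by eexists.
have [y0 y0E] : exists y0, y0 = act (k0 ^t*) (k0' ^t*) y by eexists.
have [u uE] : exists u, u = fun t => act ((k t) ^t*) ((k' t) ^t*) (act (T t) (S t) z).
  by eexists.
have hz : tcvg zt z0 by rewrite ztE z0E; exact: (tcvg_act hW hV (@tcvg_cst z)).
have hu : tcvg u y0.
  by rewrite uE y0E; exact: (tcvg_act (mxcvg_adj FF hk) (mxcvg_adj FF hk') hy).
have uk0a : k0 ^t* \is unitarymx by rewrite unitary_adj.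
have uk0a' : k0' ^t* \is unitarymx by rewrite unitary_adj.
have y0l : lgram y0 = dg P0 by rewrite y0E (lgram_act_unitary _ _ uk0a') yl trmxCK kP0.
have y0r : rgram y0 = dg Q0 by rewrite y0E (rgram_act_unitary _ _ uk0a) yr trmxCK kQ0.
have ny0 : nsq y0 = 1 by rewrite y0E (nsq_act_unitary _ uk0a uk0a') (nsq_of_lgram yl).
have nz : nsq z = 1 by rewrite (nsq_of_lgram zl).
have nz0 : nsq z0 = 1 by rewrite z0E (nsq_act_unitary _ uW0 uV0).
have nzt t : nsq (zt t) = 1 by rewrite ztE (nsq_act_unitary _ (uW t) (uV t)).
have ztl t : lgram (zt t) = dg (\row_i P 0 (s t i)).
  by rewrite ztE (lgram_act_unitary _ _ (uV t)) zl; case: (hT t).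
have ztr t : rgram (zt t) = dg (\row_i Q 0 (s' t i)).
  by rewrite ztE (rgram_act_unitary _ _ (uW t)) zr; case: (hS t).
have ut t : u t = act (dg (map_mx expR (e t))) (dg (map_mx expR (f t))) (zt t).
  rewrite uE ztE !act_act; have [_ _ -> _ _] := hT t; have [_ _ -> _ _] := hS t.
  congr act; rewrite !mulmxA.
    by rewrite (unitary_mulVr (uk t)) mul1mx.
  by rewrite (unitary_mulVr (uk' t)) mul1mx.
pose c t := \sum_i P 0 (s t i) * (2 * e t 0 i) + \sum_j Q 0 (s' t j) * (2 * f t 0 j).
have dist_le t : nsq (tsub (u t) (zt t)) <= nsq (u t) - 1 - c t.
  have := scaled_dist_le (ztl t) (ztr t) (ut t); rewrite nzt /c.
  by under eq_bigr do rewrite mxE; under [X in _ - (_ + X)]eq_bigr do rewrite mxE.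
pose b t := \sum_i \sum_j mass y0 i j * expR (- (2 * (e t 0 i + f t 0 j))).
(* The masses of [y0] have marginals [P0] and [Q0], so [1 - c t] is the mean of [1 - v] under them,
   for [v = 2 (e i + f j)], and [b t] is the mean of [exp (- v)]. *)
have c_ge : F (fun t => 1 - c t <= b t).
  apply: filterS (filterI hs0 hs0') => t [/= st st'].
  have -> : 1 - c t = \sum_i \sum_j mass y0 i j * (1 - (2 * (e t 0 i + f t 0 j))).
    rewrite /c st st'.
    have -> : \sum_i P 0 (s0 i) * (2 * e t 0 i) = \sum_i \sum_j mass y0 i j * (2 *: e t) 0 i.
      by rewrite (sum_mass_row _ y0l); apply: eq_bigr => i _; rewrite !mxE.
    have -> : \sum_j Q 0 (s0' j) * (2 * f t 0 j) = \sum_i \sum_j mass y0 i j * (2 *: f t) 0 j.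
      by rewrite (sum_mass_col _ y0r); apply: eq_bigr => i _; rewrite !mxE.
    have shift (v : R) : 1 - v = nsq y0 - v by rewrite ny0.
    rewrite shift -big_split /= {1}/nsq -sumrB; apply: eq_bigr => i _.
    rewrite -big_split /= -sumrB; apply: eq_bigr => j _; rewrite !mxE.
    by ring.
  apply: ler_sum => i _; apply: ler_sum => j _; rewrite ler_wpM2l ?mass_ge0//.
  exact: expR_ge1Dx.
(* Where [y0] has mass, [exp (- v)] is the quotient of the masses of [zt t] and [u t], which
   converges. Thus [r] is the part of the mass of [z0] on the support of [y0]. *)
pose r := \sum_i \sum_j (if mass y0 i j == 0 then 0 else mass z0 i j).
have hb : b t @[t --> F] --> r.
  apply: cvg_bigsum => i; apply: cvg_bigsum => j.
  have [->|y0n] := eqVneq (mass y0 i j) 0.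
    by under eq_fun do rewrite mul0r; exact: cvg_cst.
  have h1 : mass y0 i j * (mass (zt t) i j / mass (u t) i j) @[t --> F] --> mass z0 i j.
    have -> : mass z0 i j = mass y0 i j * (mass z0 i j / mass y0 i j).
      by rewrite mulrC divfK.
    apply: cvgM; first exact: cvg_cst.
    by apply: cvgM; [exact: cvg_mass | apply: cvgV => //; exact: cvg_mass].
  apply: cvg_trans h1; apply: near_eq_cvg.
  have un0 : F (fun t => mass (u t) i j != 0).
    exact: (cvgr_neq0 (mass y0 i j) (@cvg_mass _ _ i j hu) y0n).
  apply: filterS un0 => t un0; congr (_ * _).
  have uz : mass (u t) i j = expR (2 * (e t 0 i + f t 0 j)) * mass (zt t) i j.
    by rewrite ut mass_act_dg.
  have zn0 : mass (zt t) i j != 0 by apply: contra_neq un0 => h; rewrite uz h mulr0.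
  by rewrite uz invfM mulrCA mulfV// mulr1 expRN.
have r1 : r <= 1.
  rewrite -nz0; apply: ler_sum => i _; apply: ler_sum => j _.
  by case: ifP => // _; exact: mass_ge0.
have hdist := cvg_nsq (tcvg_sub hu hz).
have hbound : nsq (u t) - 2 + b t @[t --> F] --> nsq y0 - 2 + r.
  by apply: cvgD => //; apply: cvgB; [exact: cvg_nsq | exact: cvg_cst].
(* The displacement is at most [nsq (u t) - 1 - c t], hence at most [nsq (u t) - 2 + b t], whose
   limit [r - 1] is nonpositive. *)
have d0 : nsq (tsub y0 z0) <= nsq y0 - 2 + r.
  apply: (ler_cvg_to hdist hbound); apply: filterS c_ge => t ct.
  exact: (le_trans (dist_le t) (shift_arith _ ct)).
have dz : nsq (tsub y0 z0) <= 0 by apply: le_trans d0 _; rewrite ny0; exact: (sub_arith r1).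
have yz : y0 = z0.
  apply/funext => l; apply/eqP; rewrite -subr_eq0; apply/negP => /negP h.
  by have := @nsq_gt0 _ _ _ _ (tsub y0 z0) l h; rewrite ltNge dz.
exists (k0 *m W0), (k0' *m V0); split; [exact: (mul_unitarymx uk0 uW0) | exact: (mul_unitarymx uk0' uV0) |].
by rewrite -act_act -z0E -yz y0E (act_unitaryVK _ uk0 uk0').
Qed.

End Ultra.

(** * Rate of descent *)

Section RealSequence.
Variable R : realType.

Lemma lyapunov_arith (f f' p p' c a a' x : R) : a' ^+ 2 / 2 <= f - f' ->
  - (x * a / 2) <= p' - p ->
  f' - p' - c + x * a' / 2 <= f - p - c + x * a / 2 - a' * (a' - x) / 2.
Proof.
have -> : a' * (a' - x) = a' ^+ 2 - x * a' by ring.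
lra.
Qed.

(** For [a = |mu|], [f = ln |x|^2] and [p = Phi]. If [a] stayed above [x + e], the nonnegative [W]
    would lose at least [e^2 / 2] at every step. *)
Lemma slope_sequence_limit (a f p : nat -> R) (x c : R) : 0 <= x ->
  (forall k, 0 <= a k) -> (forall k, a k.+1 <= a k) ->
  (forall k, a k.+1 ^+ 2 / 2 <= f k - f k.+1) ->
  (forall k, - (x * a k / 2) <= p k.+1 - p k) ->
  (forall k, p k + c <= f k) ->
  forall e, 0 < e -> exists K, forall k, (K <= k)%N -> a k < x + e.
Proof.
move=> x0 a0 amono hf hp hc e e0.
have amono' k l : (k <= l)%N -> a l <= a k.
  elim: l => [|l IH]; first by rewrite leqn0 => /eqP->.
  by rewrite leq_eqVlt => /orP[/eqP->//|/IH]; apply: le_trans.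
suff [K hK] : exists K, a K < x + e by exists K => k kK; apply: le_lt_trans hK; exact: amono'.
apply: contrapT => /forallNP h.
have ha k : x + e <= a k by rewrite leNgt; apply/negP/h.
(* The summand [x * a k / 2] repairs a shift of index: the drop of [f] is measured by [a k.+1], that
   of [p] by [a k]. *)
pose W k := f k - p k - c + x * a k / 2.
have W0 k : 0 <= W k.
  apply: addr_ge0; first by rewrite -addrA -opprD subr_ge0.
  by apply: divr_ge0 => //; apply: mulr_ge0.
have dW k : W k.+1 <= W k - e ^+ 2 / 2.
  apply: le_trans (lyapunov_arith c (hf k) (hp k)) _; rewrite lerD2l lerN2 ler_pM2r ?invr_gt0//.
  rewrite expr2; apply: ler_pM; rewrite ?(ltW e0)//.
    by apply: le_trans (ha _); rewrite lerDr.
  by rewrite lerBrDl; exact: ha.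
have Wk k : W k <= W 0 - k%:R * (e ^+ 2 / 2).
  elim: k => [|k IH]; first by rewrite mul0r subr0.
  apply: le_trans (dW k) _; rewrite -[k.+1%:R]natr1 mulrDl mul1r opprD addrA lerD2r.
  exact: IH.
have e20 : 0 < e ^+ 2 / 2 by rewrite divr_gt0// exprn_gt0.
pose k := Num.bound (W 0 / (e ^+ 2 / 2)).
have q0 : 0 <= W 0 / (e ^+ 2 / 2) := divr_ge0 (W0 0) (ltW e20).
have := archi_boundP q0.
rewrite ltr_pdivrMr// => h1; have := le_trans (W0 k) (Wk k).
by rewrite subr_ge0 leNgt h1.
Qed.

Lemma cauchy_schwarz2 (I J : finType) (a b : I -> R) (c d : J -> R) (x : R) : 0 <= x ->
  \sum_i a i ^+ 2 + \sum_j c j ^+ 2 = x ^+ 2 ->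
  \sum_i a i * b i + \sum_j c j * d j <=
  x * Num.sqrt (\sum_i b i ^+ 2 + \sum_j d j ^+ 2).
Proof.
move=> x0 hx; set S := _ + _; set Y := _ + _.
pose f (k : I + J) : R[i] := match k with inl i => (a i)%:C | inr j => (c j)%:C end.
pose g (k : I + J) : R[i] := match k with inl i => (b i)%:C | inr j => (d j)%:C end.
have := sqmod_sumM_le f g.
have -> : \sum_k f k * g k = S%:C.
  rewrite big_sumType /= /S rmorphD /= !sumR; congr (_ + _).
    by apply: eq_bigr => i _; rewrite rmorphM.
  by apply: eq_bigr => i _; rewrite rmorphM.
have -> : \sum_k sqmod (f k) = x ^+ 2.
  by rewrite big_sumType /= -hx; congr (_ + _); apply: eq_bigr => i _; rewrite sqmodR.
have -> : \sum_k sqmod (g k) = Y.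
  by rewrite big_sumType /= /Y; congr (_ + _); apply: eq_bigr => i _; rewrite sqmodR.
rewrite sqmodR => h; apply: le_trans (ler_norm S) _.
rewrite -sqrtr_sqr -[x in leRHS]ger0_norm// -sqrtr_sqr -sqrtrM ?sqr_ge0//.
by rewrite ler_sqrt// mulr_ge0 ?sqr_ge0// addr_ge0// sumr_ge0// => i _; exact: sqr_ge0.
Qed.

End RealSequence.

(** * Effect of one step on the weighted log-diagonals *)

Section BusemannStep.
Variable R : realType.
Local Notation C := R[i].
Local Notation dg d := (diag_mx (map_mx (real_complex R) d)).

Lemma expmx_unit p (X : 'M[C]_p.+1) : X ^t* = X -> expmx X \in unitmx.
Proof.
move=> /hermitian_spectral[U [a [uU ->]]]; rewrite (expmx_spectral _ uU) !unitmx_mul.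
have uU' := unitarymx_unit uU; rewrite uU'.
have -> : U ^t* \in unitmx by apply: unitarymx_unit; rewrite unitary_adj.
rewrite andTb andbT unitmxE det_diag unitfE; apply/prodf_neq0 => i _.
by rewrite !mxE eq_complex /= gt_eqF// expR_gt0.
Qed.

(** The quotient [tau = t' *m invmx t] is triangular, and being [u' ^t* *m E *m u] with
    [E = exp (- X / 4)], it has as Gram matrix the exponential of [- X / 2] conjugated by [u].
    Diagonals of triangular matrices multiply, so the linear bound applies to [tau]. *)
Lemma busemann_step p (u t u' t' X : 'M[C]_p.+1) (P : 'I_p.+1 -> R) :
  u \is unitarymx -> u' \is unitarymx -> X ^t* = X -> t \in unitmx ->
  [/\ upper t, upper t' & forall i j : 'I_p.+1, (i <= j)%N -> P j <= P i] \/
  [/\ lower t, lower t' & forall i j : 'I_p.+1, (i <= j)%N -> P i <= P j] ->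
  u' *m t' = expmx (- (2 * 2)^-1 *: X) *m (u *m t) ->
  \sum_i P i * ln (sqmod (t i i)) - (\sum_i P i * complex.Re ((u ^t* *m X *m u) i i)) / 2 <=
  \sum_i P i * ln (sqmod (t' i i)).
Proof.
move=> uu uu' hX ut htri ht'.
have [U [a [uU eX]]] := hermitian_spectral hX.
have eE := expmx_step a uU; rewrite -eX in eE.
have [E Edef] : exists E, E = expmx (- (2 * 2)^-1 *: X) by eexists.
rewrite -Edef in ht' eE.
have hE : E ^t* = E by rewrite eE !adjM trmxCK adj_dg mulmxA.
have [tau tauE] : exists tau, tau = t' *m invmx t by eexists.
have t'E : t' = tau *m t by rewrite tauE mulmxKV.
have tauE' : tau = u' ^t* *m E *m u.
  rewrite tauE; have -> : t' = u' ^t* *m (E *m (u *m t)).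
    by rewrite -ht' mulmxA (unitary_mulVr uu') mul1mx.
  by rewrite !mulmxA mulmxK.
have [V VE] : exists V, V = U *m u by eexists.
have uV : V \is unitarymx by rewrite VE; exact: mul_unitarymx uU uu.
have VA : V ^t* = u ^t* *m U ^t* by rewrite VE adjM.
pose e : 'rV[R]_p.+1 := - (4^-1 *: a) - 4^-1 *: a.
have EE : E *m E = U ^t* *m dg (map_mx expR e) *m U.
  have eD := mul_dg_exp (- (4^-1 *: a)) (- (4^-1 *: a)).
  rewrite eE -[e]/(- (4^-1 *: a) - 4^-1 *: a) -eD.
  move: (dg (map_mx expR (- (4^-1 *: a)))) => D.
  transitivity (U ^t* *m D *m (U *m U ^t*) *m D *m U); first by rewrite !mulmxA.
  by rewrite (unitary_mulV uU) mulmx1 !mulmxA.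
have gtau : tau ^t* *m tau = V ^t* *m dg (map_mx expR e) *m V.
  rewrite tauE' !adjM trmxCK hE.
  transitivity (u ^t* *m (E *m (u' *m u' ^t*) *m E) *m u); first by rewrite !mulmxA.
  by rewrite (unitary_mulV uu') mulmx1 EE VA VE !mulmxA.
have VeV i : complex.Re ((V ^t* *m dg e *m V) i i) = - (complex.Re ((u ^t* *m X *m u) i i) / 2).
  have -> : V ^t* *m dg e *m V = (- 2^-1 : R)%:C *: (u ^t* *m X *m u).
    have -> : dg e = (- 2^-1 : R)%:C *: dg a.
      apply/matrixP => k l; rewrite !mxE; case: eqP => _; last by rewrite !mulr0n mulr0.
      by rewrite !mulr1n -rmorphM /=; congr (_%:C); field.
    by rewrite eX VA VE -scalemxAr -scalemxAl !mulmxA.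
  by rewrite mxE ReZ; ring.
have utau : tau \in unitmx.
  rewrite tauE' !unitmx_mul (unitarymx_unit uu).
  have -> : E \in unitmx.
    by rewrite Edef; apply: expmx_unit; apply/matrixP => i j; rewrite !mxE rmorphM /= -[in RHS]hX !mxE rmorphN fmorphV -natrM rmorph_nat.
  by have -> : u' ^t* \in unitmx by apply: unitarymx_unit; rewrite unitary_adj.
have diagE i : t' i i = tau i i * t i i.
  by rewrite t'E; case: htri => -[h1 h2 _]; [rewrite upperM_diag// | rewrite lowerM_diag//];
     rewrite tauE; [apply: upperM => //; exact: upper_inv | apply: lowerM => //; exact: lower_inv].
have n0 i : tau i i != 0 /\ t i i != 0.
  case: htri => -[h1 h2 _].
    have htau : upper tau by rewrite tauE; apply: upperM => //; exact: upper_inv.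
    by split; exact: upper_diag_neq0.
  have htau : lower tau by rewrite tauE; apply: lowerM => //; exact: lower_inv.
  by split; exact: lower_diag_neq0.
have lnE i : ln (sqmod (t' i i)) = ln (sqmod (tau i i)) + ln (sqmod (t i i)).
  have [h1 h2] := n0 i; rewrite diagE sqmodM lnM// posrE lt_neqAle sqmod_ge0 eq_sym sqmod_eq0 ?h1 ?h2//.
have key : \sum_i P i * complex.Re ((V ^t* *m dg e *m V) i i) <= \sum_i P i * ln (sqmod (tau i i)).
  case: htri => -[h1 h2 hP].
    have htau : upper tau by rewrite tauE; apply: upperM => //; exact: upper_inv.
    exact: (ln_diag_weighted_upper uV gtau htau hP).
  have htau : lower tau by rewrite tauE; apply: lowerM => //; exact: lower_inv.
  exact: (ln_diag_weighted_lower uV gtau htau hP).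
under [leRHS]eq_bigr do rewrite lnE mulrDr.
rewrite big_split /= [leRHS]addrC lerD2l; apply: le_trans key.
rewrite mulr_suml -sumrN; apply: ler_sum => i _.
by rewrite VeV mulrN mulrA.
Qed.

(** As [X] and [Y] have trace zero, [P] and [Q] may be recentred at their means, which lowers their
    squared norm to [x ^+ 2]; the rest is Cauchy-Schwarz on the diagonals. *)
Lemma traceless_pairing_le n m (P : 'rV[R]_n.+1) (Q : 'rV[R]_m.+1) (X : 'M[C]_n.+1) (Y : 'M[C]_m.+1)
    (x : R) : 0 <= x -> \sum_i P 0 i = 1 -> \sum_j Q 0 j = 1 ->
  \sum_i P 0 i ^+ 2 + \sum_j Q 0 j ^+ 2 - n.+1%:R^-1 - m.+1%:R^-1 = x ^+ 2 ->
  \tr X = 0 -> \tr Y = 0 ->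
  \sum_i P 0 i * complex.Re (X i i) + \sum_j Q 0 j * complex.Re (Y j j) <=
  x * Num.sqrt (fsq X + fsq Y).
Proof.
move=> x0 sP sQ hx tX tY.
have shift p (Z : 'M[C]_p.+1) (d : 'rV[R]_p.+1) : \tr Z = 0 ->
    \sum_i d 0 i * complex.Re (Z i i) = \sum_i (d 0 i - p.+1%:R^-1) * complex.Re (Z i i).
  move=> tZ; under [RHS]eq_bigr do rewrite mulrBl.
  by rewrite sumrB -mulr_sumr -Re_mxtrace tZ mulr0 subr0.
have sq p (d : 'rV[R]_p.+1) : \sum_i d 0 i = 1 ->
    \sum_i (d 0 i - p.+1%:R^-1) ^+ 2 = \sum_i d 0 i ^+ 2 - p.+1%:R^-1.
  move=> sd; transitivity (\sum_i (d 0 i ^+ 2 - 2 * p.+1%:R^-1 * d 0 i + p.+1%:R^-1 ^+ 2)).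
    by apply: eq_bigr => i _; ring.
  rewrite big_split sumrB /= -mulr_sumr sd sumr_const card_ord -[X in _ + X]mulr_natr.
  have : (p.+1%:R : R) != 0 by rewrite pnatr_eq0.
  by move: (p.+1%:R : R) => c c0; field.
have diag_le p (Z : 'M[C]_p.+1) : \sum_i complex.Re (Z i i) ^+ 2 <= fsq Z.
  apply: ler_sum => i _; rewrite (bigD1 i)//=.
  apply: (@le_trans _ _ (sqmod (Z i i))); first by rewrite /sqmod lerDl sqr_ge0.
  by rewrite lerDl sumr_ge0// => j _; exact: sqmod_ge0.
rewrite (shift _ _ _ tX) (shift _ _ _ tY).
apply: le_trans (cauchy_schwarz2 _ _ x0 _) _.
  by rewrite (sq _ _ sP) (sq _ _ sQ) -hx; ring.
rewrite ler_wpM2l// ler_sqrt ?addr_ge0 ?fsq_ge0//; exact: lerD.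
Qed.

End BusemannStep.

Lemma busemann_arith (R : realType) (a b x y a' b' w : R) :
  a - x / 2 <= a' -> b - y / 2 <= b' -> x + y <= w -> - (w / 2) <= a' + b' - (a + b).
Proof. lra. Qed.

(** * The descent seen from a block upper triangular representative *)

Section Assembly.
Variables (R : realType) (n m N : nat).
Local Notation C := R[i].
Local Notation dg d := (diag_mx (map_mx (real_complex R) d)).
Local Notation tuple := ('I_N -> 'M[C]_(n.+1, m.+1)).
Implicit Types (x y z : tuple).

Definition tscale (c : R) x : tuple := fun l => c%:C *: x l.

Lemma tscale_act c g h x : tscale c (act g h x) = act (c%:C *: g) h x.
Proof. by apply/funext => l; rewrite /tscale /act -!scalemxAl. Qed.

Lemma act_tscale c g h x : act g h (tscale c x) = tscale c (act g h x).
Proof. by apply/funext => l; rewrite /tscale /act -!scalemxAr -!scalemxAl. Qed.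

Lemma nsq_tscale c x : nsq (tscale c x) = c ^+ 2 * nsq x.
Proof.
rewrite /nsq mulr_sumr; apply: eq_bigr => i _; rewrite mulr_sumr; apply: eq_bigr => j _.
by rewrite /mass mulr_sumr; apply: eq_bigr => l _; rewrite mxE sqmod_scale.
Qed.

Lemma adjZ p q (c : R) (X : 'M[C]_(p, q)) : (c%:C *: X) ^t* = c%:C *: X ^t*.
Proof. by apply/matrixP => i j; rewrite !mxE rmorphM /= conjR. Qed.

Lemma lgram_tscale c x : lgram (tscale c x) = (c ^+ 2)%:C *: lgram x.
Proof.
rewrite /lgram scaler_sumr; apply: eq_bigr => l _.
by rewrite /tscale adjZ -scalemxAr -scalemxAl scalerA -rmorphM.
Qed.

Lemma rgram_tscale c x : rgram (tscale c x) = (c ^+ 2)%:C *: rgram x.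
Proof.
rewrite /rgram scaler_sumr; apply: eq_bigr => l _.
by rewrite /tscale adjZ -scalemxAr -scalemxAl scalerA -rmorphM.
Qed.

Lemma musq_tscale c x : c != 0 -> musq (tscale c x) = musq x.
Proof.
move=> c0; have e : (c ^+ 2 * nsq x)^-1 * c ^+ 2 = (nsq x)^-1.
  by rewrite invfM mulrAC mulVf ?mul1r// expf_neq0.
rewrite /musq !mu1E !mu2E nsq_tscale lgram_tscale rgram_tscale !scalerA -!rmorphM /=.
by rewrite e.
Qed.

Lemma musq_unit x : nsq x = 1 ->
  musq x = fsq (lgram x) + fsq (rgram x) - n.+1%:R^-1 - m.+1%:R^-1.
Proof.
move=> nx; rewrite /musq mu1E mu2E nx invr1.
have dgk p (k : R) : (k%:C)%:M = dg (const_mx k : 'rV[R]_p).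
  by apply/matrixP => i j; rewrite !mxE.
have e p (X : 'M[C]_p.+1) : X ^t* = X -> \tr X = 1 ->
    fsq (1%:C *: X - (p.+1%:R^-1%:C)%:M) = fsq X - p.+1%:R^-1.
  move=> hX tX; rewrite scale1r dgk fsqB_hermitian ?adj_dg// fsq_dg.
  rewrite -dgk mul_scalar_mx mxtraceZ tX mulr1 /=.
  under eq_bigr do rewrite mxE.
  rewrite sumr_const card_ord -[X in _ + X - _]mulr_natr.
  have : (p.+1%:R : R) != 0 by rewrite pnatr_eq0.
  by move: (p.+1%:R : R) => c c0; field.
rewrite e ?lgram_adj ?tr_lgram ?nx// e ?rgram_adj ?tr_rgram ?nx//.
by ring.
Qed.

Lemma fsq_conj p (U X : 'M[C]_p) : U \is unitarymx -> fsq (U *m X *m U ^t*) = fsq X.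
Proof. by move=> uU; exact: fsq_unitary. Qed.

Section Limits.
Variables (F : set_system nat) (FU : UltraFilter F).

Let FP : ProperFilter F := ultra_proper.
Let FF : Filter F := filter_filter.

Lemma cst_cvg_eq (K : numFieldType) (V : pseudoMetricNormedZmodType K) (a l : V) :
  a @[_ --> F] --> l -> l = a.
Proof.
have h : a @[_ --> F] --> a by exact: cvg_cst.
move=> h'; exact: (norm_cvg_unique h' h).
Qed.

Lemma mxcvg_lgram (X : nat -> tuple) L : tcvg F X L -> mxcvg F (fun t => lgram (X t)) (lgram L).
Proof.
move=> h i j; rewrite /lgram summxE; under eq_fun do rewrite summxE.
apply: cvg_bigsum => l; have h1 := mxcvgM FF (h l) (mxcvg_adj FF (h l)).
exact: (h1 i j).
Qed.

Lemma mxcvg_rgram (X : nat -> tuple) L : tcvg F X L -> mxcvg F (fun t => rgram (X t)) (rgram L).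
Proof.
move=> h i j; rewrite /rgram summxE; under eq_fun do rewrite summxE.
apply: cvg_bigsum => l; have h1 := mxcvgM FF (mxcvg_adj FF (h l)) (h l).
exact: (h1 i j).
Qed.

Lemma cvg_fsq p q (X : nat -> 'M[C]_(p, q)) L : mxcvg F X L ->
  fsq (X t) @[t --> F] --> fsq L.
Proof.
by move=> h; apply: cvg_bigsum => i; apply: cvg_bigsum => j; apply: cvg_sqmod; exact: h.
Qed.

End Limits.

Lemma descent0 (A : tuple) : descent 2 A 0 = (1%:M, 1%:M).
Proof. by []. Qed.

Definition iterate (A : tuple) k : tuple := act (descent 2 A k).1 (descent 2 A k).2 A.

Lemma descentS (A : tuple) k : descent 2 A k.+1 =
  (expmx (- (2 * 2)^-1 *: mu1 (iterate A k)) *m (descent 2 A k).1,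
   expmx (- (2 * 2)^-1 *: mu2 (iterate A k)) *m (descent 2 A k).2).
Proof. by rewrite /iterate /=; case: (descent 2 A k). Qed.

Lemma iterate0 (A : tuple) : iterate A 0 = A.
Proof. by rewrite /iterate descent0 act1. Qed.

Lemma iterateS (A : tuple) k : iterate A k.+1 = step (iterate A k).
Proof. by rewrite {1}/iterate descentS /= -act_act. Qed.

Lemma iterate_gt0 (A : tuple) k : 0 < nsq A -> 0 < nsq (iterate A k).
Proof.
move=> A0; elim: k => [|k IH]; first by rewrite iterate0.
by rewrite iterateS; case: (descent_step IH).
Qed.

Lemma adj_scale_moment p (X : 'M[C]_p) : X ^t* = X ->
  (- (2 * 2)^-1 *: X) ^t* = - (2 * 2)^-1 *: X.
Proof.
have -> : - (2 * 2)^-1 = (- 4^-1 : R)%:C :> C.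
  by rewrite rmorphN -natrM natinv.
by move=> hX; rewrite adjZ hX.
Qed.

Lemma descent_unit (A : tuple) k :
  (descent 2 A k).1 \in unitmx /\ (descent 2 A k).2 \in unitmx.
Proof.
elim: k => [|k [IH1 IH2]]; first by rewrite descent0 /= !unitmx1.
rewrite descentS /= !unitmx_mul IH1 IH2 !andbT.
by split; apply: expmx_unit; apply: adj_scale_moment; [exact: mu1_adj | exact: mu2_adj].
Qed.

Variables (rb : 'I_n.+1 -> nat) (cb : 'I_m.+1 -> nat).
Hypothesis rb_mono : forall i j : 'I_n.+1, (i <= j)%N -> (rb i <= rb j)%N.
Hypothesis cb_mono : forall i j : 'I_m.+1, (i <= j)%N -> (cb i <= cb j)%N.
Variables (P : 'rV[R]_n.+1) (Q : 'rV[R]_m.+1) (kappa : R).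
Hypothesis sumP : \sum_i P 0 i = 1.
Hypothesis sumQ : \sum_j Q 0 j = 1.
Hypothesis sumPQ2 : \sum_i P 0 i ^+ 2 + \sum_j Q 0 j ^+ 2 = kappa.
Hypothesis PQ_ge : forall i j, (rb i <= cb j)%N -> kappa <= P 0 i + Q 0 j.
Hypothesis PQ_cut : forall k, \sum_(i | (rb i <= k)%N) P 0 i = \sum_(j | (cb j <= k)%N) Q 0 j.
Hypothesis P_dec : forall i j : 'I_n.+1, (i <= j)%N -> P 0 j <= P 0 i.
Hypothesis Q_inc : forall i j : 'I_m.+1, (i <= j)%N -> Q 0 i <= Q 0 j.
Hypothesis P_rb : forall i j, rb i = rb j -> P 0 i = P 0 j.
Hypothesis Q_cb : forall i j, cb i = cb j -> Q 0 i = Q 0 j.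

Let slope_ge0 : 0 <= kappa - n.+1%:R^-1 - m.+1%:R^-1.
Proof.
have sq p (d : 'rV[R]_p.+1) : \sum_i d 0 i = 1 -> 0 <= \sum_i d 0 i ^+ 2 - p.+1%:R^-1.
  move=> sd; apply: (@le_trans _ _ (\sum_i (d 0 i - p.+1%:R^-1) ^+ 2)).
    by apply: sumr_ge0 => i _; exact: sqr_ge0.
  rewrite [X in X <= _](_ : _ = \sum_i (d 0 i ^+ 2 - 2 * p.+1%:R^-1 * d 0 i + p.+1%:R^-1 ^+ 2)).
    rewrite big_split sumrB /= -mulr_sumr sd sumr_const card_ord -[X in _ + X <= _]mulr_natr.
    have : (p.+1%:R : R) != 0 by rewrite pnatr_eq0.
    move: (p.+1%:R : R) => c c0; rewrite le_eqVlt; apply/orP; left; apply/eqP; by field.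
  by apply: eq_bigr => i _; ring.
rewrite -sumPQ2; apply: le_trans (addr_ge0 (sq _ _ sumP) (sq _ _ sumQ)) _.
by rewrite le_eqVlt; apply/orP; left; apply/eqP; ring.
Qed.

Let slope : R := Num.sqrt (kappa - n.+1%:R^-1 - m.+1%:R^-1).

Let slope_sq : \sum_i P 0 i ^+ 2 + \sum_j Q 0 j ^+ 2 - n.+1%:R^-1 - m.+1%:R^-1 = slope ^+ 2.
Proof. by rewrite sumPQ2 sqr_sqrtr. Qed.

Variables (A B Bstar : tuple) (g0 g : 'M[C]_n.+1) (h0 h : 'M[C]_m.+1).
Hypotheses (ug0 : g0 \in unitmx) (uh0 : h0 \in unitmx) (BE : B = act g0 h0 A).
Hypothesis (uB : block_upper rb cb B).
Hypotheses (ug : g \in unitmx) (uh : h \in unitmx).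
Hypotheses (BsE : Bstar = act g h (block_diag rb cb B)).
Hypotheses (Bsl : lgram Bstar = dg P) (Bsr : rgram Bstar = dg Q).

Let u1 p (G u t : 'M[C]_p) : G \in unitmx -> G = u *m t -> t \in unitmx.
Proof. by move=> uG e; move: uG; rewrite e unitmx_mul => /andP[]. Qed.

(* The scaling [Bstar] can be replaced by a block diagonal one. *)
Lemma block_diag_scaling : exists (k : 'M[C]_n.+1) (k' : 'M[C]_m.+1) (t s : _) z,
  [/\ k \is unitarymx, k' \is unitarymx, Bstar = act k k' z &
   [/\ t \in unitmx, s \in unitmx, upper t & lower s] /\
   [/\ z = act (diag_part rb t) (diag_part cb s) (block_diag rb cb B),
     lgram z = dg P & rgram z = dg Q]].
Proof.
have [k [t [uk gE tt]]] := qr_decomposition g.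
have [k' [s [uk' hE ts]]] := ql_decomposition uh.
have [z zE] : exists z, z = act t s (block_diag rb cb B) by eexists.
have BsE' : Bstar = act k k' z by rewrite zE act_act -gE -hE.
have ubd : block_upper rb cb (block_diag rb cb B).
  by move=> l i j ij; rewrite mxE gtn_eqF.
have uz : block_upper rb cb z by rewrite zE; exact: act_block_upper.
have nz : nsq z = 1.
  by rewrite -sumP -(nsq_of_lgram Bsl) BsE' (nsq_act_unitary _ uk uk').
have fz : fsq (lgram z) + fsq (rgram z) = kappa.
  rewrite -(fsq_conj (lgram z) uk) -(fsq_conj (rgram z) uk').
  rewrite -(lgram_act_unitary k z uk') -(rgram_act_unitary k' z uk) -BsE' Bsl Bsr.
  by rewrite !fsq_dg sumPQ2.
(* The Gram matrices of [z] are unitarily conjugate to [dg P] and [dg Q], so their squared norms add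
   up to [kappa]; for a block upper triangular tuple this forces balance and block diagonality. *)
have [zl zr zd] := balanced_of_min sumPQ2 PQ_ge PQ_cut uz nz (eq_ind_r (fun v => v <= kappa) (lexx _) fz).
exists k, k', t, s, z; split; [exact: uk|exact: uk'|exact: BsE'|].
split; first by split; [exact: u1 ug gE|exact: u1 uh hE|exact: tt|exact: ts].
split; [|exact: zl|exact: zr].
by rewrite -zd zE (block_diag_act rb_mono cb_mono tt ts ubd) block_diag_idem.
Qed.

(** [G k] and [H k] carry [B], instead of [A], to the iterate. The last two equations state the
    descent step in terms of the factors, as [busemann_step] needs it. *)
Lemma descent_qr : exists (u t : nat -> 'M[C]_n.+1) (v s : nat -> 'M[C]_m.+1), forall k,
  [/\ u k \is unitarymx, v k \is unitarymx,
      iterate A k = act (u k) (v k) (act (t k) (s k) B) &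
  [/\ t k \in unitmx, s k \in unitmx, upper (t k) & lower (s k)] /\
  [/\ u k.+1 *m t k.+1 = expmx (- (2 * 2)^-1 *: mu1 (iterate A k)) *m (u k *m t k) &
      v k.+1 *m s k.+1 = expmx (- (2 * 2)^-1 *: mu2 (iterate A k)) *m (v k *m s k)]].
Proof.
pose G k := (descent 2 A k).1 *m invmx g0; pose H k := (descent 2 A k).2 *m invmx h0.
have uG k : G k \in unitmx.
  by rewrite unitmx_mul unitmx_inv ug0 andbT; case: (descent_unit A k).
have uH k : H k \in unitmx.
  by rewrite unitmx_mul unitmx_inv uh0 andbT; case: (descent_unit A k).
have AE : A = act (invmx g0) (invmx h0) B by rewrite BE act_act !mulVmx// act1.
have hG : forall k, exists q : 'M[C]_n.+1 * 'M[C]_n.+1,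
    [/\ q.1 \is unitarymx, G k = q.1 *m q.2 & upper q.2].
  by move=> k; have [u [t [h1 h2 h3]]] := qr_decomposition (G k); exists (u, t).
have hH : forall k, exists q : 'M[C]_m.+1 * 'M[C]_m.+1,
    [/\ q.1 \is unitarymx, H k = q.1 *m q.2 & lower q.2].
  by move=> k; have [u [t [h1 h2 h3]]] := ql_decomposition (uH k); exists (u, t).
have [q hq] := choice hG; have [r hr] := choice hH.
exists (fun k => (q k).1), (fun k => (q k).2), (fun k => (r k).1), (fun k => (r k).2) => k.
have [q1 q2 q3] := hq k; have [r1 r2 r3] := hr k.
split; [exact: q1|exact: r1| |].
  transitivity (act (descent 2 A k).1 (descent 2 A k).2 (act (invmx g0) (invmx h0) B)).
    by rewrite -AE.
  by rewrite !act_act -q2 -r2.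
split; first by split; [exact: u1 (uG k) q2|exact: u1 (uH k) r2|exact: q3|exact: r3].
have [_ q2' _] := hq k.+1; have [_ r2' _] := hr k.+1.
by rewrite -q2 -q2' -r2 -r2' /G /H descentS /= !mulmxA.
Qed.

Lemma nsq_A_gt0 : 0 < nsq A.
Proof.
have : 0 < nsq Bstar by rewrite (nsq_of_lgram Bsl) sumP.
move=> /nsq_gt0_ex[l hl]; apply: (@nsq_gt0 _ _ _ _ _ l).
apply: contra_neq hl => A0; rewrite BsE /act.
have -> : block_diag rb cb B l = 0.
  by apply/matrixP => i j; rewrite !mxE BE /act A0 mulmx0 mul0mx mxE if_same.
by rewrite mulmx0 mul0mx.
Qed.

Lemma diag_part_comm p (b : 'I_p -> nat) (X : 'M[C]_p) (d : 'rV[R]_p) :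
  (forall i j, b i = b j -> d 0 i = d 0 j) ->
  diag_part b X *m dg d = dg d *m diag_part b X.
Proof.
move=> hd; apply: comm_dgP => i j dij; rewrite mxE; case: eqP => // e.
by rewrite (hd _ _ e) eqxx in dij.
Qed.

Lemma invmx_comm p (X D : 'M[C]_p) : X \in unitmx -> X *m D = D *m X ->
  invmx X *m D = D *m invmx X.
Proof.
move=> uX e; rewrite -[LHS]mulmx1 -(mulmxV uX) !mulmxA; congr (_ *m _).
by rewrite -(mulmxA _ D) -e mulKmx.
Qed.

Lemma comm_entry p (X : 'M[C]_p) (d : 'rV[R]_p) i j : X *m dg d = dg d *m X ->
  d 0 i != d 0 j -> X i j = 0.
Proof.
move=> /(congr1 (fun M : 'M[C]_p => M i j)); rewrite mul_dgr mul_dgl mulrC => /eqP.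
rewrite -subr_eq0 -mulrBl mulf_eq0 -rmorphB => /orP[|/eqP//].
by rewrite eq_complex /= eqxx andbT subr_eq0 eq_sym => /eqP->; rewrite eqxx.
Qed.

(** Such a quotient leads from the balanced tuple, obtained with [Y], to the block diagonal part of
    an iterate, obtained with [X]. Both factors respect the levels, on which [d] is constant. *)
Lemma relative_comm p (b : 'I_p -> nat) (d : 'rV[R]_p) (X Y : 'M[C]_p) :
  (forall i j, b i = b j -> d 0 i = d 0 j) -> diag_part b Y \in unitmx ->
  (diag_part b X *m invmx (diag_part b Y)) *m dg d =
  dg d *m (diag_part b X *m invmx (diag_part b Y)).
Proof.
move=> hd uY; rewrite -mulmxA (invmx_comm uY (diag_part_comm Y hd)) !mulmxA.
by rewrite (diag_part_comm X hd).
Qed.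

Lemma act_unit_gt0 (a : 'M[C]_n.+1) (b : 'M[C]_m.+1) x : a \in unitmx -> b \in unitmx ->
  0 < nsq x -> 0 < nsq (act a b x).
Proof.
move=> ua ub /nsq_gt0_ex[l hl]; apply: (@nsq_gt0 _ _ _ _ _ l).
apply: contra_neq hl => h1; have xE : x = act (invmx a) (invmx b) (act a b x).
  by rewrite act_act !mulVmx// act1.
by rewrite xE {1}/act h1 mulmx0 mul0mx.
Qed.

Lemma act_unit_gt0_inv (a : 'M[C]_n.+1) (b : 'M[C]_m.+1) x :
  0 < nsq (act a b x) -> 0 < nsq x.
Proof.
move=> /nsq_gt0_ex[l hl]; apply: (@nsq_gt0 _ _ _ _ _ l).
by apply: contra_neq hl => h1; rewrite /act h1 mulmx0 mul0mx.
Qed.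

Lemma descent_slope_limit e : 0 < e ->
  exists K, forall k, (K <= k)%N -> Num.sqrt (musq (iterate A k)) < slope + e.
Proof.
have [u [t [v [s hk]]]] := descent_qr.
have [_ [_ [t0 [s0 [z [_ _ _ [[ut0 us0 tt0 ts0] [zE zl zr]]]]]]]] := block_diag_scaling.
have ud0 := diag_part_unit_upper rb tt0 ut0; have ud0' := diag_part_unit_lower cb ts0 us0.
pose Phi k := \sum_i P 0 i * ln (sqmod (t k i i)) + \sum_j Q 0 j * ln (sqmod (s k j j)).
(* The cost of changing the base point from the block diagonal part of [B] to the balanced [z]. *)
pose cst := \sum_i P 0 i * ln (sqmod (invmx (diag_part rb t0) i i)) +
  \sum_j Q 0 j * ln (sqmod (invmx (diag_part cb s0) j j)).
have it0 k := @iterate_gt0 A k nsq_A_gt0.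
apply: (@slope_sequence_limit R _ (fun k => ln (nsq (iterate A k))) Phi _ cst).
- exact: sqrtr_ge0.
- by move=> k; exact: sqrtr_ge0.
- move=> k; rewrite ler_sqrt; last by rewrite addr_ge0 ?fsq_ge0.
  by rewrite iterateS; case: (descent_step (it0 k)).
- move=> k; rewrite sqr_sqrtr; last by rewrite addr_ge0 ?fsq_ge0.
  by rewrite iterateS; case: (descent_step (it0 k)).
- move=> k; have [uu uv _ [[ut us tt ts] [eu ev]]] := hk k.
  have [uu' uv' _ [[ut' us' tt' ts'] _]] := hk k.+1.
  have hP := busemann_step uu uu' (mu1_adj (iterate A k)) ut
    (or_introl (And3 tt tt' P_dec)) eu.
  have hQ := busemann_step uv uv' (mu2_adj (iterate A k)) us
    (or_intror (And3 ts ts' Q_inc)) ev.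
  have trc p (U X : 'M[C]_p) : U \is unitarymx -> \tr (U ^t* *m X *m U) = \tr X.
    exact: mxtrace_unitary_conj.
  have tX : \tr ((u k) ^t* *m mu1 (iterate A k) *m u k) = 0 by rewrite trc// tr_mu1.
  have tY : \tr ((v k) ^t* *m mu2 (iterate A k) *m v k) = 0 by rewrite trc// tr_mu2.
  have := traceless_pairing_le (sqrtr_ge0 _) sumP sumQ slope_sq tX tY.
  have fc p (U X : 'M[C]_p) : U \is unitarymx -> fsq (U ^t* *m X *m U) = fsq X.
    by move=> uU; rewrite -[in LHS](trmxCK U) trmxCK -[X in _ *m X]trmxCK fsq_conj// unitary_adj.
  rewrite (fc _ _ _ uu) (fc _ _ _ uv) -/(musq _) => hpair.
  exact: busemann_arith hP hQ hpair.
- move=> k; have [uu uv itE [[ut us tt ts] _]] := hk k.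
  have utd := diag_part_unit_upper rb tt ut; have usd := diag_part_unit_lower cb ts us.
  have tri1 := diag_part_upper rb tt; have tri2 := diag_part_lower cb ts.
  have tri1' := upper_inv (diag_part_upper rb tt0) ud0.
  have tri2' := lower_inv (diag_part_lower cb ts0) ud0'.
  have uT : diag_part rb (t k) *m invmx (diag_part rb t0) \in unitmx.
    by rewrite unitmx_mul unitmx_inv utd ud0.
  have uS : diag_part cb (s k) *m invmx (diag_part cb s0) \in unitmx.
    by rewrite unitmx_mul unitmx_inv usd ud0'.
  have cT := relative_comm (t k) P_rb ud0.
  have cS := relative_comm (s k) Q_cb ud0'.
  (* The capacity bound is evaluated at the block diagonal part of the triangularized iterate, whose
     norm is at most that of the iterate. *)
  have := capacity_ge sumP zl zr uT uS (upperM tri1 tri1') (lowerM tri2 tri2')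
    (fun i j => comm_entry cT) (fun i j => comm_entry cS).
  have -> : act (diag_part rb (t k) *m invmx (diag_part rb t0))
      (diag_part cb (s k) *m invmx (diag_part cb s0)) z =
      block_diag rb cb (act (t k) (s k) B).
    rewrite (block_diag_act rb_mono cb_mono tt ts uB) -act_act; congr act.
    by rewrite zE act_act !mulVmx// act1.
  have lnM2 (a b : C) : a != 0 -> b != 0 -> ln (sqmod (a * b)) = ln (sqmod a) + ln (sqmod b).
    by move=> a0 b0; rewrite sqmodM lnM// posrE lt_neqAle sqmod_ge0 eq_sym sqmod_eq0 ?a0 ?b0.
  have eT : \sum_i P 0 i * ln (sqmod ((diag_part rb (t k) *m invmx (diag_part rb t0)) i i)) =
     \sum_i P 0 i * ln (sqmod (t k i i)) + \sum_i P 0 i * ln (sqmod (invmx (diag_part rb t0) i i)).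
    rewrite -big_split; apply: eq_bigr => i _ /=; rewrite -mulrDr; congr (_ * _).
    rewrite (upperM_diag _ tri1 tri1') lnM2 ?diag_part_diag//; first exact: upper_diag_neq0.
    by apply: upper_diag_neq0 => //; rewrite unitmx_inv.
  have eS : \sum_i Q 0 i * ln (sqmod ((diag_part cb (s k) *m invmx (diag_part cb s0)) i i)) =
     \sum_i Q 0 i * ln (sqmod (s k i i)) + \sum_i Q 0 i * ln (sqmod (invmx (diag_part cb s0) i i)).
    rewrite -big_split; apply: eq_bigr => i _ /=; rewrite -mulrDr; congr (_ * _).
    rewrite (lowerM_diag _ tri2 tri2') lnM2 ?diag_part_diag//; first exact: lower_diag_neq0.
    by apply: lower_diag_neq0 => //; rewrite unitmx_inv.
  rewrite eT eS addrACA => hcap; apply: le_trans hcap _.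
  have itn : nsq (iterate A k) = nsq (act (t k) (s k) B).
    by rewrite itE (nsq_act_unitary _ uu uv).
  have pos : 0 < nsq (block_diag rb cb (act (t k) (s k) B)).
    rewrite (block_diag_act rb_mono cb_mono tt ts uB); apply: act_unit_gt0 => //.
    by apply: (@act_unit_gt0_inv g h); rewrite -BsE (nsq_of_lgram Bsl) sumP.
  rewrite itn ler_ln ?posrE//; first exact: nsq_block_diag_le.
  by rewrite -itn; exact: it0.
Qed.

Lemma limit_in_orbit (F : set_system nat) (FU : UltraFilter F) y :
  (forall K : nat, F (fun k => (K <= k)%N)) ->
  tcvg F (fun k => tscale (Num.sqrt (nsq (iterate A k)))^-1 (iterate A k)) y ->
  exists U V, [/\ U \is unitarymx, V \is unitarymx & y = act U V Bstar].
Proof.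
move=> Foo; have FP : ProperFilter F by exact: ultra_proper.
have FF : Filter F by exact: filter_filter.
have it0 k := @iterate_gt0 A k nsq_A_gt0.
have [c cE] : exists c, c = fun k => (Num.sqrt (nsq (iterate A k)))^-1 by eexists.
have c0 k : 0 < c k by rewrite cE invr_gt0 sqrtr_gt0; exact: it0.
have [x xE] : exists x : nat -> tuple, x = fun k => tscale (c k) (iterate A k) by eexists.
have -> : (fun k => tscale (Num.sqrt (nsq (iterate A k)))^-1 (iterate A k)) = x.
  by rewrite xE cE.
move=> hy.
have nx k : nsq (x k) = 1.
  rewrite xE nsq_tscale cE exprVn sqr_sqrtr; last exact: ltW (it0 k).
  by rewrite mulVf// (lt0r_neq0 (it0 k)).
have ny : nsq y = 1.
  have h1 := cvg_nsq FU hy.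
  have e1 : (fun k => nsq (x k)) = (fun=> 1) by apply/funext.
  rewrite e1 in h1.
  exact: (cst_cvg_eq FU h1).
have mux k : musq (x k) = musq (iterate A k).
  by rewrite xE musq_tscale// (lt0r_neq0 (c0 k)).
have hmu : musq (x k) @[k --> F] --> musq y.
  have -> : (fun k => musq (x k)) =
      (fun k => fsq (lgram (x k)) + fsq (rgram (x k)) - n.+1%:R^-1 - m.+1%:R^-1).
    by apply/funext => k; rewrite musq_unit.
  rewrite (musq_unit ny).
  apply: cvgB; last exact: cvg_cst.
  apply: cvgB; last exact: cvg_cst.
  by apply: cvgD; apply: cvg_fsq; [exact: (mxcvg_lgram FU hy) | exact: (mxcvg_rgram FU hy)].
have muy0 : 0 <= musq y by apply: addr_ge0; exact: fsq_ge0.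
have muy : musq y <= kappa - n.+1%:R^-1 - m.+1%:R^-1.
  rewrite -(sqr_sqrtr slope_ge0) -(sqr_sqrtr muy0) ler_sqr ?nnegrE ?sqrtr_ge0//.
  apply/ler_addgt0Pr => e e0; have [K hK] := descent_slope_limit e0.
  have se0 : 0 <= slope + e by apply: addr_ge0; [exact: sqrtr_ge0 | exact: ltW].
  rewrite -[leRHS]ger0_norm// -sqrtr_sqr ler_sqrt ?sqr_ge0//.
  have hcst : (slope + e) ^+ 2 @[_ --> F] --> (slope + e) ^+ 2 by exact: cvg_cst.
  apply: (ler_cvg_to hmu hcst).
  apply: filterS (Foo K) => k /hK hk.
  rewrite mux -[leLHS]sqr_sqrtr; last by rewrite addr_ge0 ?fsq_ge0.
  by rewrite ler_sqr ?nnegrE ?sqrtr_ge0// ltW.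
have fy : fsq (lgram y) + fsq (rgram y) <= kappa.
  by move: muy; rewrite (musq_unit ny) !lerD2r.
have [u [t [v [s hk]]]] := descent_qr.
have [k1 [k1' [t0 [s0 [z [uk1 uk1' BsE' [[ut0 us0 tt0 ts0] [zE zl zr]]]]]]]] := block_diag_scaling.
have ud0 := diag_part_unit_upper rb tt0 ut0; have ud0' := diag_part_unit_lower cb ts0 us0.
have uu k : u k \is unitarymx by case: (hk k).
have uv k : v k \is unitarymx by case: (hk k).
have [u0 [hu uu0]] := ultra_unitary FU uu.
have [v0 [hv uv0]] := ultra_unitary FU uv.
have uu0a : u0 ^t* \is unitarymx by rewrite unitary_adj.
have uv0a : v0 ^t* \is unitarymx by rewrite unitary_adj.
(* The normalized iterate with its unitary factors removed; it is block upper triangular, and so is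
   its limit [y']. *)
have [w wE] : exists w : nat -> tuple, w = fun k => tscale (c k) (act (t k) (s k) B) by eexists.
have [y' y'E] : exists y', y' = act (u0 ^t*) (v0 ^t*) y by eexists.
have wx k : w k = act ((u k) ^t*) ((v k) ^t*) (x k).
  have [_ _ itE _] := hk k.
  by rewrite wE xE /= itE act_tscale (act_unitaryK _ (uu k) (uv k)).
have hw : tcvg F w y'.
  rewrite y'E; have -> : w = fun k => act ((u k) ^t*) ((v k) ^t*) (x k) by apply/funext.
  exact: (tcvg_act FU (mxcvg_adj FF hu) (mxcvg_adj FF hv) hy).
have wup k : block_upper rb cb (w k).
  have [_ _ _ [[_ _ tt ts] _]] := hk k.
  by move=> l i j ij; rewrite wE mxE (act_block_upper rb_mono cb_mono tt ts uB)// mulr0.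
have uy' : block_upper rb cb y'.
  move=> l i j ij; have h1 := hw l i j.
  have e1 : (fun k => w k l i j) = (fun=> 0) by apply/funext => k; exact: wup.
  rewrite e1 in h1.
  exact: (cst_cvg_eq FU h1).
have ny' : nsq y' = 1 by rewrite y'E (nsq_act_unitary _ uu0a uv0a).
have fy' : fsq (lgram y') + fsq (rgram y') <= kappa.
  by rewrite y'E (lgram_act_unitary _ _ uv0a) (rgram_act_unitary _ _ uu0a) (fsq_conj _ uu0a) (fsq_conj _ uv0a).
have [yl yr yd] := balanced_of_min sumPQ2 PQ_ge PQ_cut uy' ny' fy'.
(* With the normalizing scalar absorbed in [T k], this acts on [z] to give the block diagonal part
   of [w k], which tends to that of [y'], that is to [y'] itself. *)
pose T k := (c k)%:C *: (diag_part rb (t k) *m invmx (diag_part rb t0)).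
pose S k := diag_part cb (s k) *m invmx (diag_part cb s0).
have uT k : T k \in unitmx.
  have [_ _ _ [[ut _ tt _] _]] := hk k.
  rewrite unitmxZ; last by rewrite unitfE eq_complex /= (gt_eqF (c0 k)).
  by rewrite unitmx_mul unitmx_inv (diag_part_unit_upper rb tt ut) ud0.
have uS k : S k \in unitmx.
  have [_ _ _ [[_ us _ ts] _]] := hk k.
  by rewrite unitmx_mul unitmx_inv (diag_part_unit_lower cb ts us) ud0'.
have cT k : T k *m dg P = dg P *m T k.
  by rewrite /T -scalemxAl -scalemxAr (relative_comm (t k) P_rb ud0).
have cS k : S k *m dg Q = dg Q *m S k by exact: (relative_comm (s k) Q_cb ud0').
have TSz k : act (T k) (S k) z = block_diag rb cb (w k).
  have [_ _ _ [[_ _ tt ts] _]] := hk k.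
  have -> : block_diag rb cb (w k) = tscale (c k) (block_diag rb cb (act (t k) (s k) B)).
    apply/funext => l; apply/matrixP => i j; rewrite wE !mxE.
    by case: eqP; rewrite ?mulr0.
  rewrite (block_diag_act rb_mono cb_mono tt ts uB) /T -tscale_act; congr tscale.
  by rewrite /S -act_act; congr act; rewrite zE act_act !mulVmx// act1.
have hTS : tcvg F (fun k => act (T k) (S k) z) y'.
  have -> : (fun k => act (T k) (S k) z) = (fun k => block_diag rb cb (w k)) by apply/funext.
  rewrite -yd => l i j; rewrite mxE; under eq_fun do rewrite mxE.
  by case: eqP => _; [exact: hw | exact: cvg_cst].
have [U [V [uU uV y'z]]] := limit_of_critical_unitary FU sumP zl zr yl yr uT uS cT cS hTS.
have uk1a : k1 ^t* \is unitarymx by rewrite unitary_adj.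
have uk1a' : k1' ^t* \is unitarymx by rewrite unitary_adj.
exists (u0 *m U *m k1 ^t*), (v0 *m V *m k1' ^t*); split.
- exact: (mul_unitarymx (mul_unitarymx uu0 uU) uk1a).
- exact: (mul_unitarymx (mul_unitarymx uv0 uV) uk1a').
have yE : y = act u0 v0 y' by rewrite y'E (act_unitaryVK _ uu0 uv0).
by rewrite -act_act BsE' (act_unitaryK _ uk1 uk1') -act_act -y'z.
Qed.

End Assembly.

(** * Cluster points in projective space *)

Section ProjectiveCluster.
Variables (R : realType) (n m N : nat).
Local Notation C := R[i].
Local Notation tuple := ('I_N.+1 -> 'M[C]_(n.+1, m.+1)).
Local Notation NT := (@nonzero_tuple R n.+1 m.+1 N.+1).
Local Notation PR := (projective R n.+1 m.+1 N.+1).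
Implicit Types (x y b : tuple).

Lemma nonzero_mem x : 0 < nsq x -> (x : {ptws 'I_N.+1 -> 'M[C]_(n.+1, m.+1)}) \in NT.
Proof. by move=> /nsq_gt0_ex[l hl]; rewrite inE; exists l. Qed.

Lemma val_insubd_tuple x : 0 < nsq x -> set_val (insubd (ones_tuple R n m N) x) = x.
Proof. by move=> /nonzero_mem h; rewrite set_valE /= insubdK. Qed.

Lemma nsq_set_val (a : NT) : 0 < nsq (set_val a : tuple).
Proof.
case: a => x hx; have := hx; rewrite inE => -[l hl].
by rewrite set_valE /=; exact: (nsq_gt0 hl).
Qed.

Lemma pclass_eq x y c : 0 < nsq x -> c != 0 -> (forall l, y l = c *: x l) ->
  pclass y = pclass x.
Proof.
move=> x0 c0 e.
have y0 : 0 < nsq y.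
  have [l hl] := nsq_gt0_ex x0; apply: (@nsq_gt0 _ _ _ _ _ l).
  by rewrite e scaler_eq0 negb_or c0.
apply/esym/eqquotP; rewrite /proportional /=; apply/asboolP; exists c => //.
by move=> l; rewrite !val_insubd_tuple.
Qed.

(* The 2x2 minors of the pair [(x, b)], normalized so as to descend to the quotient. *)
Definition minor b (p q : 'I_N.+1 * 'I_n.+1 * 'I_m.+1) x : R :=
  sqmod (x p.1.1 p.1.2 p.2 * b q.1.1 q.1.2 q.2 - x q.1.1 q.1.2 q.2 * b p.1.1 p.1.2 p.2) / nsq x.

Lemma minor_scale b p q x y c : c != 0 -> (forall l, y l = c *: x l) ->
  minor b p q y = minor b p q x.
Proof.
move=> c0 e; rewrite /minor !e !mxE -!mulrA -mulrBr sqmodM.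
have -> : nsq y = sqmod c * nsq x.
  rewrite !nsq_fsq mulr_sumr; apply: eq_bigr => l _; rewrite e /fsq mulr_sumr.
  apply: eq_bigr => i _; rewrite mulr_sumr; apply: eq_bigr => j _.
  by rewrite mxE sqmodM.
by rewrite invfM mulrACA mulfV ?mul1r// sqmod_eq0.
Qed.

Lemma entry_continuous l i j : continuous (fun a : NT => (set_val a : tuple) l i j).
Proof.
move=> a.
apply: (@continuous_comp _ _ _ (fun a : NT => (set_val a : {ptws 'I_N.+1 -> 'M[C]_(n.+1, m.+1)}) l)
  (fun M : 'M[C]_(n.+1, m.+1) => M i j)); last exact: coord_continuous.
apply: (@continuous_comp _ _ _ (set_val : NT -> {ptws 'I_N.+1 -> 'M[C]_(n.+1, m.+1)})
  (fun f : {ptws 'I_N.+1 -> 'M[C]_(n.+1, m.+1)} => f l)).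
  exact: initial_continuous.
exact: (@proj_continuous _ (fun _ : 'I_N.+1 => 'M[C]_(n.+1, m.+1)) l).
Qed.

Lemma minor_continuous b p q : continuous (fun a : NT => minor b p q (set_val a)).
Proof.
move=> a; rewrite /continuous_at /minor.
apply: (@cvgM _ _ (nbhs a)).
  apply: cvg_sqmod; apply: cvgB; apply: cvgMl; exact: entry_continuous.
apply: cvgV; first by rewrite gt_eqF// nsq_set_val.
apply: cvg_bigsum => i; apply: cvg_bigsum => j; apply: cvg_bigsum => l.
by apply: cvg_sqmod; exact: entry_continuous.
Qed.

(** Constant on classes, hence a function on projective space. As [b] varies, these functions
    separate points, which is how limits in the quotient are identified. *)
Lemma minor_quotient_continuous b p q :
  continuous ((fun a : NT => minor b p q (set_val a)) \o (repr : PR -> NT) : PR -> R).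
Proof.
apply: repr_comp_continuous; first exact: minor_continuous.
move=> a a' /eqP/eqquotP; rewrite /proportional /= => /asboolP[c c0 e].
by apply/eqP/esym; exact: minor_scale c0 e.
Qed.

Lemma minor_repr b p q x : 0 < nsq x ->
  minor b p q (set_val (repr (pclass x))) = minor b p q x.
Proof.
move=> x0; set a := insubd (ones_tuple R n m N) x.
have /eqquotP := reprK (pclass x).
rewrite /proportional /= => /asboolP[c c0 e].
have xa : set_val a = x by exact: val_insubd_tuple.
by rewrite -(minor_scale b p q c0 e) xa.
Qed.

(** The tails and the preimages of neighbourhoods of [p] generate a proper filter, and any finer
    ultrafilter will do. *)
Lemma cluster_ultrafilter (X : nat -> PR) p : cluster (X @ \oo) p ->
  exists F : set_system nat, [/\ UltraFilter F, (forall K : nat, F (fun k => (K <= k)%N)) &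
    X k @[k --> F] --> p].
Proof.
move=> hp.
pose G : set_system nat := fun A => exists U V,
  [/\ nbhs p U, (\oo : set_system nat) V & X @^-1` U `&` V `<=` A].
have GP : ProperFilter G.
  apply: Build_ProperFilter_ex.
    move=> A [U [V [hU hV hA]]].
    have [_ [[k Vk <-] Uk]] : (X @` V) `&` U !=set0.
      apply: hp => //; apply: filterS hV => k Vk; by exists k.
    by exists k; apply: hA.
  split.
  - by exists setT, setT; split=> //; exact: filterT.
  - move=> A A' [U [V [hU hV hA]]] [U' [V' [hU' hV' hA']]].
    exists (U `&` U'), (V `&` V'); split; [exact: filterI|exact: filterI|].
    by move=> k [[Uk Uk'] [Vk Vk']]; split; [apply: hA | apply: hA'].
  - move=> A A' AA' [U [V [hU hV hA]]]; exists U, V; split=> // k hk.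
    exact/AA'/hA.
have [F [FU GF]] := ultraFilterLemma GP.
exists F; split=> // [K|U hU].
  apply: GF; exists setT, (fun k => (K <= k)%N); split; first exact: filterT.
    exact: nbhs_infty_ge.
  by move=> k [].
by apply: GF; exists U, setT; split=> //; exact: filterT.
Qed.

Lemma ultra_normalized (F : set_system nat) (FU : UltraFilter F) (x : nat -> tuple) :
  (forall k, 0 < nsq (x k)) -> exists y, 0 < nsq y /\
  tcvg F (fun k => tscale (Num.sqrt (nsq (x k)))^-1 (x k)) y.
Proof.
move=> x0; have FP : ProperFilter F by exact: ultra_proper.
have [z zE] : exists z : nat -> tuple, z = fun k => tscale (Num.sqrt (nsq (x k)))^-1 (x k) by eexists.
have nz k : nsq (z k) = 1.
  rewrite zE nsq_tscale exprVn sqr_sqrtr; last exact: ltW (x0 k).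
  by rewrite mulVf// (lt0r_neq0 (x0 k)).
have bnd k l i j : sqmod (z k l i j) <= 1.
  rewrite -(nz k) nsq_fsq.
  apply: (@le_trans _ _ (fsq (z k l))); last first.
    by rewrite (bigD1 l)//= lerDl; apply: sumr_ge0 => ? _; exact: fsq_ge0.
  rewrite /fsq (bigD1 i)//= (bigD1 j)//= -addrA lerDl.
  by rewrite addr_ge0//; apply: sumr_ge0 => a _; [|apply: sumr_ge0 => ? _]; exact: sqmod_ge0.
have cv l i j : exists c : C, z k l i j @[k --> F] --> c.
  have sq1 (u v : R) : u ^+ 2 + v ^+ 2 <= 1 -> `|u| <= 1.
    move=> h; rewrite -(@expr_le1 _ 2)// real_normK ?num_real//.
    by apply: le_trans h; rewrite lerDl sqr_ge0.
  have [a ha] : exists a : R, complex.Re (z k l i j) @[k --> F] --> a.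
    by apply: (@ultra_bounded _ _ _ _ 1) => k; exact: sq1 (bnd k l i j).
  have [c hc] : exists c : R, complex.Im (z k l i j) @[k --> F] --> c.
    apply: (@ultra_bounded _ _ _ _ 1) => k.
    by apply: (sq1 _ (complex.Re (z k l i j))); rewrite addrC; exact: bnd.
  by exists (Complex a c); apply: cvg_complex.
have [y hy] := choice (fun q : 'I_N.+1 * 'I_n.+1 * 'I_m.+1 => cv q.1.1 q.1.2 q.2).
have hz : tcvg F z (fun l => \matrix_(i, j) y (l, i, j)).
  by move=> l i j; rewrite mxE; exact: (hy (l, i, j)).
exists (fun l => \matrix_(i, j) y (l, i, j)); split; last by rewrite -zE.
have := cvg_nsq FU hz; rewrite (_ : (fun k => nsq (z k)) = fun=> 1); last exact/funext.
by move=> /(cst_cvg_eq FU) ->; exact: ltr01.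
Qed.

(** For a representative [b] of [p], the minors against [b] tend to 0 along the ultrafilter, since
    they vanish at [b]; hence they vanish at the limit [y] of the normalized tuples, which is thus
    proportional to [b]. *)
Lemma cluster_pclass (x : nat -> tuple) p : (forall k, 0 < nsq (x k)) ->
  cluster ((fun k => pclass (x k)) @ \oo) p ->
  exists (F : set_system nat) (FU : UltraFilter F) y,
  [/\ (forall K : nat, F (fun k => (K <= k)%N)),
      0 < nsq y, tcvg F (fun k => tscale (Num.sqrt (nsq (x k)))^-1 (x k)) y & p = pclass y].
Proof.
move=> x0 /cluster_ultrafilter[F [FU Foo hp]].
have FP : ProperFilter F by exact: ultra_proper.
have [y [y0 hy]] := ultra_normalized FU x0.
exists F, FU, y; split=> //.
pose b : tuple := set_val (repr p).
have b0 : 0 < nsq b by exact: nsq_set_val.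
have pb : p = pclass b.
  rewrite -[LHS]reprK; apply/eqquotP; rewrite /proportional /=; apply/asboolP.
  by exists 1; [exact: oner_neq0 | move=> l; rewrite val_insubd_tuple// scale1r].
have sc k : (Num.sqrt (nsq (x k)))^-1 != 0.
  by rewrite invr_eq0 sqrtr_eq0 -ltNge.
have minor0 q r : minor b q r y = 0.
  have h1 : minor b q r (x k) @[k --> F] --> minor b q r b.
    have h2 := @continuous_cvg _ _ _ _ FP _ _ _ (@minor_quotient_continuous b q r p) hp.
    have e2 : (fun k => minor b q r (x k)) =
        (fun k => minor b q r (set_val (repr (pclass (x k))))).
      by apply/funext => k; rewrite minor_repr.
    by rewrite e2.
  have -> : minor b q r y = minor b q r b.
    have h3 : minor b q r (tscale (Num.sqrt (nsq (x k)))^-1 (x k)) @[k --> F] --> minor b q r y.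
      apply: cvgM.
        by apply: cvg_sqmod; apply: cvgB; apply: cvgMl; exact: hy.
      by apply: cvgV; [rewrite gt_eqF | exact: (cvg_nsq FU hy)].
    have e1 : (fun k => minor b q r (tscale (Num.sqrt (nsq (x k)))^-1 (x k))) =
        (fun k => minor b q r (x k)).
      apply/funext => k; apply: (@minor_scale _ _ _ _ _ ((Num.sqrt (nsq (x k)))^-1)%:C) => //.
      by rewrite eq_complex /= (negbTE (sc k)).
    rewrite e1 in h3; exact: (norm_cvg_unique h3 h1).
  by rewrite /minor mulrC (mulrC (b _ _ _)) subrr sqmod0 mulr0.
have [l hl] := nsq_gt0_ex b0.
have [i [j hij]] : exists i j, b l i j != 0.
  apply: contrapT => /forallNP h; move/negP: hl; apply; apply/eqP/matrixP => i j.
  have /forallNP/(_ j)/negP := h i; rewrite negbK mxE; exact/eqP.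
have yb l' i' j' : y l' i' j' = y l i j / b l i j * b l' i' j'.
  have := minor0 (l', i', j') (l, i, j); rewrite /minor /= => /eqP.
  rewrite mulf_eq0 invr_eq0 (gt_eqF y0) orbF sqmod_eq0 subr_eq0 => /eqP h.
  by rewrite mulrAC -h mulfK.
rewrite pb; apply/esym; apply: (@pclass_eq _ _ (y l i j / b l i j)) => //.
  apply/negP => /eqP h; move: y0; rewrite nsq_fsq big1 ?ltxx// => k _.
  by rewrite /fsq big1// => i' _; rewrite big1// => j' _; rewrite yb h mul0r sqmod0.
by move=> k; apply/matrixP => i' j'; rewrite mxE yb.
Qed.

End ProjectiveCluster.

(** * The DM-flag *)

Section StepFunction.
Variables (K : realFieldType) (t : nat) (e : nat -> nat).
Hypothesis e0 : e 0 = 0%N.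
Hypothesis e_lt : forall a, (a < t)%N -> (e a < e a.+1)%N.
Implicit Types (w : nat -> K) (a i x : nat).

(** A sum of indicators of consecutive intervals, to match the form of [pstar] and [qstar]. *)
Definition step_fun w i : K := \sum_(1 <= a < t.+1) w a * (e a.-1 <= i < e a)%N%:R.

Lemma knot_le a a' : (a <= a')%N -> (a' <= t)%N -> (e a <= e a')%N.
Proof.
elim: a' => [|a' IH]; first by rewrite leqn0 => /eqP ->.
rewrite leq_eqVlt => /predU1P[-> //|]; rewrite ltnS => h ht.
by apply: leq_trans (IH h (ltnW ht)) (ltnW (e_lt ht)).
Qed.

Lemma knot_part i : (i < e t)%N -> exists a, [/\ (0 < a)%N, (a <= t)%N & (e a.-1 <= i < e a)%N].
Proof.
move=> hi; have ex : exists a, (i < e a)%N by exists t.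
case: (ex_minnP ex) => a ha amin; exists a; split=> //.
- by case: a ha {amin} => //; rewrite e0.
- exact: amin.
- rewrite ha andbT; case: a ha amin => [|a] ha amin /=; first by rewrite e0 in ha.
  by rewrite leqNgt; apply/negP => /amin; rewrite ltnn.
Qed.

Lemma knot_part_le a a' i i' : (0 < a <= t)%N -> (0 < a' <= t)%N ->
  (e a.-1 <= i < e a)%N -> (e a'.-1 <= i' < e a')%N -> (i <= i')%N -> (a <= a')%N.
Proof.
move=> /andP[a0 at_] /andP[a'0 a't] /andP[h1 h2] /andP[h3 h4] ii'.
rewrite leqNgt; apply/negP => aa'.
have h5 : (e a' <= e a.-1)%N.
  apply: knot_le; first by rewrite -ltnS prednK.
  exact: leq_trans (leq_pred _) at_.
by have := leq_trans (leq_trans h4 (leq_trans h5 h1)) ii'; rewrite ltnn.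
Qed.

Lemma step_fun_part w a i : (0 < a <= t)%N -> (e a.-1 <= i < e a)%N -> step_fun w i = w a.
Proof.
move=> ha hi; rewrite /step_fun.
rewrite (bigD1_seq a) ?iota_uniq ?mem_index_iota//= hi mulr1 big1_seq ?addr0//.
move=> a' /andP[a'a]; rewrite mem_index_iota ltnS => ha'.
case: (boolP (e a'.-1 <= i < e a')%N) => hi'; last by rewrite mulr0.
suff e1 : a' = a by rewrite e1 eqxx in a'a.
apply/eqP; rewrite eqn_leq.
by rewrite (knot_part_le ha' ha hi' hi)// (knot_part_le ha ha' hi hi').
Qed.

Lemma step_fun_sum_part w a x : (0 < a <= t)%N -> (e a.-1 <= x <= e a)%N ->
  \sum_(e a.-1 <= i < x) step_fun w i = w a * (x - e a.-1)%N%:R.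
Proof.
move=> ha /andP[h1 h2].
rewrite (eq_big_nat _ _ (F2 := fun=> w a)); last first.
  by move=> i /andP[i1 i2]; apply: step_fun_part; rewrite // i1 (leq_trans i2).
by rewrite sumr_const_nat mulr_natr.
Qed.

Lemma step_fun_sum_knot w a : (a <= t)%N ->
  \sum_(0 <= i < e a) step_fun w i = \sum_(1 <= a' < a.+1) w a' * (e a' - e a'.-1)%N%:R.
Proof.
elim: a => [|a IH] ha; first by rewrite e0 !big_geq.
rewrite (big_cat_nat (n := e a)) ?leq0n ?(ltnW (e_lt ha))//= IH ?(ltnW ha)//.
rewrite [RHS]big_nat_recr//=; congr +%R.
by rewrite -(@step_fun_sum_part _ a.+1) //= leqnn (ltnW (e_lt ha)).
Qed.

Lemma step_fun_sum w a x : (0 < a <= t)%N -> (e a.-1 <= x <= e a)%N ->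
  \sum_(0 <= i < x) step_fun w i =
  \sum_(1 <= a' < a) w a' * (e a' - e a'.-1)%N%:R + w a * (x - e a.-1)%N%:R.
Proof.
move=> ha hx; have /andP[a0 at_] := ha; have /andP[h1 _] := hx.
rewrite (big_cat_nat (n := e a.-1))//= step_fun_sum_knot; last exact: leq_trans (leq_pred _) at_.
by rewrite prednK// step_fun_sum_part.
Qed.

Lemma step_fun_sumsq w :
  \sum_(0 <= i < e t) step_fun w i ^+ 2 = \sum_(1 <= a < t.+1) w a ^+ 2 * (e a - e a.-1)%N%:R.
Proof.
rewrite -step_fun_sum_knot//; apply: eq_big_nat => i /andP[_ hi].
have [a [a0 at_ hi']] := knot_part hi.
by rewrite !(@step_fun_part _ a) ?a0.
Qed.

Lemma step_fun_mono w (r : rel K) : reflexive r -> transitive r ->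
  (forall a, (0 < a < t)%N -> r (w a) (w a.+1)) ->
  forall i i', (i <= i')%N -> (i' < e t)%N -> r (step_fun w i) (step_fun w i').
Proof.
move=> rr rt hw i i' ii' hi'.
have [a [a0 at_ ha]] := knot_part (leq_ltn_trans ii' hi').
have [a' [a'0 a't ha']] := knot_part hi'.
rewrite (@step_fun_part _ a) ?a0// (@step_fun_part _ a') ?a'0//.
have aa' : (a <= a')%N by apply: (knot_part_le _ _ ha ha' ii'); rewrite ?a0 ?a'0.
elim: a' aa' {ha' a'0} a't => [|a' IH]; first by rewrite leqn0 => /eqP a0'; rewrite a0' in a0.
rewrite leq_eqVlt => /predU1P[-> //|]; rewrite ltnS => h ht.
apply: rt (IH h (ltnW ht)) (hw _ _).
by rewrite (leq_trans a0 h).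
Qed.

End StepFunction.

Lemma count_leq_sorted (s : seq nat) i k : sorted leq s -> (k < size s)%N ->
  (count (leq^~ i) s <= k)%N = (i < nth 0 s k)%N.
Proof.
elim: s k => [|x s IH] k //= srt hk.
have := order_path_min leq_trans srt => /allP xs.
case: (leqP x i) => xi.
  case: k hk => [|k] hk /=; first by rewrite ltnNge xi.
  by rewrite add1n ltnS IH// (path_sorted srt).
have -> : count (leq^~ i) s = 0%N.
  apply/eqP; rewrite -leqn0 leqNgt -has_count; apply/hasP => -[y /xs xy /=].
  by rewrite leqNgt (leq_trans xi xy).
rewrite leq0n; case: k hk => [|k] //=; rewrite ltnS => hk.
by apply/esym; apply: leq_trans xi (xs _ _); exact: mem_nth.
Qed.

(** * Levels defined by a chain of cuts *)

Section Cuts.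
Variable (cuts : seq (nat * nat)).
Implicit Types (p : nat * nat) (i j : nat).

Definition le2 : rel (nat * nat) := fun p q => (p.1 <= q.1)%N && (p.2 <= q.2)%N.
Hypothesis chain : {in cuts &, total le2}.

(** The number of cuts passed. Only comparisons of levels matter, so a cut may be listed several
    times. *)
Definition row_level i := count (fun p => (p.1 <= i)%N) cuts.
Definition col_level j := count (fun p => (p.2 <= j)%N) cuts.

Lemma row_level_le i i' : (i <= i')%N -> (row_level i <= row_level i')%N.
Proof. by move=> ii'; apply: sub_count => p /= h; exact: leq_trans h ii'. Qed.

Lemma col_level_le j j' : (j <= j')%N -> (col_level j <= col_level j')%N.
Proof. by move=> jj'; apply: sub_count => p /= h; exact: leq_trans h jj'. Qed.

Lemma count_lt_witness (a b : pred (nat * nat)) : (count a cuts < count b cuts)%N ->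
  exists p, [/\ p \in cuts, ~~ a p & b p].
Proof.
move=> h; have : ~~ all (fun p => b p ==> a p) cuts.
  apply/negP => /allP hab; move: h; rewrite ltnNge => /negP; apply.
  have sub (s : seq (nat * nat)) : {subset s <= cuts} -> (count b s <= count a s)%N.
    elim: s => //= x s IH hs.
    apply: leq_add; last by apply: IH => y ys; apply: hs; rewrite inE ys orbT.
    by have := hab x (hs x (mem_head _ _)); case: (b x); case: (a x).
  exact: sub.
by case/allPn => p pc; rewrite negb_imply => /andP[bp ap]; exists p.
Qed.

Lemma level_lt i j : (col_level j < row_level i)%N ->
  exists p, [/\ p \in cuts, (p.1 <= i)%N & (j < p.2)%N].
Proof.
by move=> /count_lt_witness[p [pc h1 h2]]; exists p; split=> //; rewrite ltnNge.
Qed.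

Lemma count_lt_strict (a b : pred (nat * nat)) p : p \in cuts -> ~~ a p -> b p ->
  {in cuts, forall q, a q -> b q} -> (count a cuts < count b cuts)%N.
Proof.
move=> pc nap bp hab.
have e : count a cuts = count (predI a b) cuts.
  by apply: eq_in_count => q qc /=; case: (boolP (a q)) => // /(hab q qc) ->.
rewrite e; have -> : count b cuts = (count (predI a b) cuts + count (predD b a) cuts)%N.
  rewrite -count_predUI (@eq_count _ (predI (predI a b) (predD b a)) pred0); last first.
    by move=> q /=; case: (a q); rewrite ?andbF.
  rewrite count_pred0 addn0; apply: eq_count => q /=.
  by case: (a q); case: (b q).
rewrite -{1}[count (predI a b) cuts]addn0 ltn_add2l -has_count.
by apply/hasP; exists p => //=; rewrite nap bp.
Qed.

Lemma level_lt_row p i j : p \in cuts -> (p.1 <= i)%N -> (j < p.2)%N ->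
  (col_level j < row_level i)%N.
Proof.
move=> pc pi jp; apply: (count_lt_strict pc) => //=; first by rewrite -ltnNge.
move=> q qc qj; case/orP: (chain qc pc) => /andP[h1 h2]; first exact: leq_trans h1 pi.
by have := leq_trans jp (leq_trans h2 qj); rewrite ltnn.
Qed.

Lemma level_lt_col p i j : p \in cuts -> (p.2 <= j)%N -> (i < p.1)%N ->
  (row_level i < col_level j)%N.
Proof.
move=> pc pj ip; apply: (count_lt_strict pc) => //=; first by rewrite -ltnNge.
move=> q qc qi; case/orP: (chain qc pc) => /andP[h1 h2]; first exact: leq_trans h2 pj.
by have := leq_trans ip (leq_trans h1 qi); rewrite ltnn.
Qed.

Lemma level_eqP i j :
  (row_level i = col_level j) <-> {in cuts, forall p, (p.1 <= i)%N = (p.2 <= j)%N}.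
Proof.
split=> [e p pc|h]; last exact: eq_in_count.
case: (leqP p.1 i) => h1; case: (leqP p.2 j) => h2 //.
  by have := level_lt_row pc h1 h2; rewrite e ltnn.
by have := level_lt_col pc h2 h1; rewrite e ltnn.
Qed.

Lemma row_level_eq i i' p : p \in cuts -> row_level i = row_level i' ->
  (p.1 <= i)%N -> (p.1 <= i')%N.
Proof.
move=> pc e h; rewrite leqNgt; apply/negP => h'.
suff : (row_level i' < row_level i)%N by rewrite e ltnn.
apply: (count_lt_strict pc) => //=; first by rewrite -ltnNge.
by move=> q _ hq; exact: leq_trans hq (leq_trans (ltnW h') h).
Qed.

Lemma col_level_eq j j' p : p \in cuts -> col_level j = col_level j' ->
  (p.2 <= j)%N -> (p.2 <= j')%N.
Proof.
move=> pc e h; rewrite leqNgt; apply/negP => h'.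
suff : (col_level j' < col_level j)%N by rewrite e ltnn.
apply: (count_lt_strict pc) => //=; first by rewrite -ltnNge.
by move=> q _ hq; exact: leq_trans hq (leq_trans (ltnW h') h).
Qed.

(** A chain can be sorted in both coordinates at once; the cut at position [k], counted from 0,
    bounds exactly the rows and the columns of level at most [k]. *)
Lemma level_threshold k : (k < size cuts)%N -> exists p, [/\ p \in cuts,
  forall i, (row_level i <= k)%N = (i < p.1)%N & forall j, (col_level j <= k)%N = (j < p.2)%N].
Proof.
move=> hk; pose s := sort le2 cuts.
have srt : sorted le2 s by apply: (sort_sorted_in chain); apply/allP.
have ps : perm_eq s cuts by rewrite perm_sort.
have hs : (k < size s)%N by rewrite size_sort.
exists (nth (0, 0)%N s k); split=> [|i|j].
- by rewrite -(perm_mem ps) mem_nth.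
- rewrite /row_level -(permP ps) -(nth_map _ 0%N (fun p => p.1))//.
  rewrite -count_leq_sorted ?size_map//; first by rewrite count_map.
  by rewrite sorted_map; apply: sub_sorted srt => p q /andP[].
- rewrite /col_level -(permP ps) -(nth_map _ 0%N (fun p => p.2))//.
  rewrite -count_leq_sorted ?size_map//; first by rewrite count_map.
  by rewrite sorted_map; apply: sub_sorted srt => p q /andP[].
Qed.

End Cuts.

(** * The profile (P, Q) of a convex staircase *)

Section Staircase.
Variables (K : realFieldType) (n m t : nat).
Variables (len : nat -> nat) (r c : nat -> nat -> nat) (re ce : nat -> nat).
Hypotheses (t0 : (0 < t)%N) (re0 : re 0 = 0%N) (ce0 : ce 0 = 0%N) (ret : re t = n) (cet : ce t = m).
Hypotheses (re_lt : forall a, (a < t)%N -> (re a < re a.+1)%N).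
Hypotheses (ce_lt : forall a, (a < t)%N -> (ce a < ce a.+1)%N).
Hypotheses (r_first : forall a, (0 < a <= t)%N -> r a 0 = re a.-1).
Hypotheses (c_first : forall a, (0 < a <= t)%N -> c a 0 = ce a.-1).
Hypotheses (r_last : forall a, (0 < a <= t)%N -> r a (len a) = re a).
Hypotheses (c_last : forall a, (0 < a <= t)%N -> c a (len a) = ce a).
Hypotheses (r_mono : forall a b b', (0 < a <= t)%N -> (b <= b' <= len a)%N -> (r a b <= r a b')%N).
Hypotheses (c_mono : forall a b b', (0 < a <= t)%N -> (b <= b' <= len a)%N -> (c a b <= c a b')%N).
Hypothesis slope : forall a, (0 < a < t)%N ->
  ((ce a.+1 - ce a) * (re a - re a.-1) <= (ce a - ce a.-1) * (re a.+1 - re a))%N.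
Hypothesis aligned : forall a b, (0 < a <= t)%N -> (b <= len a)%N ->
  ((r a b - re a.-1) * (ce a - ce a.-1) = (c a b - ce a.-1) * (re a - re a.-1))%N.
Implicit Types (a b i j k : nat).

(** The last cut of part [a] and the first of part [a.+1] coincide and both are listed. *)
Definition cuts : seq (nat * nat) :=
  [seq (r a b, c a b) | a <- iota 1 t, b <- iota 0 (len a).+1].

Lemma mem_cuts a b : (0 < a <= t)%N -> (b <= len a)%N -> (r a b, c a b) \in cuts.
Proof.
move=> ha hb; apply/allpairsPdep; exists a, b.
by rewrite !mem_iota add1n ltnS add0n ltnS.
Qed.

Lemma cutsP p : p \in cuts -> exists a b,
  [/\ (0 < a <= t)%N, (b <= len a)%N & p = (r a b, c a b)].
Proof.
move=> /allpairsPdep[a [b [ha hb e]]]; exists a, b.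
by move: ha hb; rewrite !mem_iota add1n ltnS add0n ltnS.
Qed.

Lemma cut_le a b a' b' : (0 < a <= t)%N -> (b <= len a)%N -> (0 < a' <= t)%N -> (b' <= len a')%N ->
  (a < a')%N || ((a == a') && (b <= b')%N) -> le2 (r a b, c a b) (r a' b', c a' b').
Proof.
move=> ha hb ha' hb' /orP[aa'|/andP[/eqP e bb']]; last first.
  by rewrite -e in hb' *; rewrite /le2 /= r_mono ?c_mono ?bb'.
have ha2 : (a <= a'.-1)%N by rewrite -ltnS prednK// (leq_ltn_trans _ aa').
have /andP[_ a't] := ha'; have a't' := leq_trans (leq_pred a') a't.
rewrite /le2 /=; apply/andP; split.
  apply: (@leq_trans (re a)); first by rewrite -r_last// r_mono// hb leqnn.
  by apply: leq_trans (knot_le re_lt ha2 a't') _; rewrite -r_first// r_mono.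
apply: (@leq_trans (ce a)); first by rewrite -c_last// c_mono// hb leqnn.
by apply: leq_trans (knot_le ce_lt ha2 a't') _; rewrite -c_first// c_mono.
Qed.

Lemma cuts_chain : {in cuts &, total le2}.
Proof.
move=> p q /cutsP[a [b [ha hb ->]]] /cutsP[a' [b' [ha' hb' ->]]].
case: (ltngtP a a') => aa'.
- by rewrite cut_le ?aa'.
- by apply/orP; right; rewrite cut_le ?aa'.
- case: (leqP b b') => bb'; first by rewrite cut_le// aa' eqxx bb' orbT.
  by apply/orP; right; rewrite cut_le// aa' eqxx (ltnW bb') orbT.
Qed.

Local Notation rlev := (row_level cuts).
Local Notation clev := (col_level cuts).

(** Identifies the blocks of the flag with the common levels. Conversely to the easy direction, [a]
    is the part of row [i] and [b] the least index whose cut lies beyond [i]; equal levels mean that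
    [j] passes the same cuts. *)
Lemma same_levelP i j : (i < n)%N -> (j < m)%N -> rlev i = clev j <->
  exists a b, [/\ (0 < a <= t)%N, (0 < b <= len a)%N,
    (r a b.-1 <= i < r a b)%N & (c a b.-1 <= j < c a b)%N].
Proof.
move=> hi hj; split; last first.
  move=> [a [b [ha /andP[b0 hb] /andP[hi1 hi2] /andP[hj1 hj2]]]].
  apply/(level_eqP cuts_chain) => _ /cutsP[a' [b' [ha' hb' ->]]] /=.
  have hb1 : (b.-1 <= len a)%N := leq_trans (leq_pred b) hb.
  case: (boolP ((a' < a)%N || ((a' == a) && (b' <= b.-1)%N))) => h.
    have /andP[/= h1 h2] := cut_le ha' hb' ha hb1 h.
    by rewrite (leq_trans h1 hi1) (leq_trans h2 hj1).
  have h' : (a < a')%N || ((a == a') && (b <= b')%N).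
    by move: h; rewrite negb_or negb_and -leqNgt -ltnNge prednK//; case: (ltngtP a a').
  have /andP[/= h1 h2] := cut_le ha hb ha' hb' h'.
  by rewrite [LHS]leqNgt [RHS]leqNgt (leq_trans hi2 h1) (leq_trans hj2 h2).
move=> /(level_eqP cuts_chain) h.
have hi' : (i < re t)%N by rewrite ret.
have [a [a0 at_ /andP[hi1 hi2]]] := knot_part re0 hi'.
have ha : (0 < a <= t)%N by rewrite a0.
have ex : exists b, (b <= len a)%N && (i < r a b)%N.
  by exists (len a); rewrite leqnn r_last.
case: (ex_minnP ex) => b /andP[hb hib] bmin.
have b0 : (0 < b)%N.
  case: b hb hib {bmin} => // _; rewrite r_first// => h1.
  by have := leq_ltn_trans hi1 h1; rewrite ltnn.
have hb1 : (b.-1 <= len a)%N := leq_trans (leq_pred b) hb.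
have hib1 : (r a b.-1 <= i)%N.
  rewrite leqNgt; apply/negP => h1; have := bmin b.-1; rewrite hb1 h1 => /(_ isT).
  by rewrite -[X in (X <= _)%N]prednK// ltnn.
exists a, b; split; rewrite ?b0 ?hb ?hib ?hib1//.
have /= := h _ (mem_cuts ha hb); rewrite leqNgt hib /= => h1.
have /= := h _ (mem_cuts ha hb1); rewrite hib1 => <-.
by rewrite ltnNge -h1.
Qed.

Local Notation na a := ((re a - re a.-1)%N%:R : K).
Local Notation ma a := ((ce a - ce a.-1)%N%:R : K).

Definition profile_const : K := \sum_(1 <= a < t.+1) na a * ma a / (na a + ma a).
Definition row_weight a : K := profile_const^-1 * (ma a / (na a + ma a)).
Definition col_weight a : K := profile_const^-1 * (na a / (na a + ma a)).
Local Notation fP := (step_fun t re row_weight).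
Local Notation fQ := (step_fun t ce col_weight).

Lemma na_gt0 a : (0 < a <= t)%N -> 0 < na a.
Proof. by case: a => // a /= at_; rewrite ltr0n subn_gt0 re_lt. Qed.

Lemma ma_gt0 a : (0 < a <= t)%N -> 0 < ma a.
Proof. by case: a => // a /= at_; rewrite ltr0n subn_gt0 ce_lt. Qed.

Lemma profile_const_gt0 : 0 < profile_const.
Proof.
rewrite /profile_const big_nat_recr//=; apply: ltr_wpDl.
  rewrite big_nat; apply: sumr_ge0 => a /andP[a0 at_].
  by rewrite divr_ge0 ?mulr_ge0 ?addr_ge0.
have ht : (0 < t <= t)%N by rewrite t0 leqnn.
by rewrite divr_gt0 ?mulr_gt0 ?addr_gt0 ?na_gt0 ?ma_gt0.
Qed.

(** The source of [P_i + Q_j = kappa] on the diagonal blocks. *)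
Lemma weight_sum a : (0 < a <= t)%N -> row_weight a + col_weight a = profile_const^-1.
Proof.
move=> ha; have h1 := na_gt0 ha; have h2 := ma_gt0 ha.
rewrite /row_weight /col_weight -mulrDr -mulrDl [ma a + na a]addrC divff ?mulr1//.
by rewrite gt_eqF// addr_gt0.
Qed.

Lemma weight_balance a : row_weight a * na a = col_weight a * ma a.
Proof. by rewrite /row_weight /col_weight -!mulrA; congr *%R; ring. Qed.

Lemma row_profile_sum : \sum_(0 <= i < n) fP i = 1.
Proof.
rewrite -ret step_fun_sum_knot//.
have -> : \sum_(1 <= a < t.+1) row_weight a * na a = profile_const^-1 * profile_const.
  rewrite mulr_sumr; apply: eq_bigr => a _; rewrite /row_weight; ring.
by rewrite mulVf// gt_eqF// profile_const_gt0.
Qed.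

Lemma col_profile_sum : \sum_(0 <= j < m) fQ j = 1.
Proof.
rewrite -row_profile_sum -ret -cet !step_fun_sum_knot//.
by apply: eq_bigr => a _; rewrite weight_balance.
Qed.

(** By [weight_balance], part [a] contributes [row_weight a * na a] times the constant sum of its
    two weights, and the former add up to 1. *)
Lemma profile_sumsq : \sum_(0 <= i < n) fP i ^+ 2 + \sum_(0 <= j < m) fQ j ^+ 2 = profile_const^-1.
Proof.
rewrite -ret -cet !step_fun_sumsq// -big_split /=.
rewrite (eq_big_nat _ _ (F2 := fun a => profile_const^-1 * (row_weight a * na a))).
  rewrite -mulr_sumr; have := row_profile_sum.
  by rewrite -ret step_fun_sum_knot// => ->; rewrite mulr1.
move=> a ha; rewrite -(weight_sum ha) mulrDl !expr2 -mulrA -[col_weight a * _ * _]mulrA.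
by rewrite -weight_balance.
Qed.

(** After cross-multiplication and cancellation of [na a * na a.+1] this is the convexity hypothesis
    [slope]. *)
Lemma weight_step a : (0 < a < t)%N -> col_weight a <= col_weight a.+1.
Proof.
move=> /[dup] ha' /andP[a0 at_].
have ha : (0 < a <= t)%N by rewrite a0 ltnW.
have ha1 : (0 < a.+1 <= t)%N by [].
have h1 := na_gt0 ha; have h2 := ma_gt0 ha; have h3 := na_gt0 ha1; have h4 := ma_gt0 ha1.
rewrite /col_weight ler_pM2l ?invr_gt0 ?profile_const_gt0//.
rewrite ler_pdivrMr ?addr_gt0// mulrAC ler_pdivlMr ?addr_gt0//.
rewrite !mulrDr [na a * na a.+1]mulrC lerD2l /= -!natrM ler_nat.
by rewrite mulnC [X in (_ <= X)%N]mulnC; exact: slope.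
Qed.

Lemma col_profile_le j j' : (j <= j')%N -> (j' < m)%N -> fQ j <= fQ j'.
Proof.
rewrite -cet; apply: (@step_fun_mono _ _ _ ce0 ce_lt col_weight <=%R).
- exact: lexx.
- exact: le_trans.
- exact: weight_step.
Qed.

Lemma row_profile_ge i i' : (i <= i')%N -> (i' < n)%N -> fP i' <= fP i.
Proof.
rewrite -ret; apply: (@step_fun_mono _ _ _ re0 re_lt row_weight >=%R).
- exact: lexx.
- by move=> x y z h1 h2; exact: le_trans h2 h1.
- move=> a ha; have /andP[a0 at_] := ha.
  have e1 := @weight_sum a; have e2 := @weight_sum a.+1.
  rewrite a0 (ltnW at_) in e1; rewrite at_ in e2.
  move: (weight_step ha) (e1 isT) (e2 isT) => /=; lra.
Qed.

Lemma part_cut a : (0 < a <= t)%N -> (re a, ce a) \in cuts.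
Proof. by move=> ha; rewrite -r_last// -c_last// mem_cuts. Qed.

Lemma row_level_part i i' a : (0 < a <= t)%N -> (re a.-1 <= i < re a)%N ->
  rlev i = rlev i' -> (re a.-1 <= i' < re a)%N.
Proof.
move=> ha /andP[h1 h2] e; apply/andP; split.
  case: a ha h1 {h2} => [|[|a]]//= ha h1; first by rewrite re0.
  have ha' : (0 < a.+1 <= t)%N by rewrite (ltnW ha).
  exact: (row_level_eq (part_cut ha') e h1).
rewrite ltnNge; apply/negP => h.
have := row_level_eq (part_cut ha) (esym e) h.
by rewrite leqNgt h2.
Qed.

Lemma col_level_part j j' a : (0 < a <= t)%N -> (ce a.-1 <= j < ce a)%N ->
  clev j = clev j' -> (ce a.-1 <= j' < ce a)%N.
Proof.
move=> ha /andP[h1 h2] e; apply/andP; split.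
  case: a ha h1 {h2} => [|[|a]]//= ha h1; first by rewrite ce0.
  have ha' : (0 < a.+1 <= t)%N by rewrite (ltnW ha).
  exact: (col_level_eq (part_cut ha') e h1).
rewrite ltnNge; apply/negP => h.
have := col_level_eq (part_cut ha) (esym e) h.
by rewrite leqNgt h2.
Qed.

Lemma row_profile_level i i' : (i < n)%N -> rlev i = rlev i' -> fP i = fP i'.
Proof.
rewrite -ret => /(knot_part re0)[a [a0 at_ hi]] e.
have ha : (0 < a <= t)%N by rewrite a0.
by rewrite !(@step_fun_part _ _ _ re_lt _ a)//; exact: row_level_part e.
Qed.

Lemma col_profile_level j j' : (j < m)%N -> clev j = clev j' -> fQ j = fQ j'.
Proof.
rewrite -cet => /(knot_part ce0)[a [a0 at_ hj]] e.
have ha : (0 < a <= t)%N by rewrite a0.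
by rewrite !(@step_fun_part _ _ _ ce_lt _ a)//; exact: col_level_part e.
Qed.

(** The row lies in a part [a] not after the part [b] of the column, since otherwise the cut ending
    part [b] would separate them. Column weights increase with the part, and for [b = a] the sum is
    exact. *)
Lemma profile_ge i j : (i < n)%N -> (j < m)%N -> (rlev i <= clev j)%N ->
  profile_const^-1 <= fP i + fQ j.
Proof.
rewrite -ret -cet => hi hj hl.
have [a [a0 at_ hai]] := knot_part re0 hi; have [b [b0 bt hbj]] := knot_part ce0 hj.
have ha : (0 < a <= t)%N by rewrite a0.
have hb : (0 < b <= t)%N by rewrite b0.
have ab : (a <= b)%N.
  rewrite leqNgt; apply/negP => ba.
  have /andP[_ h2] := hbj; have /andP[h1 _] := hai.
  have h3 : (re b <= i)%N.
    have h3 : (b <= a.-1)%N by rewrite -ltnS prednK.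
    by apply: leq_trans (knot_le re_lt h3 _) h1; exact: leq_trans (leq_pred _) at_.
  by have := level_lt_row cuts_chain (part_cut hb) h3 h2; rewrite ltnNge hl.
rewrite -(weight_sum ha) (step_fun_part re_lt _ ha hai) lerD2l.
have h1 : (ce a.-1 < ce a)%N by case: (a) ha => // a' /=; exact: ce_lt.
(* The last column of part [a] represents the part when monotonicity is applied. *)
have h4 : (ce a.-1 <= (ce a).-1 < ce a)%N.
  by case: (ce a) h1 => // x; rewrite ltnS /= => ->; exact: ltnSn.
rewrite leq_eqVlt in ab; case/orP: ab => [/eqP e|ab].
  by rewrite (step_fun_part ce_lt _ hb hbj) e lexx.
rewrite -(step_fun_part ce_lt col_weight ha h4).
apply: col_profile_le; last by rewrite -cet.
have /andP[h2 _] := hbj; apply: leq_trans h2; apply: leq_trans (leq_pred _) _.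
have h3 : (a <= b.-1)%N by rewrite -ltnS prednK// (leq_trans a0 (ltnW ab)).
by apply: (knot_le ce_lt h3); exact: leq_trans (leq_pred _) bt.
Qed.

(** By [aligned] the cut divides the rows and the columns of its part in the same ratio, and each
    part carries equal row and column weight. *)
Lemma profile_cut_sum a b : (0 < a <= t)%N -> (b <= len a)%N ->
  \sum_(0 <= i < r a b) fP i = \sum_(0 <= j < c a b) fQ j.
Proof.
move=> ha hb.
rewrite (@step_fun_sum _ _ _ re0 re_lt _ a) ?(@step_fun_sum _ _ _ ce0 ce_lt _ a)//; last 2 first.
- by rewrite -c_first// -c_last// !c_mono ?hb ?leqnn.
- by rewrite -r_first// -r_last// !r_mono ?hb ?leqnn.
congr +%R; first by apply: eq_bigr => a' _; rewrite weight_balance.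
have e : (r a b - re a.-1)%N%:R * ma a = (c a b - ce a.-1)%N%:R * na a.
  by rewrite -!natrM aligned.
rewrite /row_weight /col_weight -!mulrA; congr *%R.
by rewrite [(_)^-1 * _]mulrC [(_)^-1 * (c a b - _)%N%:R]mulrC !mulrA [ma a * _]mulrC e [na a * _]mulrC.
Qed.

Lemma profile_level_sum k :
  \sum_(0 <= i < n | (rlev i <= k)%N) fP i = \sum_(0 <= j < m | (clev j <= k)%N) fQ j.
Proof.
case: (ltnP k (size cuts)) => hk; last first.
  have hr i : (rlev i <= k)%N by exact: leq_trans (count_size _ _) hk.
  have hc j : (clev j <= k)%N by exact: leq_trans (count_size _ _) hk.
  by rewrite (eq_bigl _ _ hr) (eq_bigl _ _ hc) row_profile_sum col_profile_sum.
have [p [pc hr hc]] := level_threshold cuts_chain hk.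
rewrite (eq_bigl _ _ hr) (eq_bigl _ _ hc).
have [a [b [ha hb pE]]] := cutsP pc.
have /andP[_ at_] := ha.
have h1 : (p.1 <= n)%N.
  rewrite pE -ret /=; apply: (@leq_trans (re a)); last exact: (knot_le re_lt).
  by rewrite -r_last// r_mono// hb leqnn.
have h2 : (p.2 <= m)%N.
  rewrite pE -cet /=; apply: (@leq_trans (ce a)); last exact: (knot_le ce_lt).
  by rewrite -c_last// c_mono// hb leqnn.
rewrite -(big_nat_widen _ _ _ predT)// -(big_nat_widen _ _ _ predT)//.
by rewrite pE profile_cut_sum.
Qed.

End Staircase.

Lemma conv_hull_segment (R : realType) (M : lmodType R) (S : set M) (x y : M) (s : R) :
  conv_hull S x -> conv_hull S y -> 0 < s < 1 -> conv_hull S ((1 - s) *: x + s *: y).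
Proof.
move=> Sx Sy /andP[s0 s1] T [cT0 ST].
have /convex_setW cT := cT0.
have Tx : T x by exact: (Sx T (conj cT0 ST)).
have Ty : T y by exact: (Sy T (conj cT0 ST)).
have := cT y x; rewrite !inE => /(_ Ty Tx (Itv01 (ltW s0) (ltW s1)) s0 s1).
by rewrite inE [(1 - s) *: _ + _]addrC.
Qed.

(* If the slopes were in the wrong order, the vertex would lie strictly below the chord of its
   neighbours, hence strictly between the origin and a point of this chord. *)
Lemma extreme_slope (R : realType) (S : set (R^o * R^o)) (x0 y0 x1 y1 x2 y2 : R) :
  conv_hull S 0 -> conv_hull S (x0, y0) -> conv_hull S (x2, y2) ->
  extreme_point (conv_hull S) (x1, y1) -> 0 <= x1 -> 0 <= y1 ->
  x1 < x0 -> y0 < y1 -> x2 < x1 -> y1 < y2 -> (x1, y1) <> (0, 0) :> R * R ->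
  (y2 - y1) * (x0 - x1) <= (y1 - y0) * (x1 - x2).
Proof.
move=> S0 Sx Sy [_ ext] hx hy h1 h2 h3 h4 n0; rewrite leNgt; apply/negP => hlt.
(* Up to a common factor [V], [U] and [W] below are the barycentric coordinates of the vertex with
   respect to its two neighbours and the origin: [U], [V] and [U + V + W] are the determinants of
   the pairs of points (0, 1), (1, 2) and (0, 2). *)
pose U := (x0 - x1) * y1 + (y1 - y0) * x1; pose V := (x1 - x2) * y1 + (y2 - y1) * x1.
have xy : 0 < x1 \/ 0 < y1.
  case: (ltrgt0P x1) hx => // [_ _|e _]; first by left.
  case: (ltrgt0P y1) hy => // [_ _|e' _]; first by right.
  by case: n0; rewrite e e'.
have U0 : 0 < U.
  by case: xy => h; rewrite /U; [apply: ltr_wpDl | apply: ltr_pwDl];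
    rewrite ?mulr_gt0 ?mulr_ge0 ?subr_gt0 ?subr_ge0 ?(ltW h1) ?(ltW h2).
have V0 : 0 < V.
  by case: xy => h; rewrite /V; [apply: ltr_wpDl | apply: ltr_pwDl];
    rewrite ?mulr_gt0 ?mulr_ge0 ?subr_gt0 ?subr_ge0 ?(ltW h3) ?(ltW h4).
pose W := (y2 - y1) * (x0 - x1) - (y1 - y0) * (x1 - x2).
have W0 : 0 < W by rewrite subr_gt0.
have UV0 : U + V != 0 by rewrite gt_eqF// addr_gt0.
have UVp := addr_gt0 U0 V0.
have UVW0 : U + V + W != 0 by rewrite gt_eqF// addr_gt0.
have s01 : 0 < U / (U + V) < 1.
  by rewrite divr_gt0 ?(addr_gt0 UVp)//= ltr_pdivrMr ?(addr_gt0 UVp)// mul1r ltrDl.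
have t01 : 0 < (U + V) / (U + V + W) < 1.
  by rewrite divr_gt0 ?(addr_gt0 UVp)//= ltr_pdivrMr ?(addr_gt0 UVp)// mul1r ltrDl.
have Sz := conv_hull_segment Sx Sy s01.
have mean (p0 p1 p2 : R) : p1 * (U + V + W) = V * p0 + U * p2 ->
    p1 = (1 - (U + V) / (U + V + W)) * 0 +
      (U + V) / (U + V + W) * ((1 - U / (U + V)) * p0 + U / (U + V) * p2).
  move=> e; have -> : p1 = (V * p0 + U * p2) / (U + V + W) by rewrite -e mulfK.
  by field; rewrite UVW0 UV0.
have e : (x1, y1) = (1 - (U + V) / (U + V + W)) *: (0 : R^o * R^o) + ((U + V) / (U + V + W)) *:
    ((1 - U / (U + V)) *: ((x0, y0) : R^o * R^o) + (U / (U + V)) *: ((x2, y2) : R^o * R^o)).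
  by congr pair; apply: mean; rewrite /U /V /W /=; ring.
by have [h _] := ext _ _ _ S0 Sz t01 e; apply: n0; rewrite -h.
Qed.

(** * Dimensions along a DM-flag *)

Section FlagProfile.
Variables (R : realType) (n m N : nat).
Local Notation C := R[i].
Variables (A : 'I_N -> 'M[C]_(n.+1, m.+1)) (F : dm_flag R n.+1 m.+1).
Hypothesis flagF : is_dm_flag A F.
Local Notation t := (dm_theta F).
Local Notation E := (dm_ext F).
Local Notation len := (dm_len F).
Implicit Types (a b i j : nat).

(** The spaces [X] occupy the last rows, hence the complement; row and column cuts both increase
    along the flag. *)
Definition row_cut a b := (n.+1 - \dim (dm_chain F a b).1)%N.
Definition col_cut a b := \dim (dm_chain F a b).2.
Definition row_knot a := (n.+1 - \dim (E a).1)%N.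
Definition col_knot a := \dim (E a).2.

Lemma dim_cV p : \dim {:'cV[C]_p} = p.
Proof. by rewrite dimvf /dim /= muln1. Qed.

Lemma dim_cV_le p (U : {vspace 'cV[C]_p}) : (\dim U <= p)%N.
Proof. by have := dimvS (subvf U); rewrite dim_cV. Qed.

Lemma ext_ends : E 0%N = (fullv, 0%VS) /\ E t = (0%VS, fullv).
Proof. by case: flagF. Qed.

Lemma theta_gt0 : (0 < t)%N.
Proof.
rewrite lt0n; apply/eqP => t0; have [e1 e2] := ext_ends.
move: e2; rewrite t0 e1 => /(congr1 (fun Z => \dim Z.1)) /=.
by rewrite dim_cV dimv0.
Qed.

Lemma row_knot0 : row_knot 0 = 0%N.
Proof. by rewrite /row_knot (proj1 ext_ends) /= dim_cV subnn. Qed.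

Lemma col_knot0 : col_knot 0 = 0%N.
Proof. by rewrite /col_knot (proj1 ext_ends) /= dimv0. Qed.

Lemma row_knot_theta : row_knot t = n.+1.
Proof. by rewrite /row_knot (proj2 ext_ends) /= dimv0 subn0. Qed.

Lemma col_knot_theta : col_knot t = m.+1.
Proof. by rewrite /col_knot (proj2 ext_ends) /= dim_cV. Qed.

Lemma row_knot_lt a : (a < t)%N -> (row_knot a < row_knot a.+1)%N.
Proof.
move=> ha; have [_ _ /(_ a ha)[s1 n1 _ _] _] := flagF.
have h : (\dim (E a.+1).1 < \dim (E a).1)%N.
  by rewrite ltn_neqAle dimvS// andbT; apply/eqP => e; apply: n1; apply/eqP; rewrite eqEdim s1 e leqnn.
by rewrite ltn_sub2l// (leq_trans h)// dim_cV_le.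
Qed.

Lemma col_knot_lt a : (a < t)%N -> (col_knot a < col_knot a.+1)%N.
Proof.
move=> ha; have [_ _ /(_ a ha)[_ _ s1 n1] _] := flagF.
rewrite /col_knot ltn_neqAle dimvS// andbT; apply/eqP => e.
by apply: n1; apply/eqP; rewrite eqEdim s1 e leqnn.
Qed.

Lemma chain_max a : (0 < a <= t)%N ->
  maximal_chain (vanishing_edge A (E a.-1) (E a)) (E a.-1) (E a) (len a) (dm_chain F a).
Proof. by move=> ha; case: flagF => _ _ _; exact. Qed.

Lemma row_cut_first a : (0 < a <= t)%N -> row_cut a 0 = row_knot a.-1.
Proof. by move=> /chain_max[e _ _ _ _]; rewrite /row_cut e. Qed.

Lemma col_cut_first a : (0 < a <= t)%N -> col_cut a 0 = col_knot a.-1.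
Proof. by move=> /chain_max[e _ _ _ _]; rewrite /col_cut e. Qed.

Lemma row_cut_last a : (0 < a <= t)%N -> row_cut a (len a) = row_knot a.
Proof. by move=> /chain_max[_ e _ _ _]; rewrite /row_cut e. Qed.

Lemma col_cut_last a : (0 < a <= t)%N -> col_cut a (len a) = col_knot a.
Proof. by move=> /chain_max[_ e _ _ _]; rewrite /col_cut e. Qed.

Lemma chain_vle a b b' : (0 < a <= t)%N -> (b <= b' <= len a)%N ->
  vle (dm_chain F a b) (dm_chain F a b').
Proof.
move=> /chain_max[_ _ _ hlt _] /andP[].
elim: b' => [|b' IH]; first by rewrite leqn0 => /eqP ->; split.
rewrite leq_eqVlt => /predU1P[->|]; first by split.
rewrite ltnS => h hb'; have [h1 h2] := IH h (ltnW hb').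
have [[h3 h4] _] := hlt _ hb'.
by split; [exact: subv_trans h3 h1 | exact: subv_trans h2 h4].
Qed.

Lemma row_cut_mono a b b' : (0 < a <= t)%N -> (b <= b' <= len a)%N ->
  (row_cut a b <= row_cut a b')%N.
Proof. by move=> ha hb; have [h _] := chain_vle ha hb; rewrite leq_sub2l// dimvS. Qed.

Lemma col_cut_mono a b b' : (0 < a <= t)%N -> (b <= b' <= len a)%N ->
  (col_cut a b <= col_cut a b')%N.
Proof. by move=> ha hb; have [_ h] := chain_vle ha hb; rewrite dimvS. Qed.

Lemma chain_edge a b : (0 < a <= t)%N -> (b <= len a)%N ->
  vanishing_edge A (E a.-1) (E a) (dm_chain F a b).
Proof. by move=> /chain_max[_ _ h _ _] hb; exact: h. Qed.

(** A chain member lies on its edge, so both of its coordinates have covered the same fraction [s]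
    of it; monotonicity makes the truncated subtractions exact. *)
Lemma cut_aligned a b : (0 < a <= t)%N -> (b <= len a)%N ->
  ((row_cut a b - row_knot a.-1) * (col_knot a - col_knot a.-1) =
   (col_cut a b - col_knot a.-1) * (row_knot a - row_knot a.-1))%N.
Proof.
move=> ha hb; have [_ [s s01 e]] := chain_edge ha hb.
have h1 : (row_knot a.-1 <= row_cut a b)%N by rewrite -row_cut_first// row_cut_mono.
have h2 : (col_knot a.-1 <= col_cut a b)%N by rewrite -col_cut_first// col_cut_mono.
have h3 : (row_knot a.-1 <= row_knot a)%N.
  by apply: leq_trans h1 _; rewrite -row_cut_last// row_cut_mono// hb leqnn.
have h4 : (col_knot a.-1 <= col_knot a)%N.
  by apply: leq_trans h2 _; rewrite -col_cut_last// col_cut_mono// hb leqnn.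
apply/eqP; rewrite -(eqr_nat R) !natrM (natrB _ h1) (natrB _ h2) (natrB _ h3) (natrB _ h4).
rewrite /row_cut /row_knot /col_cut /col_knot !(natrB _ (dim_cV_le _)).
move: e => [e1 e2]; apply/eqP.
have {}e1 : (\dim (dm_chain F a b).1)%:R = (1 - s) * (\dim (E a.-1).1)%:R + s * (\dim (E a).1)%:R :> R by exact: e1.
have {}e2 : (\dim (dm_chain F a b).2)%:R = (1 - s) * (\dim (E a.-1).2)%:R + s * (\dim (E a).2)%:R :> R by exact: e2.
rewrite e1 e2; ring.
Qed.

Lemma ext_extreme a : (a <= t)%N -> vanishing_extreme A (E a).
Proof. by move=> ha; case: flagF => h _ _ _; apply/h; exists a. Qed.

Lemma ext_hull a : (a <= t)%N -> conv_hull (@phi R n.+1 m.+1 @` vanishing A) (phi (E a)).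
Proof. by move=> /ext_extreme[_ [h _] _]. Qed.

Lemma zero_hull : conv_hull (@phi R n.+1 m.+1 @` vanishing A) (0 : R^o * R^o).
Proof.
apply: sub_gen_smallest; exists (0%VS, 0%VS); last by rewrite /phi /= !dimv0.
by move=> u v l; rewrite !memv0 => /eqP -> _; rewrite trmx0 !mul0mx.
Qed.

Lemma knot_slope a : (0 < a < t)%N ->
  ((col_knot a.+1 - col_knot a) * (row_knot a - row_knot a.-1) <=
   (col_knot a - col_knot a.-1) * (row_knot a.+1 - row_knot a))%N.
Proof.
move=> /andP[a0 at_].
have at1 : (a.-1 < t)%N := leq_ltn_trans (leq_pred a) at_.
have := col_knot_lt at_; have := col_knot_lt at1; have := row_knot_lt at_; have := row_knot_lt at1.
rewrite prednK// => r1 r2 c1 c2.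
have [_ hext hn0] := ext_extreme (ltnW at_).
have := extreme_slope zero_hull (ext_hull (ltnW at1)) (ext_hull at_) hext _ _ _ _ _ _ hn0.
rewrite -(ler_nat R) !natrM (natrB _ (ltnW r1)) (natrB _ (ltnW r2)) (natrB _ (ltnW c1)) (natrB _ (ltnW c2)).
move: r1 r2 c1 c2; rewrite -!(ltr_nat R) /row_knot !(natrB _ (dim_cV_le _)) /col_knot => r1 r2 c1 c2.
have -> : n.+1%:R - (\dim (E a).1)%:R - (n.+1%:R - (\dim (E a.-1).1)%:R) =
  (\dim (E a.-1).1)%:R - (\dim (E a).1)%:R :> R by ring.
have -> : n.+1%:R - (\dim (E a.+1).1)%:R - (n.+1%:R - (\dim (E a).1)%:R) =
  (\dim (E a).1)%:R - (\dim (E a.+1).1)%:R :> R by ring.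
rewrite ltrD2l ltrN2 in r1; rewrite ltrD2l ltrN2 in r2.
by apply.
Qed.

End FlagProfile.

Lemma card_ord_interval p x y : (y <= p)%N ->
  #|[set i : 'I_p | (x <= i < y)%N]%SET| = (y - x)%N.
Proof.
move=> yp; rewrite -sum1_card (eq_bigl (fun i : 'I_p => (x <= i < y)%N)); last first.
  by move=> i; rewrite inE.
rewrite -(big_mkord (fun i => (x <= i < y)%N) (fun=> 1%N)).
rewrite -(big_nat_widen _ _ _ (fun i => (x <= i)%N))//.
have -> : (\sum_(0 <= i < y | x <= i) 1 = \sum_(x <= i < y) 1)%N.
  by rewrite [RHS](big_nat_widenl x 0).
by rewrite sum_nat_const_nat muln1.
Qed.

Section FlagBlocks.
Variables (R : realType) (n m N : nat).
Local Notation C := R[i].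
Variables (A : 'I_N -> 'M[C]_(n.+1, m.+1)) (F : dm_flag R n.+1 m.+1).
Hypothesis flagF : is_dm_flag A F.
Local Notation t := (dm_theta F).
Local Notation len := (dm_len F).
Implicit Types (a b k : nat).

Lemma rpartE a : (0 < a <= t)%N ->
  rpart F a = [set i : 'I_n.+1 | (row_knot F a.-1 <= i < row_knot F a)%N]%SET.
Proof.
move=> ha; rewrite -(row_cut_first flagF ha) -(row_cut_last flagF ha) /rpart.
have : (len a <= len a)%N by [].
elim: {1 3 4}(len a) => [|k IH] hk.
  by rewrite big_geq//; apply/setP => i; rewrite !inE; case: leqP => // h; rewrite ltnNge (ltnW h).
rewrite big_nat_recr//= IH ?(ltnW hk)//; apply/setP => i; rewrite !inE /=.
have h1 : (row_cut F a 0 <= row_cut F a k)%N by apply: (row_cut_mono flagF ha); rewrite (ltnW hk).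
have h2 : (row_cut F a k <= row_cut F a k.+1)%N.
  by apply: (row_cut_mono flagF ha); rewrite leqnSn.
rewrite -/(row_cut F a k) -/(row_cut F a k.+1).
case: (ltnP i (row_cut F a k)) => h3; last by rewrite andbF (leq_trans h1 h3).
by rewrite (leq_trans h3 h2) orbF.
Qed.

Lemma cpartE a : (0 < a <= t)%N ->
  cpart F a = [set j : 'I_m.+1 | (col_knot F a.-1 <= j < col_knot F a)%N]%SET.
Proof.
move=> ha; rewrite -(col_cut_first flagF ha) -(col_cut_last flagF ha) /cpart.
have : (len a <= len a)%N by [].
elim: {1 3 4}(len a) => [|k IH] hk.
  by rewrite big_geq//; apply/setP => i; rewrite !inE; case: leqP => // h; rewrite ltnNge (ltnW h).
rewrite big_nat_recr//= IH ?(ltnW hk)//; apply/setP => i; rewrite !inE /=.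
have h1 : (col_cut F a 0 <= col_cut F a k)%N by apply: (col_cut_mono flagF ha); rewrite (ltnW hk).
have h2 : (col_cut F a k <= col_cut F a k.+1)%N.
  by apply: (col_cut_mono flagF ha); rewrite leqnSn.
rewrite -/(col_cut F a k) -/(col_cut F a k.+1).
case: (ltnP i (col_cut F a k)) => h3; last by rewrite andbF (leq_trans h1 h3).
by rewrite (leq_trans h3 h2) orbF.
Qed.

Lemma card_rpart a : (0 < a <= t)%N -> #|rpart F a| = (row_knot F a - row_knot F a.-1)%N.
Proof. by move=> ha; rewrite rpartE// card_ord_interval// leq_subr. Qed.

Lemma card_cpart a : (0 < a <= t)%N -> #|cpart F a| = (col_knot F a - col_knot F a.-1)%N.
Proof. by move=> ha; rewrite cpartE// card_ord_interval// dim_cV_le. Qed.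

Lemma dm_constE : dm_const F = profile_const R t (row_knot F) (col_knot F).
Proof.
by apply: eq_big_nat => a ha; rewrite card_rpart ?card_cpart.
Qed.

Lemma pstarE i : (pstar F + const_mx n.+1%:R^-1) 0 i =
  step_fun t (row_knot F) (row_weight R t (row_knot F) (col_knot F)) i.
Proof.
rewrite /pstar addrAC addNr add0r mxE summxE mulr_sumr; apply: eq_big_nat => a ha.
by rewrite !mxE dm_constE card_rpart// card_cpart// rpartE// inE mulrA.
Qed.

Lemma qstarE j : (qstar F + const_mx m.+1%:R^-1) 0 j =
  step_fun t (col_knot F) (col_weight R t (row_knot F) (col_knot F)) j.
Proof.
rewrite /qstar addrAC addNr add0r mxE summxE mulr_sumr; apply: eq_big_nat => a ha.
by rewrite !mxE dm_constE card_rpart// card_cpart// cpartE// inE mulrA.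
Qed.

Local Notation flag_cuts := (cuts t len (row_cut F) (col_cut F)).

Variable B : 'I_N -> 'M[C]_(n.+1, m.+1).

Lemma diagonalizedE : diagonalized F B =
  block_diag (fun i : 'I_n.+1 => row_level flag_cuts i) (fun j : 'I_m.+1 => col_level flag_cuts j) B.
Proof.
apply/funext => l; apply/matrixP => i j; rewrite !mxE; congr (if _ then _ else _).
have h := same_levelP (row_knot0 flagF) (row_knot_theta flagF) (row_knot_lt flagF)
  (col_knot_lt flagF) (row_cut_first flagF) (col_cut_first flagF) (row_cut_last flagF)
  (col_cut_last flagF) (row_cut_mono flagF) (col_cut_mono flagF) (ltn_ord i) (ltn_ord j).
apply/asboolP/eqP => [[a [b [ha hb]]]|/h[a [b [ha hb h1 h2]]]].
  by rewrite !inE => h1 h2; apply/h; exists a, b.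
by exists a, b; rewrite !inE.
Qed.

(** Below the block diagonal some cut separates [i] from [j], so row [i] of [g] lies in an [X] and
    row [j] of [h] in the matching [Y], on which [A] vanishes. *)
Lemma dm_block_upper : is_dm_decomposition A F B ->
  block_upper (fun i : 'I_n.+1 => row_level flag_cuts i) (fun j : 'I_m.+1 => col_level flag_cuts j) B.
Proof.
move=> [g [h [ug uh gh ->]]] l i j /level_lt[_ [/cutsP[a [b [ha hb ->]]] /= hi hj]].
have [bX bY] := gh a b ha hb; have [van _] := chain_edge flagF ha hb.
have iX : (row i g)^T \in (dm_chain F a b).1.
  by apply: (basis_mem bX); apply/mapP; exists i; rewrite // mem_filter mem_enum andbT.
have jY : (row j h)^T \in (dm_chain F a b).2.
  by apply: (basis_mem bY); apply/mapP; exists j; rewrite // mem_filter mem_enum andbT.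
have := van _ _ l iX jY; rewrite trmxK => e.
have -> : act g h A l i j = (row i g *m A l *m map_mx Num.Def.conjC (row j h)^T) 0 0.
  rewrite /act !mxE; apply: eq_bigr => k _; rewrite !mxE; congr (_ * _).
  by apply: eq_bigr => k' _; rewrite !mxE.
by rewrite e mxE.
Qed.

End FlagBlocks.

Lemma det_unitary_norm (R : realType) p (U : 'M[R[i]]_p) : U \is unitarymx -> `|\det U| = 1.
Proof.
move=> /unitarymxP h; have : \det U * (\det U)^* = 1.
  by rewrite -{2}(det_tr U) -det_map_mx -det_mulmx h det1.
rewrite -normCK => /eqP; rewrite sqrf_eq1 => /orP[/eqP //|/eqP e].
by have := normr_ge0 (\det U); rewrite e lerNr oppr0 ler10.
Qed.

(** The scalar is a root of the inverse determinant, of modulus 1. *)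
Lemma unitary_unimodular (R : realType) p (U : 'M[R[i]]_p.+1) : U \is unitarymx ->
  exists2 c : R[i], c != 0 & SU R p.+1 (c *: U).
Proof.
move=> uU; have dU := det_unitary_norm uU.
have dU0 : \det U != 0 by rewrite -normr_gt0 dU ltr01.
have [c cE] : exists c : R[i], c = p.+1.-root (\det U)^-1 by eexists.
have cp : c ^+ p.+1 = (\det U)^-1 by rewrite cE rootCK.
have c1 : `|c| = 1.
  by apply/eqP; rewrite -(pexpr_eq1 (n := p.+1))// -normrX cp normfV dU invr1.
exists c; first by rewrite -normr_gt0 c1 ltr01.
split; last by rewrite detZ cp mulVf.
apply/unitarymxP.
have -> : (c *: U) ^t* = c^* *: U ^t* by apply/matrixP => i j; rewrite !mxE rmorphM.
rewrite -scalemxAl -scalemxAr scalerA -normCK c1 expr1n scale1r.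
exact/unitarymxP.
Qed.

Section FlagLimit.
Variables (R : realType) (n m N : nat).
Local Notation C := R[i].
Variables (A : 'I_N -> 'M[C]_(n.+1, m.+1)) (F : dm_flag R n.+1 m.+1).
Hypothesis flagF : is_dm_flag A F.
Variables (B Bstar : 'I_N -> 'M[C]_(n.+1, m.+1)).
Hypothesis decB : is_dm_decomposition A F B.
Hypothesis scaleB : is_scaling (pstar F + const_mx n.+1%:R^-1)
  (qstar F + const_mx m.+1%:R^-1) (diagonalized F B) Bstar.
Local Notation P := (pstar F + const_mx n.+1%:R^-1).
Local Notation Q := (qstar F + const_mx m.+1%:R^-1).
Local Notation flag_cuts := (cuts (dm_theta F) (dm_len F) (row_cut F) (col_cut F)).

Let t0 := theta_gt0 flagF.
Let r0 := row_knot0 flagF.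
Let c0 := col_knot0 flagF.
Let rt := row_knot_theta flagF.
Let ct := col_knot_theta flagF.
Let rlt := row_knot_lt flagF.
Let clt := col_knot_lt flagF.
Let rf := row_cut_first flagF.
Let cf := col_cut_first flagF.
Let rl := row_cut_last flagF.
Let cl := col_cut_last flagF.
Let rm := row_cut_mono flagF.
Let cm := col_cut_mono flagF.
Let slope := knot_slope flagF.
Let al := cut_aligned flagF.

Lemma pstar_sum : \sum_i P 0 i = 1.
Proof.
have := row_profile_sum R t0 r0 rt rlt clt; rewrite big_mkord; apply: etrans.
by apply: eq_bigr => i _; exact: (pstarE flagF).
Qed.

Lemma qstar_sum : \sum_j Q 0 j = 1.
Proof.
have := col_profile_sum R t0 r0 c0 rt ct rlt clt; rewrite big_mkord; apply: etrans.
by apply: eq_bigr => i _; exact: (qstarE flagF).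
Qed.

Lemma nsq_flag_gt0 : 0 < nsq A.
Proof.
case: decB => g0 [h0 [ug0 uh0 _ BE]]; case: scaleB => g [h [ug uh]].
rewrite (diagonalizedE flagF) => BsE Bsl Bsr.
exact: (nsq_A_gt0 pstar_sum BE BsE Bsl).
Qed.

Lemma flag_limit_in_orbit (G : set_system nat) (GU : UltraFilter G) y :
  (forall K : nat, G (fun k => (K <= k)%N)) ->
  tcvg G (fun k => tscale (Num.sqrt (nsq (iterate A k)))^-1 (iterate A k)) y ->
  exists U V, [/\ U \is unitarymx, V \is unitarymx & y = act U V Bstar].
Proof.
move=> Goo hy.
case: (decB) => g0 [h0 [ug0 uh0 _ BE]]; case: scaleB => g [h [ug uh]].
rewrite (diagonalizedE flagF) => BsE Bsl Bsr.
apply: (limit_in_orbit (rb := fun i : 'I_n.+1 => row_level flag_cuts i)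
  (cb := fun j : 'I_m.+1 => col_level flag_cuts j) (P := P) (Q := Q)
  (kappa := (dm_const F)^-1)
  _ _ pstar_sum qstar_sum _ _ _ _ _ _ _ ug0 uh0 BE (dm_block_upper flagF decB) ug uh
  BsE Bsl Bsr GU Goo hy).
- by move=> i j; exact: row_level_le.
- by move=> i j; exact: col_level_le.
- rewrite (dm_constE flagF) -(@profile_sumsq R _ _ _ _ _ t0 r0 c0 rt ct rlt clt) !big_mkord.
  by congr +%R; apply: eq_bigr => i _; rewrite ?(pstarE flagF) ?(qstarE flagF).
- move=> i j h1; rewrite (pstarE flagF) (qstarE flagF) (dm_constE flagF).
  exact: (profile_ge R t0 r0 c0 rt ct rlt clt rf cf rl cl rm cm slope (ltn_ord i) (ltn_ord j) h1).
- move=> k; have := profile_level_sum R t0 r0 c0 rt ct rlt clt rf cf rl cl rm cm al k.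
  rewrite !big_mkord => e.
  transitivity (\sum_(i < n.+1 | (row_level flag_cuts i <= k)%N)
      step_fun (dm_theta F) (row_knot F) (row_weight R (dm_theta F) (row_knot F) (col_knot F)) i).
    by apply: eq_bigr => i _; exact: (pstarE flagF).
  by rewrite e; apply: eq_bigr => j _; exact/esym/(qstarE flagF).
- move=> i j ij; rewrite !(pstarE flagF).
  exact: (row_profile_ge R t0 r0 rt rlt clt slope ij (ltn_ord j)).
- move=> i j ij; rewrite !(qstarE flagF).
  exact: (col_profile_le R t0 c0 ct rlt clt slope ij (ltn_ord j)).
- move=> i j e; rewrite !(pstarE flagF).
  exact: (row_profile_level R r0 rt rlt rl cl (ltn_ord i) e).
- move=> i j e; rewrite !(qstarE flagF).
  exact: (col_profile_level R c0 ct clt rl cl (ltn_ord i) e).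
Qed.

End FlagLimit.

Theorem theorem4p27 (R : realType) (n m N : nat)
    (A : 'I_N.+1 -> 'M[R[i]]_(n.+1, m.+1))
    (kerA : forall v : 'cV_m.+1, (forall l, A l *m v = 0) -> v = 0)
    (kerAt : forall u : 'cV_n.+1, (forall l, (A l) ^t* *m u = 0) -> u = 0)
    (not_scalable : ~ uniform_scalable A)
    (F : dm_flag R n.+1 m.+1) (flagF : is_dm_flag A F)
    (B : 'I_N.+1 -> 'M[R[i]]_(n.+1, m.+1)) (decB : is_dm_decomposition A F B)
    (Bstar : 'I_N.+1 -> 'M[R[i]]_(n.+1, m.+1))
    (scaleB : is_scaling (pstar F + const_mx n.+1%:R^-1)
                (qstar F + const_mx m.+1%:R^-1) (diagonalized F B) Bstar) :
  cluster ((fun k => pclass (act (descent 2 A k).1 (descent 2 A k).2 A)) @ \oo)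
    `<=` [set pclass (act sigma tau Bstar) | sigma in SU R n.+1 & tau in SU R m.+1].
Proof.
move=> p hp; have A0 := nsq_flag_gt0 flagF decB scaleB.
have [G [GU [y [Goo y0 hy ->]]]] := cluster_pclass (fun k => iterate_gt0 k A0) hp.
have [U [V [uU uV yE]]] := flag_limit_in_orbit flagF decB scaleB GU Goo hy.
(* Passing to determinant one multiplies the tuple by [c] times the conjugate of [d], which its
   projective class ignores. *)
have [c c0 cU] := unitary_unimodular uU; have [d d0 dV] := unitary_unimodular uV.
exists (c *: U); first exact: cU.
exists (d *: V); first exact: dV.
apply: (@pclass_eq _ _ _ _ _ _ (c * d^*) y0); first by rewrite mulf_neq0 ?conjC_eq0.
move=> l; rewrite yE /act.
have -> : (d *: V) ^t* = d^* *: V ^t* by apply/matrixP => i j; rewrite !mxE rmorphM.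
by rewrite -scalemxAr -!scalemxAl scalerA mulrC.
Qed.
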